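(* Let $J(a,b):=\int_0^1\zeta_1(a,x)\,\zeta_1(b,1-x)\,dx$ for $a,b\in\mathbb{C}\setminus\{1\}$. When $0<\Re(a)<1$ and $0<\Re(b)<1$, $$J(a,b)=B(1-a,1-b)\{\zeta(a+b-1)-1\}-\sum_{n=0}^\infty\frac{(a)_n}{n!}\,\frac{\zeta(a+n)-1}{n+1-b}-\sum_{n=0}^\infty\frac{(b)_n}{n!}\,\frac{\zeta(b+n)-1}{n+1-a}.$$ Moreover, this formula provides the analytic continuation of $J(a,b)$ into $\Re(a)>1$, $\Re(b)>1$: the same identity holds for all $a,b$ with $\Re(a)>1$, $\Re(b)>1$ and $a,b\notin\{2,3,4,\ldots\}$. On $\Re(a)>0$, $\Re(b)>0$, $J(a,b)$ is an analytic function of $a$ and $b$ except at $a=1$ and $b=1$, and there is a double pole at $a=b=1$ (that is, $a\mapsto J(a,a)$ has a double pole at $a=1$).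
   Context: The auxiliary Hurwitz zeta function is $\zeta_1(a,x)=\zeta(a,x+1)$ for $x\in[0,1]$ and $a\in\mathbb{C}\setminus\{1\}$, where $\zeta(a,y)$ is the Hurwitz zeta function, equal to $\sum_{k\ge 0}(k+y)^{-a}$ for $\Re(a)>1$ and defined by analytic continuation in $a$ elsewhere (simple pole with residue $1$ at $a=1$). For $x\in(0,1]$, $\zeta_1(a,x)=\zeta(a,x)-x^{-a}$. $\zeta(s)$ is the Riemann zeta function (analytically continued), $(c)_n=c(c+1)\cdots(c+n-1)$ (with $(c)_0=1$) is the Pochhammer symbol, and $B(x,y)=\Gamma(x)\Gamma(y)/\Gamma(x+y)$ is the beta function (extended meromorphically through gamma functions). *)

(* Defs.v *)
From Stdlib Require Import Reals Factorial ClassicalEpsilon.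
From Coquelicot Require Import Coquelicot.

Open Scope C_scope.

(** * Elementary complex functions *)

Definition Cexp (z : C) : C := RtoC (exp (Re z)) * (cos (Im z), sin (Im z)).

(** [x ^ s = exp (s ln x)]; used for [0 < x] only. *)
Definition Rcpow (x : R) (s : C) : C := Cexp (s * RtoC (ln x)).

Definition Clim_seq (u : nat -> C) : C :=
  (real (Lim_seq (fun n => Re (u n))), real (Lim_seq (fun n => Im (u n)))).

Fixpoint Cpochhammer (c : C) (n : nat) : C :=
  match n with
  | O => 1
  | S m => Cpochhammer c m * (c + RtoC (INR m))
  end.

(** * Analyticity *)

Definition analytic_at (f : C -> C) (z0 : C) : Prop :=
  exists (c : nat -> C) (r : R), (0 < r)%R /\
    forall z : C, (Cmod (z - z0) < r)%R ->
      @is_pseries C_AbsRing C_NormedModule c (z - z0) (f z).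

(** Joint analyticity of a function of two complex variables.  The bound on the
    coefficients makes the double power series absolutely convergent on the
    polydisc of radius [r], so that summing it as an iterated series is
    harmless. *)
Definition analytic2_at (f : C -> C -> C) (a0 b0 : C) : Prop :=
  exists (c : nat -> nat -> C) (r M : R), (0 < r)%R /\
    (forall m n : nat, (Cmod (c m n) * r ^ m * r ^ n <= M)%R) /\
    forall a b : C, (Cmod (a - a0) < r)%R -> (Cmod (b - b0) < r)%R ->
      exists s : nat -> C,
        (forall m : nat,
           @is_pseries C_AbsRing C_NormedModule (c m) (b - b0) (s m)) /\
        @is_pseries C_AbsRing C_NormedModule s (a - a0) (f a b).

(** A pole of exact order [m] at [z0]; the value [f z0] is irrelevant. *)
Definition has_pole_of_order (m : nat) (f : C -> C) (z0 : C) : Prop :=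
  exists (g : C -> C) (r : R), (0 < r)%R /\ analytic_at g z0 /\ g z0 <> 0 /\
    forall z : C, (0 < Cmod (z - z0) < r)%R -> f z = g z / (z - z0) ^ m.

(** * Gamma and beta functions *)

(** The entire function [1 / Gamma], by the Euler-Gauss limit
    [1 / Gamma z = lim z (z+1) ... (z+n) / (n! n^z)].
    The index is shifted by one so that [n <> 0]. *)
Definition Crgamma (z : C) : C :=
  Clim_seq (fun n =>
    Cpochhammer z (S (S n))
    / (RtoC (INR (fact (S n))) * Rcpow (INR (S n)) z)).

Definition Cgamma (z : C) : C := / Crgamma z.

(** [Gamma x Gamma y / Gamma (x + y)], meromorphically extended: multiplying by
    the entire function [1 / Gamma] gives the correct value [0] when [x + y] is
    a pole of [Gamma] and [x], [y] are not. *)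
Definition Cbeta (x y : C) : C := Cgamma x * Cgamma y * Crgamma (x + y).

(** * Zeta functions *)

(** [h] is the analytic continuation in [a], to [C \ {1}], of the series
    [sum_(k >= 0) (k + y)^(-a)], [Re a > 1]. *)
Definition is_hurwitz_zeta (y : R) (h : C -> C) : Prop :=
  (forall a : C, a <> 1 -> analytic_at h a) /\
  (forall a : C, (1 < Re a)%R ->
     @is_series C_AbsRing C_NormedModule
       (fun k : nat => Rcpow (INR k + y) (- a)) (h a)).

(** Meaningful for [0 < y] and [a <> 1], where the continuation exists and its
    value at [a] is unique. *)
Definition hurwitz_zeta (a : C) (y : R) : C :=
  epsilon (inhabits (fun _ : C => RtoC 0)) (is_hurwitz_zeta y) a.

Definition riemann_zeta (s : C) : C := hurwitz_zeta s 1.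

Definition zeta1 (a : C) (x : R) : C := hurwitz_zeta a (x + 1).

(** * The integral [J] and its expansion *)

Definition J_integrand (a b : C) (x : R) : C := zeta1 a x * zeta1 b (1 - x).

Definition J (a b : C) : C :=
  @RInt C_R_CompleteNormedModule (J_integrand a b) 0 1.

Definition J_series_term (a b : C) (n : nat) : C :=
  Cpochhammer a n / RtoC (INR (fact n))
  * ((riemann_zeta (a + RtoC (INR n)) - 1) / (RtoC (INR n) + 1 - b)).

(** Both series converge, and the closed formula for [J a b] holds. *)
Definition J_expansion (a b : C) : Prop :=
  exists S1 S2 : C,
    @is_series C_AbsRing C_NormedModule (J_series_term a b) S1 /\
    @is_series C_AbsRing C_NormedModule (J_series_term b a) S2 /\
    J a b = Cbeta (1 - a) (1 - b) * (riemann_zeta (a + b - 1) - 1) - S1 - S2.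

(* Main.v *)
Require Import Defs.
From Stdlib Require Import Reals Factorial Lra Lia ClassicalEpsilon.
From Coquelicot Require Import Coquelicot.

(* Euler summation turns [(s - 1) zeta(s, y)] into an entire function [Phi s y]
   of [s].  Analyticity is handled through power series whose coefficients are
   continuous in a parameter and have summable sup norms: these form a Banach
   algebra stable under integration in the parameter, so [J], being
   [int Phi Phi / ((a - 1) (b - 1))], is analytic away from [a = 1] and [b = 1],
   and [Phi 1 y = 1] gives the double pole.

   For [Re a, Re b > 1], multiplying the two Dirichlet series and substituting
   [u = j + x], [m = j + k + 1] gives
   [J(a, b) = sum_(m >= 2) int_1^(m-1) u^(-a) (m-u)^(-b) du].
   Each term is [m^(1-a-b) B(1-a, 1-b)] minus the two end pieces, continued in
   the exponents by their binomial expansions in [1/m]; the continued identity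
   propagates from negative exponents by the recurrence [a - 1 -> a].  Summing
   over [m] yields the expansion.

   For [0 < Re a, Re b < 1], both sides are analytic along a segment from
   [(a, b)] to [(a + 1 + i tau, b + 1 + i tau)] and agree near its end. *)

(** * Complex series *)

Section Basics.
Local Open Scope R_scope.

(** The zeta functions are introduced by a choice operator, so nothing is known about their values
    until existence and uniqueness of the continuation are settled; hence the identity theorem comes
    before them. The terms of the expansion arise from the sum over [m]: the binomial expansion of
    an end piece contains [m] only through [m^(-b-n)], whose sum over [m >= 2] is [zeta(b+n) - 1],
    while [m^(1-a-b)] yields [zeta(a+b-1) - 1]. In the strip neither Dirichlet series converges, so
    nothing can be summed there directly. A segment of real direction from the strip to the
    half-planes may meet the poles at [a = 1], [b = 1] and [a + b = 2]; the slope [tau] avoids them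
    all, and restriction to a segment reduces the continuation in two variables to one variable.
    Analyticity of the Gamma function is never established: the beta factor is analytic because the
    decomposition at [m = 2], where the middle integral is empty, expresses it by the two end
    pieces. *)

Definition Cser (u : nat -> C) (l : C) : Prop :=
  @is_series C_AbsRing C_NormedModule u l.

Definition Csum (u : nat -> C) : C :=
  (Series (fun n => Re (u n)), Series (fun n => Im (u n))).

Definition Clim (u : nat -> C) (l : C) : Prop :=
  is_lim_seq (fun n => Cmod (u n - l)%C) 0.

Lemma im_le_Cmod (z : C) : Rabs (Im z) <= Cmod z.
Proof.
  eapply Rle_trans; [| apply Rmax_Cmod]. apply Rmax_r.
Qed.

Lemma Cmod_le_re_im (z : C) : Cmod z <= Rabs (Re z) + Rabs (Im z).
Proof.
  replace z with (RtoC (Re z) + Ci * RtoC (Im z))%C at 1.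
  - eapply Rle_trans; [apply Cmod_triangle|].
    rewrite Cmod_mult, Cmod_Ci, !Cmod_R. lra.
  - destruct z as [x y]; unfold Re, Im, Ci, RtoC, Cmult, Cplus; simpl.
    f_equal; ring.
Qed.

Lemma Clim_re_im (u : nat -> C) (l : C) :
  Clim u l <-> (is_lim_seq (fun n => Re (u n)) (Re l) /\
                is_lim_seq (fun n => Im (u n)) (Im l)).
Proof.
  unfold Clim; split.
  - intros H; split; apply is_lim_seq_spec; apply is_lim_seq_spec in H;
    intros eps; destruct (H eps) as [N HN]; exists N; intros n Hn;
    specialize (HN n Hn); rewrite Rminus_0_r, (Rabs_pos_eq _ (Cmod_ge_0 _)) in HN;
    eapply Rle_lt_trans; try exact HN.
    + replace (Re (u n) - Re l) with (Re (u n - l)%C) by reflexivity.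
      apply re_le_Cmod.
    + replace (Im (u n) - Im l) with (Im (u n - l)%C) by reflexivity.
      apply im_le_Cmod.
  - intros [H1 H2].
    apply is_lim_seq_le_le with (u := fun _ => 0)
      (w := fun n => Rabs (Re (u n) - Re l) + Rabs (Im (u n) - Im l)).
    + intros n; split; [apply Cmod_ge_0|]. apply Cmod_le_re_im.
    + apply is_lim_seq_const.
    + replace (Finite 0) with (Rbar_plus (Finite 0) (Finite 0)) by (simpl; f_equal; ring).
      apply is_lim_seq_plus'; apply -> is_lim_seq_abs_0.
      * replace 0 with (Re l - Re l) by ring. apply is_lim_seq_minus'; auto.
        apply is_lim_seq_const.
      * replace 0 with (Im l - Im l) by ring. apply is_lim_seq_minus'; auto.
        apply is_lim_seq_const.
Qed.

Lemma Clim_unique (u : nat -> C) (l1 l2 : C) : Clim u l1 -> Clim u l2 -> l1 = l2.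
Proof.
  intros H1 H2; apply Clim_re_im in H1; apply Clim_re_im in H2.
  destruct H1 as [A1 B1], H2 as [A2 B2].
  apply is_lim_seq_unique in A1, B1, A2, B2.
  rewrite A1 in A2; rewrite B1 in B2.
  destruct l1, l2; simpl in *. injection A2; injection B2; intros; subst; reflexivity.
Qed.

Lemma Clim_seq_correct (u : nat -> C) (l : C) : Clim u l -> Clim_seq u = l.
Proof.
  intros H; apply Clim_re_im in H; destruct H as [A B]; unfold Clim_seq.
  rewrite (is_lim_seq_unique _ _ A), (is_lim_seq_unique _ _ B).
  destruct l; reflexivity.
Qed.

Lemma Clim_filterlim (u : nat -> C) (l : C) :
  Clim u l <-> @filterlim nat C_UniformSpace u eventually (locally l).
Proof.
  split.
  - intros H P [eps HP].
    apply is_lim_seq_spec in H; destruct (H eps) as [N HN].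
    exists N; intros n Hn; apply HP.
    specialize (HN n Hn); rewrite Rminus_0_r, (Rabs_pos_eq _ (Cmod_ge_0 _)) in HN.
    apply C_NormedModule_mixin_compat1. exact HN.
  - intros H. apply Clim_re_im; split; intros P [eps HP].
    + destruct (H (fun z => P (Re z))) as [N HN].
      * exists eps; intros z [Hz _]; apply HP; exact Hz.
      * exists N; exact HN.
    + destruct (H (fun z => P (Im z))) as [N HN].
      * exists eps; intros z [_ Hz]; apply HP; exact Hz.
      * exists N; exact HN.
Qed.

Lemma Cser_Clim (u : nat -> C) (l : C) : Cser u l <-> Clim (fun N => @sum_n C_AbelianMonoid u N) l.
Proof. symmetry; apply Clim_filterlim. Qed.

Lemma re_sum_n (u : nat -> C) (N : nat) :
  Re (@sum_n C_AbelianMonoid u N) = sum_n (fun n => Re (u n)) N.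
Proof.
  induction N; [rewrite !sum_O; reflexivity|]. rewrite !sum_Sn, <- IHN. reflexivity.
Qed.

Lemma im_sum_n (u : nat -> C) (N : nat) :
  Im (@sum_n C_AbelianMonoid u N) = sum_n (fun n => Im (u n)) N.
Proof.
  induction N; [rewrite !sum_O; reflexivity|]. rewrite !sum_Sn, <- IHN. reflexivity.
Qed.

Lemma Cser_re_im (u : nat -> C) (l : C) :
  Cser u l <-> (is_series (fun n => Re (u n)) (Re l) /\ is_series (fun n => Im (u n)) (Im l)).
Proof.
  rewrite Cser_Clim, Clim_re_im; split; intros [A B]; split.
  - exact (is_lim_seq_ext _ _ _ (re_sum_n u) A).
  - exact (is_lim_seq_ext _ _ _ (im_sum_n u) B).
  - exact (is_lim_seq_ext _ _ (Re l) (fun n => eq_sym (re_sum_n u n)) A).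
  - exact (is_lim_seq_ext _ _ (Im l) (fun n => eq_sym (im_sum_n u n)) B).
Qed.

Lemma Cser_unique (u : nat -> C) (l1 l2 : C) : Cser u l1 -> Cser u l2 -> l1 = l2.
Proof. rewrite !Cser_Clim; apply Clim_unique. Qed.

Lemma Csum_eq (u : nat -> C) (l : C) : Cser u l -> Csum u = l.
Proof.
  intros H; apply Cser_re_im in H; destruct H as [A B]; unfold Csum.
  rewrite (is_series_unique _ _ A), (is_series_unique _ _ B). destruct l; reflexivity.
Qed.

Lemma Cser_ext (u v : nat -> C) (l : C) : (forall n, u n = v n) -> Cser u l -> Cser v l.
Proof. intros H; apply is_series_ext; exact H. Qed.

Lemma Cser_plus (u v : nat -> C) (l m : C) :
  Cser u l -> Cser v m -> Cser (fun n => u n + v n)%C (l + m)%C.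
Proof. intros A B; exact (@is_series_plus C_AbsRing C_NormedModule u v l m A B). Qed.

Lemma Cser_opp (u : nat -> C) (l : C) : Cser u l -> Cser (fun n => - u n)%C (- l)%C.
Proof. intros A; exact (@is_series_opp C_AbsRing C_NormedModule u l A). Qed.

Lemma Cser_minus (u v : nat -> C) (l m : C) :
  Cser u l -> Cser v m -> Cser (fun n => u n - v n)%C (l - m)%C.
Proof. intros A B; apply Cser_plus; [|apply Cser_opp]; auto. Qed.

Lemma Cser_scal (c : C) (u : nat -> C) (l : C) : Cser u l -> Cser (fun n => c * u n)%C (c * l)%C.
Proof. intros A; exact (@is_series_scal C_AbsRing C_NormedModule c u l A). Qed.

Lemma Cser_incr_1 (u : nat -> C) (l : C) : Cser u l -> Cser (fun n => u (S n)) (l - u O)%C.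
Proof.
  intros A; apply (@is_series_incr_1 C_AbsRing C_NormedModule u).
  replace (plus _ _) with l; [exact A|].
  change (l = (l - u O) + u O)%C. ring.
Qed.

Lemma Cser_decr_1 (u : nat -> C) (l : C) : Cser (fun n => u (S n)) l -> Cser u (l + u O)%C.
Proof.
  intros A; apply (@is_series_decr_1 C_AbsRing C_NormedModule u).
  replace (plus _ _) with l; [exact A|].
  change (l = (l + u O) - u O)%C. ring.
Qed.

Lemma Csum_n_Cmod_le (u : nat -> C) (M : nat -> R) (N : nat) :
  (forall n, Cmod (u n) <= M n) -> Cmod (@sum_n C_AbelianMonoid u N) <= sum_n M N.
Proof.
  intros H; induction N; [rewrite !sum_O; auto|].
  rewrite !sum_Sn. eapply Rle_trans; [apply Cmod_triangle|].
  apply Rplus_le_compat; auto.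
Qed.

Lemma ex_series_pos_bound (M : nat -> R) (B : R) :
  (forall n, 0 <= M n) -> (forall N, sum_n M N <= B) -> ex_series M.
Proof.
  intros H0 HB.
  assert (H : ex_finite_lim_seq (sum_n M)).
  { apply ex_finite_lim_seq_incr with B; auto.
    intros n; rewrite sum_Sn. unfold plus; simpl. specialize (H0 (S n)); lra. }
  destruct H as [l Hl]; exists l; exact Hl.
Qed.

Lemma Series_partial_le (M : nat -> R) (N : nat) :
  (forall n, 0 <= M n) -> ex_series M -> sum_n M N <= Series M.
Proof.
  intros H0 HM. apply Series_correct in HM.
  apply (is_lim_seq_incr_compare (sum_n M)); [exact HM|].
  intros n; rewrite sum_Sn. unfold plus; simpl. specialize (H0 (S n)); lra.
Qed.

Lemma Series_bound (M : nat -> R) (B : R) :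
  (forall N, sum_n M N <= B) -> ex_series M -> Series M <= B.
Proof.
  intros H HM; apply Series_correct in HM.
  apply (is_lim_seq_le (sum_n M) (fun _ => B) (Series M) B); auto.
  apply is_lim_seq_const.
Qed.

Lemma ex_series_Rle (u M : nat -> R) :
  (forall n, Rabs (u n) <= M n) -> ex_series M -> ex_series u.
Proof. intros H HM; exact (@ex_series_le R_AbsRing R_CompleteNormedModule u M H HM). Qed.

Lemma Cser_Csum (u : nat -> C) (M : nat -> R) :
  (forall n, Cmod (u n) <= M n) -> ex_series M -> Cser u (Csum u).
Proof.
  intros H HM; apply Cser_re_im; split; simpl; apply Series_correct;
  apply ex_series_Rle with M; auto; intros n; eapply Rle_trans; try apply H.
  - apply re_le_Cmod.
  - apply im_le_Cmod.
Qed.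

Lemma Clim_Cmod_le (u : nat -> C) (l : C) (B : R) :
  Clim u l -> (forall n, Cmod (u n) <= B) -> Cmod l <= B.
Proof.
  intros H HB.
  apply (is_lim_seq_le (fun _ => Cmod l) (fun n => Cmod (u n - l)%C + B) (Cmod l) B).
  - intros n. replace l with (u n - (u n - l))%C at 1 by ring.
    eapply Rle_trans; [apply Cmod_triangle|]. rewrite Cmod_opp. specialize (HB n); lra.
  - apply is_lim_seq_const.
  - replace (Finite B) with (Finite (0 + B)) by (f_equal; ring).
    apply is_lim_seq_plus'; [exact H|apply is_lim_seq_const].
Qed.

Lemma Cser_Cmod_le (u : nat -> C) (M : nat -> R) (l : C) (B : R) :
  Cser u l -> (forall n, Cmod (u n) <= M n) -> (forall N, sum_n M N <= B) -> Cmod l <= B.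
Proof.
  intros H HM HB; apply Cser_Clim in H; eapply Clim_Cmod_le; [exact H|].
  intros N; eapply Rle_trans; [apply Csum_n_Cmod_le; apply HM|apply HB].
Qed.

Lemma Cser_Cmod_le_Series (u : nat -> C) (M : nat -> R) (l : C) :
  Cser u l -> (forall n, Cmod (u n) <= M n) -> ex_series M -> Cmod l <= Series M.
Proof.
  intros H HM E; eapply Cser_Cmod_le; eauto.
  intros N; apply Series_partial_le; auto.
  intros n; eapply Rle_trans; [apply Cmod_ge_0|apply HM].
Qed.

Lemma Cser_partial_diff (u : nat -> C) (M : nat -> R) (l : C) (N : nat) :
  Cser u l -> (forall n, Cmod (u n) <= M n) -> ex_series M ->
  Cmod (@sum_n C_AbelianMonoid u N - l)%C <= Series (fun n => M (S N + n)%nat).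
Proof.
  intros H HM E.
  assert (H1 : Cser (fun n => u (S N + n)%nat) (l - @sum_n C_AbelianMonoid u N)%C).
  { apply (@is_series_incr_n C_AbsRing C_NormedModule u); [lia|].
    replace (plus _ _) with l; [exact H|].
    simpl. change (l = (l - @sum_n C_AbelianMonoid u N) + @sum_n C_AbelianMonoid u N)%C. ring. }
  replace (@sum_n C_AbelianMonoid u N - l)%C with (- (l - @sum_n C_AbelianMonoid u N))%C by ring.
  rewrite Cmod_opp. apply Cser_Cmod_le_Series with (1 := H1).
  - intros n; apply HM.
  - apply -> (ex_series_incr_n M (S N)); auto.
Qed.

Lemma Series_tail_lim (M : nat -> R) :
  ex_series M -> is_lim_seq (fun N => Series (fun n => M (S N + n)%nat)) 0.
Proof.
  intros E.
  apply is_lim_seq_ext with (fun N => Series M - sum_n M N).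
  - intros N. rewrite (Series_incr_n M (S N)); [|lia|auto].
    simpl pred. rewrite sum_n_Reals. ring.
  - replace 0 with (Series M - Series M) by ring.
    apply is_lim_seq_minus'; [apply is_lim_seq_const|].
    apply Series_correct in E; exact E.
Qed.

Lemma Clim_ext (u v : nat -> C) l : (forall n, u n = v n) -> Clim u l -> Clim v l.
Proof.
  intros H; apply is_lim_seq_ext; intros n; rewrite H; auto.
Qed.

Lemma Clim_const (c : C) : Clim (fun _ => c) c.
Proof.
  apply is_lim_seq_ext with (fun _ => 0); [|apply is_lim_seq_const].
  intros _. replace (c - c)%C with (RtoC 0) by ring. rewrite Cmod_0; auto.
Qed.

Lemma Clim_plus (u v : nat -> C) l m :
  Clim u l -> Clim v m -> Clim (fun n => u n + v n)%C (l + m)%C.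
Proof.
  rewrite !Clim_re_im; intros [A B] [D E]; split; apply is_lim_seq_plus'; auto.
Qed.

Lemma Clim_mult (u v : nat -> C) l m :
  Clim u l -> Clim v m -> Clim (fun n => u n * v n)%C (l * m)%C.
Proof.
  rewrite !Clim_re_im; intros [A B] [D E]; split; simpl.
  - apply is_lim_seq_minus'; apply is_lim_seq_mult'; auto.
  - apply is_lim_seq_plus'; apply is_lim_seq_mult'; auto.
Qed.

Lemma Clim_incr_1 (u : nat -> C) l : Clim (fun n => u (S n)) l <-> Clim u l.
Proof.
  unfold Clim. symmetry. apply (is_lim_seq_incr_1 (fun n => Cmod (u n - l)%C)).
Qed.

Lemma Clim_0_bound (u : nat -> C) (e : nat -> R) :
  (forall n, Cmod (u n) <= e n) -> is_lim_seq e 0 -> Clim u 0.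
Proof.
  intros H He. apply is_lim_seq_le_le with (fun _ => 0) e; auto.
  - intros n; split; [apply Cmod_ge_0|].
    replace (u n - 0)%C with (u n) by ring; auto.
  - apply is_lim_seq_const.
Qed.

(** Dominated convergence for series. Cut all series at an index beyond which the tail of [M] is
    small: the heads are finite sums and converge termwise, and both remainders are bounded by the
    tail of [M], uniformly in [N]. *)
Lemma Tannery (f : nat -> nat -> C) (g : nat -> C) (M : nat -> R) (F : nat -> C) (G : C) :
  (forall N k, Cmod (f N k) <= M k) -> ex_series M ->
  (forall k, Clim (fun N => f N k) (g k)) ->
  (forall N, Cser (f N) (F N)) -> Cser g G -> Clim F G.
Proof.
  intros HM EM Hlim HF HG.
  assert (Hg : forall k, Cmod (g k) <= M k).
  { intros k; eapply Clim_Cmod_le; [apply Hlim|]. intros n; apply HM. }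
  apply is_lim_seq_spec; intros eps.
  assert (He : 0 < eps / 3) by (destruct eps; simpl; lra).
  assert (Ht := Series_tail_lim M EM). apply is_lim_seq_spec in Ht.
  destruct (Ht (mkposreal _ He)) as [K HK]; simpl in HK.
  specialize (HK K (le_n K)). rewrite Rminus_0_r in HK.
  assert (Hs : Clim (fun N => @sum_n C_AbelianMonoid (f N) K) (@sum_n C_AbelianMonoid g K)).
  { clear HK. induction K.
    - rewrite sum_O. eapply Clim_ext; [|apply (Hlim O)]. intros; rewrite sum_O; auto.
    - rewrite sum_Sn. eapply Clim_ext; [|apply (Clim_plus _ _ _ _ IHK (Hlim (S K)))].
      intros; rewrite sum_Sn; auto. }
  apply is_lim_seq_spec in Hs. destruct (Hs (mkposreal _ He)) as [N0 HN]; simpl in HN.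
  exists N0; intros n Hn; specialize (HN n Hn).
  rewrite Rminus_0_r, (Rabs_pos_eq _ (Cmod_ge_0 _)) in HN.
  rewrite Rminus_0_r, (Rabs_pos_eq _ (Cmod_ge_0 _)).
  assert (A1 := Cser_partial_diff (f n) M (F n) K (HF n) (HM n) EM).
  assert (A2 := Cser_partial_diff g M G K HG Hg EM).
  apply Rle_lt_trans with (Cmod (- (@sum_n C_AbelianMonoid (f n) K - F n)
     + ((@sum_n C_AbelianMonoid (f n) K - @sum_n C_AbelianMonoid g K)
     + (@sum_n C_AbelianMonoid g K - G)))%C).
  { apply Req_le; f_equal; ring. }
  eapply Rle_lt_trans; [apply Cmod_triangle|]. rewrite Cmod_opp.
  eapply Rle_lt_trans; [apply Rplus_le_compat_l, Cmod_triangle|].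
  assert (HK' := Rle_abs (Series (fun n0 : nat => M (S K + n0)%nat))).
  change (Series (fun n0 => M (S (K + n0))) ) with (Series (fun n0 => M (S K + n0)%nat)) in HK.
  lra.
Qed.

Lemma Cser_sum_n (u : nat -> nat -> C) (l : nat -> C) (N : nat) :
  (forall n, Cser (u n) (l n)) ->
  Cser (fun k => @sum_n C_AbelianMonoid (fun n => u n k) N) (@sum_n C_AbelianMonoid l N).
Proof.
  intros H; induction N.
  - rewrite sum_O. eapply Cser_ext; [|apply (H O)]. intros; rewrite sum_O; auto.
  - rewrite sum_Sn. eapply Cser_ext; [|apply (Cser_plus _ _ _ _ IHN (H (S N)))].
    intros; rewrite sum_Sn; auto.
Qed.

(** The partial sum of [col] up to [N] is itself a series in [k], whose terms are the partial row
    sums; these are dominated by [M k] and tend to [row k], so [Tannery] applies. *)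
Lemma Cser_Fubini (a : nat -> nat -> C) (M : nat -> R) (row col : nat -> C) (S : C) :
  (forall k N, sum_n (fun n => Cmod (a k n)) N <= M k) -> ex_series M ->
  (forall k, Cser (a k) (row k)) -> (forall n, Cser (fun k => a k n) (col n)) ->
  Cser row S -> Cser col S.
Proof.
  intros HM EM Hrow Hcol HS. apply Cser_Clim.
  apply Tannery with (f := fun N k => @sum_n C_AbelianMonoid (a k) N) (g := row) (M := M); auto.
  - intros N k. eapply Rle_trans; [apply Csum_n_Cmod_le; intros n; apply Rle_refl|apply HM].
  - intros k; apply Cser_Clim; auto.
  - intros N. apply (Cser_sum_n (fun n k => a k n)); auto.
Qed.

End Basics.

(** * Calculus of complex-valued functions of a real variable *)

Section Calculus.
Local Open Scope R_scope.

Definition Ccont (f : R -> C) (x : R) : Prop := @continuous R_UniformSpace C_UniformSpace f x.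

Definition is_CInt (f : R -> C) (a b : R) (l : C) : Prop := @is_RInt C_R_NormedModule f a b l.

Definition CInt (f : R -> C) (a b : R) : C := @RInt C_R_CompleteNormedModule f a b.

Definition is_Cder (f : R -> C) (x : R) (l : C) : Prop := @is_derive R_AbsRing C_R_NormedModule f x l.

Lemma Ccont_re_im (f : R -> C) (x : R) :
  Ccont f x <-> (continuous (fun t => Re (f t)) x /\ continuous (fun t => Im (f t)) x).
Proof.
  unfold Ccont, continuous; split.
  - intros H; split; intros P [eps HP].
    + apply (H (fun z => P (Re z))). exists eps; intros z [Hz _]; apply HP; exact Hz.
    + apply (H (fun z => P (Im z))). exists eps; intros z [_ Hz]; apply HP; exact Hz.
  - intros [A B] P [eps HP].
    assert (A' : locally x (fun t => ball (Re (f x)) eps (Re (f t))))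
      by exact (A (fun y => ball (Re (f x)) eps y) (locally_ball _ _)).
    assert (B' : locally x (fun t => ball (Im (f x)) eps (Im (f t))))
      by exact (B (fun y => ball (Im (f x)) eps y) (locally_ball _ _)).
    assert (D := filter_and _ _ A' B'). destruct D as [d Hd].
    exists d; intros t Ht. destruct (Hd t Ht). apply HP; split; assumption.
Qed.

Lemma Ccont_ext (f g : R -> C) (x : R) : (forall t, f t = g t) -> Ccont f x -> Ccont g x.
Proof. intros H; apply continuous_ext; exact H. Qed.

Lemma Ccont_const (c : C) (x : R) : Ccont (fun _ => c) x.
Proof. apply continuous_const. Qed.

Lemma Ccont_RtoC (f : R -> R) (x : R) : continuous f x -> Ccont (fun t => RtoC (f t)) x.
Proof.
  intros H; apply Ccont_re_im; split; simpl; [exact H|apply continuous_const].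
Qed.

Lemma Rcont_plus (f g : R -> R) (x : R) :
  continuous f x -> continuous g x -> continuous (fun t => f t + g t) x.
Proof. intros A B; exact (@continuous_plus R_UniformSpace R_AbsRing R_NormedModule f g x A B). Qed.

Lemma Rcont_minus (f g : R -> R) (x : R) :
  continuous f x -> continuous g x -> continuous (fun t => f t - g t) x.
Proof. intros A B; exact (@continuous_minus R_UniformSpace R_AbsRing R_NormedModule f g x A B). Qed.

Lemma Rcont_mult (f g : R -> R) (x : R) :
  continuous f x -> continuous g x -> continuous (fun t => f t * g t) x.
Proof. intros A B; exact (@continuous_mult R_UniformSpace R_AbsRing f g x A B). Qed.

Lemma Ccont_plus (f g : R -> C) (x : R) :
  Ccont f x -> Ccont g x -> Ccont (fun t => f t + g t)%C x.
Proof.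
  rewrite !Ccont_re_im; intros [A B] [D E]; split; apply Rcont_plus; auto.
Qed.

Lemma Ccont_mult (f g : R -> C) (x : R) :
  Ccont f x -> Ccont g x -> Ccont (fun t => f t * g t)%C x.
Proof.
  rewrite !Ccont_re_im; intros [A B] [D E]; split; simpl.
  - apply Rcont_minus; apply Rcont_mult; auto.
  - apply Rcont_plus; apply Rcont_mult; auto.
Qed.

Lemma Ccont_scal (c : C) (f : R -> C) (x : R) : Ccont f x -> Ccont (fun t => c * f t)%C x.
Proof. intros; apply Ccont_mult; auto using Ccont_const. Qed.

Lemma Ccont_opp (f : R -> C) (x : R) : Ccont f x -> Ccont (fun t => - f t)%C x.
Proof.
  intros H; apply Ccont_ext with (fun t => (- (1)) * f t)%C; [intros; ring|].
  apply Ccont_scal; auto.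
Qed.

Lemma Ccont_minus (f g : R -> C) (x : R) :
  Ccont f x -> Ccont g x -> Ccont (fun t => f t - g t)%C x.
Proof. intros; apply Ccont_plus; auto using Ccont_opp. Qed.

Lemma Ccont_pow (f : R -> C) (n : nat) (x : R) : Ccont f x -> Ccont (fun t => f t ^ n)%C x.
Proof.
  intros H; induction n; simpl; [apply Ccont_const|apply Ccont_mult; auto].
Qed.

Lemma Ccont_comp (f : R -> C) (g : R -> R) (x : R) :
  continuous g x -> Ccont f (g x) -> Ccont (fun t => f (g t)) x.
Proof. intros A B; exact (continuous_comp g f x A B). Qed.

Lemma Ccont_Cmod (f : R -> C) (x : R) : Ccont f x -> continuous (fun t => Cmod (f t)) x.
Proof.
  intros H. apply (continuous_comp f (fun z : C_R_NormedModule => Cmod z)); [exact H|].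
  apply (@continuous_ext C_UniformSpace R_UniformSpace (fun z : C_R_NormedModule => norm z)).
  - intros z; symmetry; apply Cmod_norm.
  - apply (@filterlim_norm R_AbsRing C_R_NormedModule).
Qed.

Lemma is_CInt_re_im (f : R -> C) (a b : R) (l : C) :
  is_CInt f a b l <->
  (is_RInt (fun t => Re (f t)) a b (Re l) /\ is_RInt (fun t => Im (f t)) a b (Im l)).
Proof.
  split.
  - intros H; split.
    + apply (@is_RInt_fct_extend_fst R_NormedModule R_NormedModule f a b l H).
    + apply (@is_RInt_fct_extend_snd R_NormedModule R_NormedModule f a b l H).
  - intros [A B]. destruct l as [l1 l2].
    exact (@is_RInt_fct_extend_pair R_NormedModule R_NormedModule f a b l1 l2 A B).
Qed.

Lemma CInt_eq (f : R -> C) (a b : R) (l : C) : is_CInt f a b l -> CInt f a b = l.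
Proof. apply (@is_RInt_unique C_R_CompleteNormedModule). Qed.

Lemma ex_CInt (f : R -> C) (a b : R) :
  (forall x, Rmin a b <= x <= Rmax a b -> Ccont f x) ->
  @ex_RInt C_R_NormedModule f a b.
Proof. apply (@ex_RInt_continuous C_R_CompleteNormedModule). Qed.

Lemma is_CInt_CInt (f : R -> C) (a b : R) :
  (forall x, Rmin a b <= x <= Rmax a b -> Ccont f x) -> is_CInt f a b (CInt f a b).
Proof.
  intros H; apply (@RInt_correct C_R_CompleteNormedModule). apply ex_CInt; auto.
Qed.

Lemma is_CInt_ext (f g : R -> C) (a b : R) (l : C) :
  (forall x, Rmin a b < x < Rmax a b -> f x = g x) -> is_CInt f a b l -> is_CInt g a b l.
Proof. apply (@is_RInt_ext C_R_NormedModule). Qed.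

Lemma CInt_ext (f g : R -> C) (a b : R) :
  (forall x, Rmin a b < x < Rmax a b -> f x = g x) -> CInt f a b = CInt g a b.
Proof. apply (@RInt_ext C_R_CompleteNormedModule). Qed.

Lemma is_CInt_plus (f g : R -> C) (a b : R) (l m : C) :
  is_CInt f a b l -> is_CInt g a b m -> is_CInt (fun t => f t + g t)%C a b (l + m)%C.
Proof. apply (@is_RInt_plus C_R_NormedModule). Qed.

Lemma is_CInt_minus (f g : R -> C) (a b : R) (l m : C) :
  is_CInt f a b l -> is_CInt g a b m -> is_CInt (fun t => f t - g t)%C a b (l - m)%C.
Proof. apply (@is_RInt_minus C_R_NormedModule). Qed.

Lemma is_CInt_scal (c : C) (f : R -> C) (a b : R) (l : C) :
  is_CInt f a b l -> is_CInt (fun t => c * f t)%C a b (c * l)%C.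
Proof.
  rewrite !is_CInt_re_im; intros [A B]; split; simpl.
  - apply (@is_RInt_minus R_NormedModule (fun t => Re c * Re (f t)) (fun t => Im c * Im (f t)));
    apply (@is_RInt_scal R_NormedModule); auto.
  - apply (@is_RInt_plus R_NormedModule (fun t => Re c * Im (f t)) (fun t => Im c * Re (f t)));
    apply (@is_RInt_scal R_NormedModule); auto.
Qed.

Lemma is_CInt_Cmod_le (f : R -> C) (g : R -> R) (a b : R) (l : C) (m : R) :
  a <= b -> (forall x, a <= x <= b -> Cmod (f x) <= g x) ->
  is_CInt f a b l -> is_RInt g a b m -> Cmod l <= m.
Proof.
  intros Hab H Hf Hg. rewrite Cmod_norm.
  apply (@norm_RInt_le C_R_NormedModule f g a b l m Hab); auto.
  intros x Hx; apply Rle_trans with (2 := H x Hx). rewrite Cmod_norm; apply Rle_refl.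
Qed.

Lemma is_CInt_Cmod_le_const (f : R -> C) (a b : R) (l : C) (M : R) :
  a <= b -> (forall x, a <= x <= b -> Cmod (f x) <= M) ->
  is_CInt f a b l -> Cmod l <= (b - a) * M.
Proof.
  intros Hab H Hf. apply (is_CInt_Cmod_le f (fun _ => M) a b); auto.
  apply (@is_RInt_const R_NormedModule).
Qed.

(** The function is the combination of its two real components with the constant vectors [(1, 0)]
    and [(0, 1)], so real scalar rules suffice. *)
Lemma is_Cder_re_im (f : R -> C) (x : R) (l : C) :
  is_derive (fun t => Re (f t)) x (Re l) -> is_derive (fun t => Im (f t)) x (Im l) ->
  is_Cder f x l.
Proof.
  intros A B. unfold is_Cder.
  assert (A1 := @is_derive_scal_l R_AbsRing C_R_NormedModule _ _ _ (1,0) A).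
  assert (B1 := @is_derive_scal_l R_AbsRing C_R_NormedModule _ _ _ (0,1) B).
  assert (H := is_derive_plus _ _ _ _ _ A1 B1).
  replace l with (@plus C_R_NormedModule (@scal R_AbsRing C_R_NormedModule (Re l) (1, 0))
    (@scal R_AbsRing C_R_NormedModule (Im l) (0, 1))).
  - eapply (@is_derive_ext R_AbsRing C_R_NormedModule); [|exact H].
    intros t. transitivity (Re (f t), Im (f t)); [|destruct (f t); reflexivity].
    change ((Re (f t) * 1 + Im (f t) * 0, Re (f t) * 0 + Im (f t) * 1) = (Re (f t), Im (f t))).
    f_equal; ring.
  - destruct l as [p q].
    change ((p * 1 + q * 0, p * 0 + q * 1) = (p, q)). f_equal; ring.
Qed.

Lemma is_Cder_re (f : R -> C) (x : R) (l : C) :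
  is_Cder f x l -> is_derive (fun t => Re (f t)) x (Re l).
Proof.
  intros [A B]; split; [apply is_linear_scal_l|].
  intros y Hy eps. specialize (B y Hy eps). revert B; apply filter_imp.
  intros t Ht. eapply Rle_trans; [|exact Ht].
  eapply Rle_trans; [|rewrite <- Cmod_norm; apply re_le_Cmod].
  apply Rle_refl.
Qed.

Lemma is_Cder_im (f : R -> C) (x : R) (l : C) :
  is_Cder f x l -> is_derive (fun t => Im (f t)) x (Im l).
Proof.
  intros [A B]; split; [apply is_linear_scal_l|].
  intros y Hy eps. specialize (B y Hy eps). revert B; apply filter_imp.
  intros t Ht. eapply Rle_trans; [|exact Ht].
  eapply Rle_trans; [|rewrite <- Cmod_norm; apply im_le_Cmod].
  apply Rle_refl.
Qed.

Lemma is_Cder_ext (f g : R -> C) (x : R) (l : C) :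
  (forall t, f t = g t) -> is_Cder f x l -> is_Cder g x l.
Proof. apply (@is_derive_ext R_AbsRing C_R_NormedModule). Qed.

Lemma is_Cder_Ccont (f : R -> C) (x : R) (l : C) : is_Cder f x l -> Ccont f x.
Proof.
  intros H. apply (@ex_derive_continuous R_AbsRing C_R_NormedModule). exists l; exact H.
Qed.

Lemma is_Cder_const (c : C) (x : R) : is_Cder (fun _ => c) x 0.
Proof. apply (@is_derive_const R_AbsRing C_R_NormedModule). Qed.

Lemma is_Cder_plus (f g : R -> C) (x : R) (l m : C) :
  is_Cder f x l -> is_Cder g x m -> is_Cder (fun t => f t + g t)%C x (l + m)%C.
Proof. apply (@is_derive_plus R_AbsRing C_R_NormedModule). Qed.

Lemma is_Cder_mult (f g : R -> C) (x : R) (l m : C) :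
  is_Cder f x l -> is_Cder g x m -> is_Cder (fun t => f t * g t)%C x (l * g x + f x * m)%C.
Proof.
  intros A B.
  assert (A1 := is_Cder_re _ _ _ A). assert (A2 := is_Cder_im _ _ _ A).
  assert (B1 := is_Cder_re _ _ _ B). assert (B2 := is_Cder_im _ _ _ B).
  assert (P : forall (u v : R -> R) (p q : R), is_derive u x p -> is_derive v x q ->
     is_derive (fun t => u t * v t) x (p * v x + u x * q)).
  { intros u v p q U V. apply (is_derive_mult u v x p q U V). intros; apply Rmult_comm. }
  apply is_Cder_re_im; simpl.
  - evar_last.
    + apply (@is_derive_minus R_AbsRing R_NormedModule); apply P; eassumption.
    + change minus with Rminus. unfold minus, plus, opp; simpl. unfold Re, Im. ring.
  - evar_last.
    + apply (@is_derive_plus R_AbsRing R_NormedModule); apply P; eassumption.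
    + unfold plus; simpl. unfold Re, Im. ring.
Qed.

Lemma is_Cder_scal (c : C) (f : R -> C) (x : R) (l : C) :
  is_Cder f x l -> is_Cder (fun t => c * f t)%C x (c * l)%C.
Proof.
  intros H. assert (H1 := is_Cder_mult _ _ x _ _ (is_Cder_const c x) H).
  replace (c * l)%C with (0 * f x + c * l)%C by ring. exact H1.
Qed.

Lemma is_Cder_RtoC (f : R -> R) (x : R) (l : R) :
  is_derive f x l -> is_Cder (fun t => RtoC (f t)) x (RtoC l).
Proof.
  intros H; apply is_Cder_re_im; simpl; [exact H|apply (@is_derive_const R_AbsRing R_NormedModule)].
Qed.

Lemma is_CInt_derive (f df : R -> C) (a b : R) :
  (forall x, Rmin a b <= x <= Rmax a b -> is_Cder f x (df x)) ->
  (forall x, Rmin a b <= x <= Rmax a b -> Ccont df x) ->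
  is_CInt df a b (f b - f a)%C.
Proof. apply (@is_RInt_derive C_R_CompleteNormedModule). Qed.

(** * The complex exponential and complex powers of positive reals *)

Lemma Cexp_add (a b : C) : Cexp (a + b) = (Cexp a * Cexp b)%C.
Proof.
  unfold Cexp; destruct a as [a1 a2], b as [b1 b2]; simpl.
  rewrite exp_plus, cos_plus, sin_plus. unfold RtoC, Cmult; simpl; f_equal; ring.
Qed.

Lemma Cexp_0 : Cexp 0 = 1%C.
Proof.
  unfold Cexp; simpl. rewrite exp_0, cos_0, sin_0. unfold RtoC, Cmult; simpl; f_equal; ring.
Qed.

Lemma Cmod_Cexp (z : C) : Cmod (Cexp z) = exp (Re z).
Proof.
  unfold Cexp. rewrite Cmod_mult, Cmod_R, Rabs_pos_eq by (left; apply exp_pos).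
  replace (Cmod (cos (Im z), sin (Im z))) with 1; [ring|].
  unfold Cmod; simpl. replace (_ + _) with 1; [symmetry; apply sqrt_1|].
  generalize (sin2_cos2 (Im z)); unfold Rsqr; lra.
Qed.

Lemma Cexp_neq_0 (z : C) : Cexp z <> 0.
Proof.
  intros H. assert (A := Cmod_Cexp z). rewrite H, Cmod_0 in A.
  generalize (exp_pos (Re z)); lra.
Qed.

Lemma is_Cder_Cexp (p : R -> C) (x : R) (l : C) :
  is_Cder p x l -> is_Cder (fun t => Cexp (p t)) x (l * Cexp (p x))%C.
Proof.
  intros H. assert (A := is_Cder_re _ _ _ H). assert (B := is_Cder_im _ _ _ H).
  apply is_Cder_ext with (fun t => RtoC (exp (Re (p t))) * (cos (Im (p t)), sin (Im (p t))))%C.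
  { reflexivity. }
  assert (E : is_derive (fun t => exp (Re (p t))) x (Re l * exp (Re (p x)))).
  { apply (is_derive_comp exp (fun t => Re (p t))); auto. apply is_derive_exp. }
  assert (D : is_derive (fun t => cos (Im (p t))) x (Im l * - sin (Im (p x)))).
  { apply (is_derive_comp cos (fun t => Im (p t))); auto. apply is_derive_cos. }
  assert (S : is_derive (fun t => sin (Im (p t))) x (Im l * cos (Im (p x)))).
  { apply (is_derive_comp sin (fun t => Im (p t))); auto. apply is_derive_sin. }
  assert (CS : is_Cder (fun t => (cos (Im (p t)), sin (Im (p t)))) x
     (Im l * - sin (Im (p x)), Im l * cos (Im (p x)))).
  { apply is_Cder_re_im; auto. }
  generalize (is_Cder_mult _ _ _ _ _ (is_Cder_RtoC _ _ _ E) CS).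
  match goal with |- is_Cder _ _ ?u -> is_Cder _ _ ?v => replace u with v; auto end.
  unfold Cexp. destruct l as [l1 l2]; simpl. unfold Cmult, Cplus, RtoC; simpl; f_equal; ring.
Qed.

Lemma Rcpow_add (u : R) (s t : C) : Rcpow u (s + t) = (Rcpow u s * Rcpow u t)%C.
Proof.
  unfold Rcpow. rewrite <- Cexp_add. f_equal; ring.
Qed.

Lemma Rcpow_0 (u : R) : Rcpow u 0 = 1%C.
Proof. unfold Rcpow. rewrite Cmult_0_l. apply Cexp_0. Qed.

Lemma Rcpow_neq_0 (u : R) (s : C) : Rcpow u s <> 0.
Proof. apply Cexp_neq_0. Qed.

Lemma Rcpow_opp (u : R) (s : C) : Rcpow u (- s) = (/ Rcpow u s)%C.
Proof.
  assert (H : (Rcpow u s * Rcpow u (- s) = 1)%C).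
  { rewrite <- Rcpow_add. replace (s + - s)%C with (RtoC 0) by ring. apply Rcpow_0. }
  assert (N := Rcpow_neq_0 u s).
  replace (/ Rcpow u s)%C with (/ Rcpow u s * (Rcpow u s * Rcpow u (- s)))%C.
  - field; auto.
  - rewrite H; ring.
Qed.

Lemma Rcpow_1_l (s : C) : Rcpow 1 s = 1%C.
Proof. unfold Rcpow. rewrite ln_1, Cmult_0_r. apply Cexp_0. Qed.

Lemma Rcpow_1 (u : R) : 0 < u -> Rcpow u 1 = RtoC u.
Proof.
  intros H; unfold Rcpow, Cexp. simpl.
  replace (1 * ln u - 0 * 0) with (ln u) by ring.
  replace (1 * 0 + 0 * ln u) with 0 by ring.
  rewrite exp_ln by auto. rewrite cos_0, sin_0. unfold Cmult, RtoC; simpl; f_equal; ring.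
Qed.

Lemma Rcpow_mult_base (u v : R) (s : C) :
  0 < u -> 0 < v -> Rcpow (u * v) s = (Rcpow u s * Rcpow v s)%C.
Proof.
  intros Hu Hv; unfold Rcpow. rewrite ln_mult by auto.
  rewrite <- Cexp_add. f_equal. rewrite RtoC_plus; ring.
Qed.

Lemma Cmod_Rcpow (u : R) (s : C) : Cmod (Rcpow u s) = Rpower u (Re s).
Proof.
  unfold Rcpow, Rpower. rewrite Cmod_Cexp. f_equal. destruct s; simpl. ring.
Qed.

Lemma is_Cder_Rcpow (s : C) (u : R) :
  0 < u -> is_Cder (fun t => Rcpow t s) u (s * Rcpow u (s - 1))%C.
Proof.
  intros H. unfold Rcpow at 1.
  assert (A : is_Cder (fun t => s * RtoC (ln t))%C u (s * RtoC (/ u))%C).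
  { apply is_Cder_scal, is_Cder_RtoC, is_derive_ln; auto. }
  generalize (is_Cder_Cexp _ _ _ A).
  match goal with |- is_Cder _ _ ?u -> is_Cder _ _ ?v => replace u with v; auto end.
  change (Cexp (s * RtoC (ln u))) with (Rcpow u s).
  unfold Cminus. rewrite Rcpow_add, Rcpow_opp, Rcpow_1 by auto.
  rewrite RtoC_inv by lra. ring.
Qed.

Lemma is_Cder_comp (f : R -> C) (g : R -> R) (x : R) (l : C) (m : R) :
  is_Cder f (g x) l -> is_derive g x m -> is_Cder (fun t => f (g t)) x (RtoC m * l)%C.
Proof.
  intros A B.
  assert (H := @is_derive_comp R_AbsRing C_R_NormedModule f g x l m A B).
  replace (RtoC m * l)%C with (@scal R_AbsRing C_R_NormedModule m l); [exact H|].
  destruct l as [p q]. change ((m * p, m * q)%R = (RtoC m * (p, q))%C).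
  unfold RtoC, Cmult; simpl; f_equal; ring.
Qed.

Lemma Ccont_Rcpow (s : C) (u : R) : 0 < u -> Ccont (fun t => Rcpow t s) u.
Proof. intros H; eapply is_Cder_Ccont; apply is_Cder_Rcpow; auto. Qed.

End Calculus.

(** * Series of functions *)

Section FunctionSeries.
Local Open Scope R_scope.

Lemma Ccont_eps (f : R -> C) (x : R) :
  (forall eps : R, 0 < eps -> locally x (fun t => Cmod (f t - f x)%C < eps)) -> Ccont f x.
Proof.
  intros H P [eps HP]. destruct (H eps (cond_pos eps)) as [d Hd].
  exists d; intros t Ht; apply HP. apply C_NormedModule_mixin_compat1. exact (Hd t Ht).
Qed.

Lemma Ccont_eps_inv (f : R -> C) (x : R) (eps : R) :
  0 < eps -> Ccont f x -> locally x (fun t => Cmod (f t - f x)%C < eps).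
Proof.
  intros He H.
  assert (A : continuous (fun t => Cmod (f t - f x)%C) x).
  { apply Ccont_Cmod, Ccont_minus; auto using Ccont_const. }
  replace eps with (pos (mkposreal _ He)) by reflexivity.
  assert (B := A (fun y => ball (Cmod (f x - f x)%C) (mkposreal _ He) y) (locally_ball _ _)).
  destruct B as [d Hd]; exists d; intros t Ht; specialize (Hd t Ht).
  simpl in *. revert Hd. unfold ball; simpl. unfold AbsRing_ball, abs, minus, plus, opp; simpl.
  replace (f x - f x)%C with (RtoC 0) by ring. rewrite Cmod_0.
  replace (Cmod (f t - f x)%C + - 0) with (Cmod (f t - f x)%C) by ring.
  rewrite Rabs_pos_eq; auto using Cmod_ge_0.
Qed.

Lemma Ccont_sum_n (f : nat -> R -> C) (N : nat) (x : R) :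
  (forall k, Ccont (f k) x) -> Ccont (fun t => @sum_n C_AbelianMonoid (fun k => f k t) N) x.
Proof.
  intros H; induction N.
  - apply Ccont_ext with (f O); auto. intros; rewrite sum_O; auto.
  - apply Ccont_ext with (fun t => @sum_n C_AbelianMonoid (fun k => f k t) N + f (S N) t)%C.
    { intros; rewrite sum_Sn; auto. }
    apply Ccont_plus; auto.
Qed.

(** Uniform convergence: the tail of [M] puts one partial sum within a third of [eps] of [F] at
    every point at once. *)
Lemma Ccont_series (f : nat -> R -> C) (F : R -> C) (M : nat -> R) :
  (forall k x, Ccont (f k) x) -> (forall k x, Cmod (f k x) <= M k) -> ex_series M ->
  (forall x, Cser (fun k => f k x) (F x)) -> forall x, Ccont F x.
Proof.
  intros Hc HM EM HF x. apply Ccont_eps; intros eps He.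
  assert (He3 : 0 < eps / 3) by lra.
  assert (Ht := Series_tail_lim M EM). apply is_lim_seq_spec in Ht.
  destruct (Ht (mkposreal _ He3)) as [K HK]; simpl in HK.
  specialize (HK K (le_n K)). rewrite Rminus_0_r in HK.
  change (Series (fun n0 => M (S (K + n0))) ) with (Series (fun n0 => M (S K + n0)%nat)) in HK.
  assert (HK' := Rle_abs (Series (fun n0 : nat => M (S K + n0)%nat))).
  assert (D : forall t, Cmod (@sum_n C_AbelianMonoid (fun k => f k t) K - F t)%C < eps / 3).
  { intros t. eapply Rle_lt_trans; [|eapply Rle_lt_trans; [exact HK'|exact HK]].
    apply (Cser_partial_diff (fun k => f k t) M); auto. }
  assert (A := Ccont_eps_inv _ x _ He3 (Ccont_sum_n f K x (fun k => Hc k x))).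
  revert A; apply filter_imp; intros t A.
  set (s := fun t => @sum_n C_AbelianMonoid (fun k => f k t) K) in *.
  assert (D1 := D t). assert (D2 := D x).
  apply Rle_lt_trans with (Cmod (- (s t - F t) + ((s t - s x) + (s x - F x)))%C).
  { apply Req_le; f_equal; ring. }
  eapply Rle_lt_trans; [apply Cmod_triangle|]. rewrite Cmod_opp.
  eapply Rle_lt_trans; [apply Rplus_le_compat_l, Cmod_triangle|].
  fold (s t) in D1. fold (s x) in D2. fold (s t) in A. fold (s x) in A. lra.
Qed.

Lemma is_CInt_sum_n (f : nat -> R -> C) (a b : R) (I : nat -> C) (N : nat) :
  (forall k, is_CInt (f k) a b (I k)) ->
  is_CInt (fun t => @sum_n C_AbelianMonoid (fun k => f k t) N) a b (@sum_n C_AbelianMonoid I N).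
Proof.
  intros H; induction N.
  - rewrite sum_O. apply is_CInt_ext with (f O); auto. intros; rewrite sum_O; auto.
  - rewrite sum_Sn.
    apply is_CInt_ext with (fun t => @sum_n C_AbelianMonoid (fun k => f k t) N + f (S N) t)%C.
    { intros; rewrite sum_Sn; auto. }
    apply is_CInt_plus; auto.
Qed.

Lemma is_CInt_series (f : nat -> R -> C) (F : R -> C) (M : nat -> R) (a b : R) :
  a <= b ->
  (forall k x, Ccont (f k) x) -> (forall k x, Cmod (f k x) <= M k) -> ex_series M ->
  (forall x, Cser (fun k => f k x) (F x)) ->
  Cser (fun k => CInt (f k) a b) (CInt F a b).
Proof.
  intros Hab Hc HM EM HF.
  assert (HcF := Ccont_series f F M Hc HM EM HF).
  apply Cser_Clim.
  apply is_lim_seq_le_le with (fun _ => 0) (fun N => (b - a) * Series (fun n => M (S N + n)%nat)).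
  - intros N; split; [apply Cmod_ge_0|].
    apply (is_CInt_Cmod_le_const (fun t => @sum_n C_AbelianMonoid (fun k => f k t) N - F t)%C a b); auto.
    + intros x _. apply (Cser_partial_diff (fun k => f k x) M); auto.
    + apply is_CInt_minus.
      * apply is_CInt_sum_n. intros k; apply is_CInt_CInt; auto.
      * apply is_CInt_CInt; auto.
  - apply is_lim_seq_const.
  - replace 0 with ((b - a) * 0) by ring.
    apply is_lim_seq_mult'; [apply is_lim_seq_const|apply Series_tail_lim; auto].
Qed.

Definition clamp (a b x : R) : R := Rmax a (Rmin b x).

Lemma clamp_range (a b x : R) : a <= b -> a <= clamp a b x <= b.
Proof.
  intros H; unfold clamp; split; [apply Rmax_l|]. apply Rmax_lub; auto. apply Rmin_l.
Qed.

Lemma clamp_id (a b x : R) : a <= x <= b -> clamp a b x = x.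
Proof. intros [H1 H2]; unfold clamp. rewrite Rmin_right, Rmax_right; auto. Qed.

Lemma clamp_cont (a b x : R) : continuous (clamp a b) x.
Proof.
  intros P [eps HP]. exists eps; intros t Ht; apply HP.
  revert Ht; unfold ball; simpl; unfold AbsRing_ball, abs, minus, plus, opp; simpl.
  intros Ht. eapply Rle_lt_trans; [|exact Ht].
  unfold clamp, Rmax, Rmin.
  repeat destruct Rle_dec; unfold Rabs; repeat destruct Rcase_abs; lra.
Qed.

(** Composition with [clamp] extends each function to the whole line without changing it on
    [[a, b]], which reduces the claim to hypotheses that hold everywhere. *)
Lemma is_CInt_series_on (f : nat -> R -> C) (F : R -> C) (M : nat -> R) (a b : R) :
  a <= b ->
  (forall k x, a <= x <= b -> Ccont (f k) x) ->
  (forall k x, a <= x <= b -> Cmod (f k x) <= M k) -> ex_series M ->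
  (forall x, a <= x <= b -> Cser (fun k => f k x) (F x)) ->
  is_CInt F a b (CInt F a b) /\ Cser (fun k => CInt (f k) a b) (CInt F a b).
Proof.
  intros Hab Hc HM EM HF.
  assert (CR := fun x => clamp_range a b x Hab).
  assert (Hc' : forall k x, Ccont (fun t => f k (clamp a b t)) x).
  { intros k x. apply Ccont_comp; [apply clamp_cont|auto]. }
  assert (E : forall g : R -> C, CInt (fun t => g (clamp a b t)) a b = CInt g a b).
  { intros g. apply CInt_ext. rewrite Rmin_left, Rmax_right by auto.
    intros x Hx. rewrite clamp_id; auto; lra. }
  assert (HcF : forall x, Ccont (fun t => F (clamp a b t)) x).
  { apply (Ccont_series (fun k t => f k (clamp a b t)) _ M); auto. }
  split.
  - rewrite <- E. apply is_CInt_ext with (fun t => F (clamp a b t)).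
    + rewrite Rmin_left, Rmax_right by auto. intros x Hx. rewrite clamp_id; auto; lra.
    + apply is_CInt_CInt; auto.
  - rewrite <- E.
    apply Cser_ext with (fun k => CInt (fun t => f k (clamp a b t)) a b); [intros; apply E|].
    apply (is_CInt_series _ _ M); auto.
Qed.

Lemma is_RInt_monomial (c t : R) (n : nat) :
  is_RInt (fun s => c * s ^ n) 0 t (c * t ^ S n / INR (S n)).
Proof.
  replace (c * t ^ S n / INR (S n)) with (c * (t ^ S n / INR (S n) - 0 ^ S n / INR (S n))).
  - apply (@is_RInt_scal R_NormedModule). apply is_RInt_pow.
  - rewrite pow_ne_zero by lia. field. apply not_0_INR; lia.
Qed.

Lemma fact_S_R (n : nat) : INR (fact (S n)) = INR (S n) * INR (fact n).
Proof. rewrite <- mult_INR. reflexivity. Qed.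

Lemma exp_pow_series (x : R) : is_series (fun n => x ^ n / INR (fact n)) (exp x).
Proof.
  assert (H := is_exp_Reals x). apply is_pseries_R in H.
  eapply is_series_ext; [|exact H]. intros n; simpl. unfold Rdiv; ring.
Qed.

(** Taylor's formula along the ray [t z]. The remainder of order [N + 1] vanishes at [t = 0] and has
    derivative [z] times the remainder of order [N], so each integration of the bound gains a factor
    [|z| t / (N + 2)]. *)
Lemma Cexp_series (z : C) : Cser (fun n => z ^ n / RtoC (INR (fact n)))%C (Cexp z).
Proof.
  set (T := fun (N : nat) (t : R) => @sum_n C_AbelianMonoid
     (fun n => (RtoC t * z) ^ n / RtoC (INR (fact n)))%C N).
  (* Bounds [|exp(t z)|] for all [t] in [[0, 1]]. *)
  set (B := exp (Rabs (Re z))).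
  assert (Hf : forall n, RtoC (INR (fact n)) <> 0).
  { intros n H. apply RtoC_inj in H. generalize (INR_fact_neq_0 n); auto. }
  assert (Dterm : forall n t, is_Cder (fun t => (RtoC t * z) ^ (S n) / RtoC (INR (fact (S n))))%C t
     (z * ((RtoC t * z) ^ n / RtoC (INR (fact n))))%C).
  { intros n t.
    apply is_Cder_ext with (fun t => (z ^ S n / RtoC (INR (fact (S n)))) * RtoC (t ^ S n))%C.
    { intros s. rewrite RtoC_pow, Cpow_mult_l. unfold Cdiv; ring. }
    replace (z * ((RtoC t * z) ^ n / RtoC (INR (fact n))))%C with
      ((z ^ S n / RtoC (INR (fact (S n)))) * RtoC (INR (S n) * t ^ n))%C.
    - apply is_Cder_scal, is_Cder_RtoC.
      evar_last; [apply is_derive_pow, is_derive_id|].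
      change (INR (S n) * 1 * t ^ n = INR (S n) * t ^ n). ring.
    - rewrite Cpow_mult_l, fact_S_R, !RtoC_mult, RtoC_pow. simpl. field.
      split; auto. intros H; apply RtoC_inj in H. revert H.
      change (INR (S n) <> 0). apply not_0_INR; lia. }
  assert (DT : forall N t, is_Cder (T (S N)) t (z * T N t)%C).
  { intros N t; induction N.
    - unfold T.
      apply is_Cder_ext with (fun t => 1 + (RtoC t * z) ^ 1 / RtoC (INR (fact 1)))%C.
      { intros s. rewrite sum_Sn, sum_O. change plus with Cplus. simpl. field. }
      rewrite sum_O. rewrite <- (Cplus_0_l (z * _)%C).
      apply is_Cder_plus; [apply is_Cder_const|]. exact (Dterm O t).
    - unfold T in *.
      apply is_Cder_ext with (fun t => @sum_n C_AbelianMonoid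
        (fun n => (RtoC t * z) ^ n / RtoC (INR (fact n)))%C (S N)
         + (RtoC t * z) ^ (S (S N)) / RtoC (INR (fact (S (S N)))))%C.
      { intros s. rewrite (sum_Sn _ (S N)). reflexivity. }
      replace (z * @sum_n C_AbelianMonoid (fun n => (RtoC t * z) ^ n / RtoC (INR (fact n))) (S N))%C
       with (z * @sum_n C_AbelianMonoid (fun n => (RtoC t * z) ^ n / RtoC (INR (fact n))) N
          + z * ((RtoC t * z) ^ S N / RtoC (INR (fact (S N)))))%C.
      + apply is_Cder_plus; [exact IHN|apply Dterm].
      + rewrite (sum_Sn _ N). change plus with Cplus. ring. }
  assert (DE : forall t, is_Cder (fun t => Cexp (RtoC t * z)) t (z * Cexp (RtoC t * z))%C).
  { intros t. apply (is_Cder_Cexp (fun t => RtoC t * z)%C).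
    apply is_Cder_ext with (fun t => z * RtoC t)%C; [intros; ring|].
    assert (H1 := is_Cder_scal z _ _ _ (is_Cder_RtoC _ t 1 (@is_derive_id R_AbsRing t))).
    rewrite Cmult_1_r in H1. exact H1. }
  assert (cT : forall N t, Ccont (T N) t).
  { intros N t; apply Ccont_sum_n. intros k. apply Ccont_mult; [|apply Ccont_const].
    apply Ccont_pow, Ccont_mult; [|apply Ccont_const]. apply Ccont_RtoC, continuous_id. }
  assert (cE : forall t, Ccont (fun t => Cexp (RtoC t * z)) t).
  { intros t; eapply is_Cder_Ccont, DE. }
  assert (bE : forall t, 0 <= t <= 1 -> Cmod (Cexp (RtoC t * z)) <= B).
  { intros t Ht. rewrite Cmod_Cexp. unfold B.
    replace (Re (RtoC t * z)%C) with (t * Re z) by (destruct z; simpl; ring).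
    assert (t * Re z <= Rabs (Re z)).
    { generalize (Rle_abs (Re z)) (Rabs_pos (Re z)). intros. nra. }
    destruct H as [H|H]; [left; apply exp_increasing; auto|rewrite H; lra]. }
  assert (T0 : forall N, T N 0 = RtoC 1).
  { intros N; induction N; unfold T in *.
    - rewrite sum_O. simpl. field.
    - rewrite sum_Sn, IHN. change plus with Cplus. simpl.
      unfold Cdiv. rewrite Cmult_0_l, !Cmult_0_l. ring. }
  assert (HR : forall N t, 0 <= t <= 1 ->
     Cmod (Cexp (RtoC t * z) - T N t)%C <= B * Cmod z ^ S N / INR (fact (S N)) * t ^ S N).
  { induction N; intros t Ht.
    - assert (I : is_CInt (fun s => z * Cexp (RtoC s * z))%C 0 t
         (Cexp (RtoC t * z) - Cexp (RtoC 0 * z))%C).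
      { apply (is_CInt_derive (fun s => Cexp (RtoC s * z))); intros; [apply DE|].
        apply Ccont_scal, cE. }
      rewrite Cmult_0_l, Cexp_0 in I.
      replace (T 0%nat t) with (RtoC 1); [|unfold T; rewrite sum_O; simpl; field].
      eapply Rle_trans; [apply (is_CInt_Cmod_le_const _ _ _ _ (Cmod z * B)) with (3 := I)|].
      + apply Ht.
      + intros x Hx. rewrite Cmod_mult. apply Rmult_le_compat_l; [apply Cmod_ge_0|].
        apply bE; lra.
      + simpl. right. field.
    - assert (I : is_CInt (fun s => z * (Cexp (RtoC s * z) - T N s))%C 0 t
         ((Cexp (RtoC t * z) - T (S N) t) - (Cexp (RtoC 0 * z) - T (S N) 0))%C).
      { apply (is_CInt_derive (fun s => Cexp (RtoC s * z) - T (S N) s)%C); intros x _.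
        - replace (z * (Cexp (RtoC x * z) - T N x))%C with
            (z * Cexp (RtoC x * z) + (- (1)) * (z * T N x))%C by ring.
          apply is_Cder_ext with (fun s => Cexp (RtoC s * z) + (- (1)) * T (S N) s)%C; [intros; ring|].
          apply is_Cder_plus; [apply DE|apply is_Cder_scal, DT].
        - apply Ccont_scal, Ccont_minus; auto. }
      rewrite T0, Cmult_0_l, Cexp_0 in I.
      replace (Cexp (RtoC t * z) - T (S N) t - (1 - 1))%C with (Cexp (RtoC t * z) - T (S N) t)%C in I by ring.
      eapply Rle_trans; [apply (is_CInt_Cmod_le _
         (fun s => (Cmod z * (B * Cmod z ^ S N / INR (fact (S N)))) * s ^ S N) _ _ _
         ((Cmod z * (B * Cmod z ^ S N / INR (fact (S N)))) * t ^ S (S N) / INR (S (S N))))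
         with (3 := I)|].
      + apply Ht.
      + intros x Hx. rewrite Cmod_mult, Rmult_assoc. apply Rmult_le_compat_l; [apply Cmod_ge_0|].
        apply IHN; lra.
      + apply is_RInt_monomial.
      + right. rewrite (fact_S_R (S N)).
        replace (Cmod z ^ S (S N)) with (Cmod z * Cmod z ^ S N) by reflexivity.
        field. split; [apply INR_fact_neq_0|]. apply not_0_INR; lia. }
  apply Cser_Clim.
  apply is_lim_seq_le_le with (fun _ => 0) (fun N => B * (Cmod z ^ S N / INR (fact (S N)))).
  - intros N; split; [apply Cmod_ge_0|].
    assert (H := HR N 1). rewrite Cmult_1_l, pow1 in H.
    replace (@sum_n C_AbelianMonoid (fun n => z ^ n / RtoC (INR (fact n)))%C N - Cexp z)%C
      with (- (Cexp z - T N 1))%C.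
    + rewrite Cmod_opp. eapply Rle_trans; [apply H; lra|]. right; unfold Rdiv; ring.
    + unfold T. rewrite (sum_n_ext _ (fun n => z ^ n / RtoC (INR (fact n)))%C);
      [ring|]. intros n; rewrite Cmult_1_l; auto.
  - apply is_lim_seq_const.
  - replace 0 with (B * 0) by ring. apply is_lim_seq_mult'; [apply is_lim_seq_const|].
    apply (is_lim_seq_incr_1 (fun N => Cmod z ^ N / INR (fact N))).
    apply ex_series_lim_0. exists (exp (Cmod z)); apply exp_pow_series.
Qed.

End FunctionSeries.

(** * Power series with continuous coefficients *)

Section Families.
Local Open Scope R_scope.

Lemma functional_choice (A B : Type) (P : A -> B -> Prop) :
  (forall x, exists y, P x y) -> exists f : A -> B, forall x, P x (f x).
Proof.
  intros H; exists (fun x => proj1_sig (constructive_indefinite_description _ (H x))).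
  intros x; apply proj2_sig.
Qed.

(* Membership in the ball of radius [M] of the Banach algebra described above.
   The parameter ranges over all of [R]; a parameter confined to an interval
   enters through [clamp], which spares one-sided continuity at the end points. *)
Definition fam (r M : R) (f : R -> C -> C) : Prop :=
  exists (c : nat -> R -> C) (m : nat -> R),
    (forall n x, Ccont (c n) x) /\ (forall n x, Cmod (c n x) <= m n) /\
    (forall N, sum_n (fun n => m n * r ^ n) N <= M) /\
    (forall x w, Cmod w <= r -> Cser (fun n => c n x * w ^ n)%C (f x w)).

Lemma fam_terms (c : nat -> R -> C) (m : nat -> R) (r M : R) :
  0 < r -> (forall n x, Cmod (c n x) <= m n) ->
  (forall N, sum_n (fun n => m n * r ^ n) N <= M) ->
  (forall n, 0 <= m n) /\ (forall n, m n * r ^ n <= M) /\ ex_series (fun n => m n * r ^ n) /\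
  (forall n x w, Cmod w <= r -> Cmod (c n x * w ^ n)%C <= m n * r ^ n).
Proof.
  intros Hr Hc HM.
  assert (H0 : forall n, 0 <= m n).
  { intros n; eapply Rle_trans; [apply Cmod_ge_0|apply (Hc n 0)]. }
  assert (H1 : forall n, 0 <= m n * r ^ n).
  { intros n; apply Rmult_le_pos; auto. apply pow_le; lra. }
  split; [auto|split; [|split]].
  - intros n; eapply Rle_trans; [|apply (HM n)].
    destruct n; [rewrite sum_O; lra|]. rewrite sum_Sn. unfold plus; simpl.
    assert (0 <= sum_n (fun n0 => m n0 * r ^ n0) n); [|simpl in *; lra].
    clear -H1. induction n; [rewrite sum_O; apply (H1 O)|]. rewrite sum_Sn. unfold plus; simpl.
    specialize (H1 (S n)); simpl in *; lra.
  - apply ex_series_pos_bound with M; auto.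
  - intros n x w Hw. rewrite Cmod_mult, Cmod_pow. apply Rmult_le_compat; auto using Cmod_ge_0.
    apply pow_le, Cmod_ge_0. apply pow_incr; split; auto using Cmod_ge_0.
Qed.

Lemma fam_M_pos (r M : R) (f : R -> C -> C) : 0 < r -> fam r M f -> 0 <= M.
Proof.
  intros Hr (c & m & _ & H2 & H3 & _).
  destruct (fam_terms c m r M Hr H2 H3) as (A & B & _).
  specialize (A O); specialize (B O); simpl in B; lra.
Qed.

Lemma fam_bound (r M : R) (f : R -> C -> C) (x : R) (w : C) :
  0 < r -> fam r M f -> Cmod w <= r -> Cmod (f x w) <= M.
Proof.
  intros Hr (c & m & _ & H2 & H3 & H4) Hw.
  destruct (fam_terms c m r M Hr H2 H3) as (A & B & D & E).
  apply (Cser_Cmod_le _ _ _ _ (H4 x w Hw) (fun n => E n x w Hw) H3).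
Qed.

Lemma fam_cont (r M : R) (f : R -> C -> C) (w : C) :
  0 < r -> fam r M f -> Cmod w <= r -> forall x, Ccont (fun x => f x w) x.
Proof.
  intros Hr (c & m & H1 & H2 & H3 & H4) Hw.
  destruct (fam_terms c m r M Hr H2 H3) as (A & B & D & E).
  apply (Ccont_series (fun n x => c n x * w ^ n)%C _ (fun n => m n * r ^ n)); auto.
  intros k x; apply Ccont_mult; auto using Ccont_const.
Qed.

Lemma fam_ext (r M : R) (f g : R -> C -> C) :
  (forall x w, Cmod w <= r -> f x w = g x w) -> fam r M f -> fam r M g.
Proof.
  intros H (c & m & H1 & H2 & H3 & H4); exists c, m; repeat (split; auto).
  intros x w Hw; rewrite <- H; auto.
Qed.

Lemma fam_le (r M M' : R) (f : R -> C -> C) : M <= M' -> fam r M f -> fam r M' f.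
Proof.
  intros H (c & m & H1 & H2 & H3 & H4); exists c, m; repeat (split; auto).
  intros N; eapply Rle_trans; eauto.
Qed.

Lemma Cser_single (u : nat -> C) : (forall n, u (S n) = 0) -> Cser u (u O).
Proof.
  intros H. apply Cser_Clim.
  apply Clim_ext with (fun _ => u O); [|apply Clim_const].
  intros n; induction n; [rewrite sum_O; auto|]. rewrite sum_Sn, <- IHn, H.
  change plus with Cplus. ring.
Qed.

Lemma fam_const (r B : R) (h : R -> C) :
  (forall x, Ccont h x) -> (forall x, Cmod (h x) <= B) -> fam r B (fun x _ => h x).
Proof.
  intros Hc HB.
  exists (fun n x => match n with O => h x | _ => 0 end), (fun n => match n with O => B | _ => 0 end).
  split; [|split; [|split]].
  - intros [|n] x; auto using Ccont_const.
  - intros [|n] x; auto. rewrite Cmod_0; lra.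
  - intros N; induction N; [rewrite sum_O; simpl; lra|]. rewrite sum_Sn. unfold plus; simpl.
    simpl in IHN; lra.
  - intros x w Hw.
    assert (E := Cser_single (fun n => match n with O => h x | _ => 0 end * w ^ n)%C).
    simpl in E. rewrite Cmult_1_r in E. apply E. intros n; ring.
Qed.

Lemma fam_plus (r M1 M2 : R) (f g : R -> C -> C) :
  fam r M1 f -> fam r M2 g -> fam r (M1 + M2) (fun x w => f x w + g x w)%C.
Proof.
  intros (c & m & H1 & H2 & H3 & H4) (c' & m' & H1' & H2' & H3' & H4').
  exists (fun n x => c n x + c' n x)%C, (fun n => m n + m' n).
  split; [|split; [|split]].
  - intros; apply Ccont_plus; auto.
  - intros n x; eapply Rle_trans; [apply Cmod_triangle|]. apply Rplus_le_compat; auto.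
  - intros N. rewrite (sum_n_ext _ (fun n => plus (m n * r ^ n) (m' n * r ^ n))).
    + rewrite sum_n_plus. apply Rplus_le_compat; auto.
    + intros n. unfold plus; simpl; ring.
  - intros x w Hw. apply Cser_ext with (fun n => c n x * w ^ n + c' n x * w ^ n)%C.
    + intros; ring.
    + apply Cser_plus; auto.
Qed.

Lemma fam_scal (r M B : R) (h : R -> C) (f : R -> C -> C) : 0 < r ->
  (forall x, Ccont h x) -> (forall x, Cmod (h x) <= B) ->
  fam r M f -> fam r (B * M) (fun x w => h x * f x w)%C.
Proof.
  intros Hr Hh HB (c & m & H1 & H2 & H3 & H4).
  assert (0 <= B) by (eapply Rle_trans; [apply Cmod_ge_0|apply (HB 0)]).
  exists (fun n x => h x * c n x)%C, (fun n => B * m n).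
  split; [|split; [|split]].
  - intros; apply Ccont_mult; auto.
  - intros n x; rewrite Cmod_mult. apply Rmult_le_compat; auto using Cmod_ge_0.
  - intros N. rewrite (sum_n_ext _ (fun n => mult B (m n * r ^ n))).
    + rewrite (sum_n_mult_l (K:=R_Ring)). apply Rmult_le_compat_l; auto.
    + intros n. unfold mult; simpl; ring.
  - intros x w Hw. apply Cser_ext with (fun n => h x * (c n x * w ^ n))%C.
    + intros; ring.
    + apply Cser_scal; auto.
Qed.

Lemma fam_shift (r M : R) (f : R -> C -> C) : 0 < r ->
  fam r M f -> fam r (r * M) (fun x w => w * f x w)%C.
Proof.
  intros Hr HF. assert (HM := fam_M_pos r M f Hr HF).
  destruct HF as (c & m & H1 & H2 & H3 & H4).
  exists (fun n x => match n with O => RtoC 0 | S n => c n x end),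
    (fun n => match n with O => 0 | S n => m n end).
  split; [|split; [|split]].
  - intros [|n] x; auto using Ccont_const.
  - intros [|n] x; auto. rewrite Cmod_0; lra.
  - intros N.
    destruct N; [rewrite sum_O; simpl; nra|].
    specialize (H3 N); revert H3.
    assert (G : sum_n (fun n => match n with O => 0 | S n => m n end * r ^ n) (S N)
      = r * sum_n (fun n => m n * r ^ n) N).
    { clear -Hr. induction N; [rewrite sum_Sn, !sum_O; unfold plus; simpl; ring|].
      rewrite sum_Sn, IHN, sum_Sn. unfold plus; simpl. ring. }
    rewrite G. intros; apply Rmult_le_compat_l; lra.
  - intros x w Hw.
    replace (w * f x w)%C with (w * f x w + (0 * w ^ 0))%C by ring.
    apply (Cser_decr_1 (fun n => match n with O => RtoC 0 | S n => c n x end * w ^ n)%C).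
    apply Cser_ext with (fun n => w * (c n x * w ^ n))%C; [intros; simpl; ring|].
    apply Cser_scal; auto.
Qed.

Lemma fam_monomial (r M : R) (k : nat) (f : R -> C -> C) : 0 < r ->
  fam r M f -> fam r (r ^ k * M) (fun x w => w ^ k * f x w)%C.
Proof.
  intros Hr HF; induction k.
  - simpl. rewrite Rmult_1_l. apply fam_ext with f; auto. intros; simpl; ring.
  - apply fam_ext with (fun x w => w * (w ^ k * f x w))%C; [intros; simpl; ring|].
    simpl. rewrite Rmult_assoc. apply fam_shift; auto.
Qed.

(** Completeness of the algebra: the power series are added coefficientwise, and absolute
    convergence allows the sums over [k] and [n] to be exchanged. *)
Lemma fam_series (r : R) (M : nat -> R) (f : nat -> R -> C -> C) (F : R -> C -> C) : 0 < r ->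
  (forall k, fam r (M k) (f k)) -> ex_series M ->
  (forall x w, Cmod w <= r -> Cser (fun k => f k x w) (F x w)) ->
  fam r (Series M) F.
Proof.
  intros Hr Hf EM HF.
  destruct (functional_choice _ _ _ Hf) as [c Hc].
  destruct (functional_choice _ _ _ Hc) as [m Hm].
  assert (HT := fun k => fam_terms (c k) (m k) r (M k) Hr
     (proj1 (proj2 (Hm k))) (proj1 (proj2 (proj2 (Hm k))))).
  assert (HM0 : forall k, 0 <= M k) by (intros k; eapply fam_M_pos; eauto).
  assert (Hrn : forall n, 0 < r ^ n) by (intros; apply pow_lt; auto).
  (* For fixed [n], [m k n r^n] is one term of a nonnegative sum that is at most [M k], hence
     [m k n <= M k / r^n]. *)
  assert (Em : forall n, ex_series (fun k => m k n)).
  { intros n. apply ex_series_Rle with (fun k => M k * / r ^ n).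
    - intros k. destruct (HT k) as (A & B & _).
      rewrite Rabs_pos_eq by auto.
      apply Rmult_le_reg_r with (r ^ n); auto.
      rewrite Rmult_assoc, Rinv_l, Rmult_1_r; auto. apply Rgt_not_eq, Hrn.
    - destruct EM as [l Hl]. exists (l * / r ^ n). apply is_series_scal_r; auto. }
  assert (Hcm : forall k n x, Cmod (c k n x) <= m k n) by (intros; apply (Hm k)).
  assert (Sc : forall n x, Cser (fun k => c k n x) (Csum (fun k => c k n x))).
  { intros n x; apply Cser_Csum with (fun k => m k n); auto. }
  exists (fun n x => Csum (fun k => c k n x)), (fun n => Series (fun k => m k n)).
  split; [|split; [|split]].
  - intros n. apply (Ccont_series (fun k x => c k n x) _ (fun k => m k n)); auto.
    intros k x; apply (Hm k).
  - intros n x. apply (Cser_Cmod_le_Series (fun k => c k n x) (fun k => m k n)); auto.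
  - intros N.
    assert (E : is_series (fun k => sum_n (fun n => m k n * r ^ n) N)
        (sum_n (fun n => Series (fun k => m k n) * r ^ n) N)).
    { induction N.
      - rewrite sum_O. apply is_series_ext with (fun k => m k 0%nat * r ^ 0).
        + intros; rewrite sum_O; auto.
        + apply is_series_scal_r, Series_correct; auto.
      - rewrite sum_Sn. apply is_series_ext with
          (fun k => plus (sum_n (fun n => m k n * r ^ n) N) (m k (S N) * r ^ S N)).
        + intros; rewrite sum_Sn; auto.
        + apply (@is_series_plus R_AbsRing R_NormedModule); auto.
          apply is_series_scal_r, Series_correct; auto. }
    rewrite <- (is_series_unique _ _ E). apply Series_le; auto.
    intros k. split; [|apply (Hm k)].
    clear -HT Hrn. destruct (HT k) as (A & _).
    assert (P : forall n, 0 <= m k n * r ^ n).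
    { intros n; apply Rmult_le_pos; auto. left; auto. }
    induction N; [rewrite sum_O; auto|]. rewrite sum_Sn. unfold plus; simpl.
    specialize (P (S N)); simpl in P; lra.
  - intros x w Hw.
    apply (Cser_Fubini (fun k n => c k n x * w ^ n)%C M (fun k => f k x w)); auto.
    + intros k N. eapply Rle_trans; [|apply (Hm k)].
      apply sum_n_m_le. intros n. apply (HT k); auto.
    + intros k; apply (Hm k); auto.
    + intros n. apply Cser_ext with (fun k => w ^ n * c k n x)%C; [intros; ring|].
      replace (Csum (fun k => c k n x) * w ^ n)%C with (w ^ n * Csum (fun k => c k n x))%C by ring.
      apply Cser_scal; auto.
Qed.

(** Expanding only [f] writes the product as the sum over [k] of [c k] times [w^k g], with norms at
    most [m k r^k M2]; no Cauchy product is formed. *)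
Lemma fam_mult (r M1 M2 : R) (f g : R -> C -> C) : 0 < r ->
  fam r M1 f -> fam r M2 g -> fam r (M1 * M2) (fun x w => f x w * g x w)%C.
Proof.
  intros Hr (c & m & H1 & H2 & H3 & H4) Hg.
  assert (P := fam_M_pos _ _ _ Hr Hg).
  destruct (fam_terms c m r M1 Hr H2 H3) as (A & B & D & E).
  apply fam_le with (Series (fun k => m k * (r ^ k * M2))).
  - rewrite (Series_ext _ (fun k => (m k * r ^ k) * M2)) by (intros; ring).
    rewrite Series_scal_r. apply Rmult_le_compat_r; auto. apply Series_bound; auto.
  - apply fam_series with (fun k x w => c k x * (w ^ k * g x w))%C; auto.
    + intros k. apply fam_scal; auto. apply fam_monomial; auto.
    + destruct D as [l Hl]. exists (l * M2).
      apply is_series_ext with (fun k => m k * r ^ k * M2);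
        [intros k; exact (Rmult_assoc (m k) (r ^ k) M2)|].
      apply is_series_scal_r; auto.
    + intros x w Hw. rewrite Cmult_comm.
      apply Cser_ext with (fun k => g x w * (c k x * w ^ k))%C; [intros; ring|].
      apply Cser_scal; auto.
Qed.

Lemma fam_reparam (r M : R) (f : R -> C -> C) (g : R -> R) :
  (forall x, continuous g x) -> fam r M f -> fam r M (fun x w => f (g x) w).
Proof.
  intros Hg (c & m & H1 & H2 & H3 & H4); exists (fun n x => c n (g x)), m; repeat (split; auto).
  intros n x; apply Ccont_comp; auto.
Qed.

Lemma fam_var (r : R) : 0 < r -> fam r r (fun _ w => w).
Proof.
  intros Hr. apply fam_ext with (fun (_ : R) w => w * 1)%C; [intros; ring|].
  rewrite <- (Rmult_1_r r) at 2. apply fam_shift; auto.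
  apply fam_const; [intros; apply Ccont_const|]. intros; rewrite Cmod_1; lra.
Qed.

Lemma fam_affine (r : R) (a u : C) : 0 < r ->
  fam r (Cmod a + Cmod u * r) (fun _ w => a + u * w)%C.
Proof.
  intros Hr. apply fam_plus.
  - apply fam_const; intros; [apply Ccont_const|lra].
  - apply fam_scal with (h := fun _ => u); auto using fam_var; intros; [apply Ccont_const|lra].
Qed.

Lemma fam_exp (r L : R) (l : R -> C) : 0 < r ->
  (forall x, Ccont l x) -> (forall x, Cmod (l x) <= L) ->
  fam r (exp (L * r)) (fun x w => Cexp (l x * w)).
Proof.
  intros Hr Hl HL.
  assert (0 <= L) by (eapply Rle_trans; [apply Cmod_ge_0|apply (HL 0)]).
  assert (Hf : forall n, RtoC (INR (fact n)) <> 0).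
  { intros n E. apply RtoC_inj in E. generalize (INR_fact_neq_0 n); auto. }
  assert (Hf' : forall n, 0 < / INR (fact n)).
  { intros n. apply Rinv_0_lt_compat, INR_fact_lt_0. }
  exists (fun n x => l x ^ n / RtoC (INR (fact n)))%C, (fun n => L ^ n / INR (fact n)).
  split; [|split; [|split]].
  - intros n x. apply Ccont_mult; auto using Ccont_const, Ccont_pow.
  - intros n x. rewrite Cmod_div by auto. rewrite Cmod_pow, Cmod_R.
    rewrite (Rabs_pos_eq (INR _)) by apply pos_INR.
    apply Rmult_le_compat_r; [left; auto|]. apply pow_incr; auto using Cmod_ge_0.
  - intros N. assert (E := exp_pow_series (L * r)).
    rewrite (sum_n_ext _ (fun n => (L * r) ^ n / INR (fact n))).
    + rewrite <- (is_series_unique _ _ E). apply Series_partial_le.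
      * intros n. apply Rmult_le_pos; [|left; auto]. apply pow_le. nra.
      * exists (exp (L * r)); auto.
    + intros n. rewrite Rpow_mult_distr. match goal with |- ?a = ?b => change (a = b :> R) end. unfold Rdiv; ring.
  - intros x w Hw. apply Cser_ext with (2 := Cexp_series (l x * w)).
    intros n. rewrite Cpow_mult_l. unfold Cdiv; ring.
Qed.

Lemma Csum_geom_partial (z : C) (N : nat) :
  ((1 - z) * @sum_n C_AbelianMonoid (fun n => z ^ n)%C N = 1 - z ^ S N)%C.
Proof.
  induction N; [rewrite sum_O; simpl; ring|]. rewrite sum_Sn. change plus with Cplus.
  rewrite Cmult_plus_distr_l, IHN. simpl; ring.
Qed.

Lemma Cser_geom (z : C) : Cmod z < 1 -> Cser (fun n => z ^ n)%C (/ (1 - z)).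
Proof.
  intros H.
  assert (Hz : (1 - z)%C <> 0).
  { intros E. replace z with (RtoC 1) in H; [rewrite Cmod_1 in H; lra|].
    replace (RtoC 1) with ((1 - z) + z)%C by ring. rewrite E; ring. }
  apply Cser_Clim.
  apply Clim_ext with (fun N => / (1 - z) + - (/ (1 - z)) * z ^ S N)%C.
  { intros N. replace (@sum_n C_AbelianMonoid (fun n => z ^ n)%C N) with
      (/ (1 - z) * ((1 - z) * @sum_n C_AbelianMonoid (fun n => z ^ n)%C N))%C.
    - rewrite Csum_geom_partial. field; auto.
    - field; auto. }
  replace (/ (1 - z))%C with (/ (1 - z) + - (/ (1 - z)) * 0)%C at 1 by ring.
  apply Clim_plus; [apply Clim_const|]. apply Clim_mult; [apply Clim_const|].
  apply (Clim_incr_1 (fun N => z ^ N)%C).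
  apply Clim_0_bound with (fun N => Cmod z ^ N).
  - intros; rewrite Cmod_pow; lra.
  - apply is_lim_seq_geom. rewrite Rabs_pos_eq; auto using Cmod_ge_0.
Qed.

Lemma fam_recip (r : R) (l : C) : 0 < r -> Cmod l * r <= 1 / 2 ->
  fam r 2 (fun _ w => / (1 - l * w))%C.
Proof.
  intros Hr Hl. assert (P := Cmod_ge_0 l).
  exists (fun n _ => l ^ n)%C, (fun n => Cmod l ^ n).
  split; [|split; [|split]].
  - intros; apply Ccont_const.
  - intros; rewrite Cmod_pow; lra.
  - intros N. rewrite (sum_n_ext _ (fun n => (Cmod l * r) ^ n)); [|intros; rewrite Rpow_mult_distr; auto].
    assert (Q : 0 <= Cmod l * r) by nra.
    assert (E := is_series_geom (Cmod l * r)).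
    rewrite Rabs_pos_eq in E by auto. specialize (E ltac:(lra)).
    eapply Rle_trans; [apply Series_partial_le|].
    + intros n; apply pow_le; auto.
    + eexists; exact E.
    + rewrite (is_series_unique _ _ E).
      apply Rmult_le_reg_l with (1 - Cmod l * r); [lra|]. rewrite Rinv_r by lra. lra.
  - intros x w Hw. apply Cser_ext with (fun n => (l * w) ^ n)%C; [intros; apply Cpow_mult_l|].
    apply Cser_geom. rewrite Cmod_mult.
    assert (Cmod l * Cmod w <= Cmod l * r) by (apply Rmult_le_compat_l; auto). lra.
Qed.

(** On the disc [|u w| <= d / 2 <= |a| / 2], so the affine factor has no zero; after division by [a]
    its inverse is a geometric series of ratio at most 1/2. *)
Lemma fam_inv_affine (r d : R) (a u : C) : 0 < r -> 0 < d -> d <= Cmod a -> 2 * Cmod u * r <= d ->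
  fam r (2 / d) (fun _ w => / (a + u * w))%C.
Proof.
  intros Hr Hd Ha Hu.
  assert (a <> 0) by (apply Cmod_gt_0; lra).
  assert (A : Cmod (- (u / a)) * r <= 1 / 2).
  { rewrite Cmod_opp, Cmod_div by auto.
    apply Rmult_le_reg_r with (2 * Cmod a); [lra|]. unfold Rdiv.
    replace (Cmod u * / Cmod a * r * (2 * Cmod a)) with (2 * Cmod u * r) by (field; lra). lra. }
  assert (B := fam_recip r _ Hr A).
  apply fam_le with (/ Cmod a * 2).
  { unfold Rdiv. rewrite (Rmult_comm 2). apply Rmult_le_compat_r; [lra|]. apply Rinv_le_contravar; auto. }
  apply fam_ext with (fun (_ : R) w => / a * / (1 - - (u / a) * w))%C.
  - intros _ w Hw.
    assert (N : (a + u * w)%C <> 0).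
    { intros E. assert (F : a = (- (u * w))%C).
      { replace a with (a + u * w - u * w)%C by ring. rewrite E; ring. }
      rewrite F, Cmod_opp, Cmod_mult in Ha.
      assert (Cmod u * Cmod w <= Cmod u * r) by (apply Rmult_le_compat_l; auto using Cmod_ge_0).
      lra. }
    replace (1 - - (u / a) * w)%C with ((a + u * w) / a)%C by (field; auto).
    field; auto.
  - apply (fam_scal r 2 (/ Cmod a) (fun _ => / a)%C); auto.
    + intros; apply Ccont_const.
    + intros; rewrite Cmod_inv; auto; lra.
Qed.

(** Termwise integration of the coefficients. The real weight [k] is there for the kernel
    [1 + y - u] of Euler summation; [k = 1] gives the plain integral. *)
Lemma fam_int_series (r M : R) (f : R -> C -> C) (c : nat -> R -> C) (m : nat -> R)
   (k : R -> R) (a b : R) (w : C) : 0 < r -> a <= b -> Cmod w <= r ->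
   (forall n x, Ccont (c n) x) -> (forall n x, Cmod (c n x) <= m n) ->
   (forall N, sum_n (fun n => m n * r ^ n) N <= M) ->
   (forall x, Cser (fun n => c n x * w ^ n)%C (f x w)) ->
   (forall x, continuous k x) -> (forall x, a <= x <= b -> Rabs (k x) <= 1) ->
   Cser (fun n => CInt (fun u => RtoC (k u) * c n u)%C a b * w ^ n)%C
     (CInt (fun u => RtoC (k u) * f u w)%C a b).
Proof.
  intros Hr Hab Hw H1 H2 H3 H4 Hk Hk1.
  destruct (fam_terms c m r M Hr H2 H3) as (A & B & D & E).
  assert (cc : forall n x, Ccont (fun u => RtoC (k u) * c n u)%C x).
  { intros; apply Ccont_mult; auto. apply Ccont_RtoC; auto. }
  destruct (is_CInt_series_on (fun n u => RtoC (k u) * (c n u * w ^ n))%C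
    (fun u => RtoC (k u) * f u w)%C (fun n => m n * r ^ n) a b Hab) as [_ S].
  - intros n x _. apply Ccont_mult; [apply Ccont_RtoC; auto|apply Ccont_mult; auto using Ccont_const].
  - intros n x Hx. rewrite Cmod_mult, Cmod_R.
    assert (X := E n x w Hw). assert (Y := Hk1 x Hx).
    rewrite <- (Rmult_1_l (m n * r ^ n)).
    apply Rmult_le_compat; auto using Cmod_ge_0, Rabs_pos.
  - auto.
  - intros x Hx. apply Cser_scal; auto.
  - apply Cser_ext with (2 := S). intros n.
    apply CInt_eq. apply is_CInt_ext with (fun u => w ^ n * (RtoC (k u) * c n u))%C.
    + intros; ring.
    + rewrite Cmult_comm. apply is_CInt_scal, is_CInt_CInt. auto.
Qed.

Lemma CInt_weight_bound (c : R -> C) (k : R -> R) (a b B : R) :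
  0 <= b - a <= 1 -> (forall x, Ccont c x) -> (forall x, Cmod (c x) <= B) ->
   (forall x, continuous k x) -> (forall x, a <= x <= b -> Rabs (k x) <= 1) ->
  Cmod (CInt (fun u => RtoC (k u) * c u)%C a b) <= B.
Proof.
  intros Hab Hc HB Hk Hk1.
  assert (0 <= B) by (eapply Rle_trans; [apply Cmod_ge_0|apply (HB a)]).
  apply Rle_trans with ((b - a) * B); [|nra].
  apply (is_CInt_Cmod_le_const (fun u => RtoC (k u) * c u)%C a b); [lra| |].
  - intros x Hx. rewrite Cmod_mult, Cmod_R. rewrite <- (Rmult_1_l B).
    apply Rmult_le_compat; auto using Cmod_ge_0, Rabs_pos.
  - apply is_CInt_CInt. intros; apply Ccont_mult; auto. apply Ccont_RtoC; auto.
Qed.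

Lemma fam_int01 (r M : R) (f : R -> C -> C) : 0 < r ->
  fam r M f -> fam r M (fun _ w => CInt (fun x => f x w) 0 1).
Proof.
  intros Hr (c & m & H1 & H2 & H3 & H4).
  apply fam_ext with (fun _ w => CInt (fun x => RtoC 1 * f x w)%C 0 1).
  { intros; apply CInt_ext. intros; ring. }
  exists (fun n _ => CInt (fun x => RtoC 1 * c n x)%C 0 1), m.
  split; [|split; [|split]]; auto.
  - intros; apply Ccont_const.
  - intros n x. apply (CInt_weight_bound (c n) (fun _ => 1)); auto; try lra.
    intros; apply continuous_const. intros; rewrite Rabs_R1; lra.
  - intros x w Hw. apply (fam_int_series r M f c m (fun _ => 1)); auto; try lra.
    intros; apply continuous_const. intros; rewrite Rabs_R1; lra.
Qed.

Lemma Ccont_CInt_window (h : R -> C) (y : R) :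
  (forall x, Ccont h x) -> Ccont (fun y => CInt h y (y + 1)) y.
Proof.
  intros Hh.
  assert (A : forall y, Ccont (fun y => CInt h 0 y) y).
  { intros x. apply is_Cder_Ccont with (h x).
    apply (@is_derive_RInt C_R_NormedModule h (fun y => CInt h 0 y) 0 x).
    - exists (mkposreal _ Rlt_0_1). intros t _. apply is_CInt_CInt; auto.
    - apply Hh. }
  apply Ccont_ext with (fun y => CInt h 0 (y + 1) - CInt h 0 y)%C.
  - intros t. symmetry. apply CInt_eq.
    replace (CInt h 0 (t + 1) - CInt h 0 t)%C with (- CInt h 0 t + CInt h 0 (t + 1))%C by ring.
    apply (@is_RInt_Chasles C_R_NormedModule h t 0 (t + 1)).
    + apply (@is_RInt_swap C_R_NormedModule). apply is_CInt_CInt; auto.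
    + apply is_CInt_CInt; auto.
  - apply Ccont_minus; auto. apply (Ccont_comp (fun y => CInt h 0 y) (fun y => y + 1)); auto.
    apply Rcont_plus; [apply continuous_id|apply continuous_const].
Qed.

(** The operation performed by one Euler summation step. A window of length 1 and a kernel between 0
    and 1 keep the norm bound [M] unchanged. *)
Lemma fam_int_window (r M : R) (f : R -> C -> C) (g : R -> R) : 0 < r ->
  (forall x, continuous g x) -> fam r M f ->
  fam r M (fun x w => CInt (fun u => RtoC (1 + g x - u) * f u w)%C (g x) (g x + 1)).
Proof.
  intros Hr Hg (c & m & H1 & H2 & H3 & H4).
  assert (Hk : forall y x : R, continuous (fun u => 1 + y - u) x).
  { intros; apply Rcont_minus; [apply continuous_const|apply continuous_id]. }
  assert (Hk1 : forall y x : R, y <= x <= y + 1 -> Rabs (1 + y - x) <= 1).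
  { intros; apply Rabs_le; lra. }
  exists (fun n x => CInt (fun u => RtoC (1 + g x - u) * c n u)%C (g x) (g x + 1)), m.
  split; [|split; [|split]]; auto.
  - intros n x. apply (Ccont_comp (fun y => CInt (fun u => RtoC (1 + y - u) * c n u)%C y (y + 1)) g); auto.
    assert (cu : forall x, Ccont (fun u => RtoC u * c n u)%C x).
    { intros; apply Ccont_mult; auto. apply Ccont_RtoC, continuous_id. }
    (* Splitting the kernel into [1 + y] and [u] removes [y] from the integrands, so that only the
       end points still move. *)
    apply Ccont_ext with (fun y => RtoC (1 + y) * CInt (c n) y (y + 1) -
        CInt (fun u => RtoC u * c n u)%C y (y + 1))%C.
    + intros t. symmetry. apply CInt_eq.
      apply is_CInt_ext with (fun u => RtoC (1 + t) * c n u - RtoC u * c n u)%C.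
      * intros u _. rewrite (RtoC_minus (1 + t) u). ring.
      * apply is_CInt_minus; [apply is_CInt_scal|]; apply is_CInt_CInt; auto.
    + apply Ccont_minus; [apply Ccont_mult|].
      * apply Ccont_RtoC. apply Rcont_plus; [apply continuous_const|apply continuous_id].
      * apply Ccont_CInt_window; auto.
      * apply Ccont_CInt_window; auto.
  - intros n x. apply (CInt_weight_bound (c n) (fun u => 1 + g x - u)); auto; try lra.
  - intros x w Hw. apply (fam_int_series r M f c m (fun u => 1 + g x - u)); auto; try lra.
Qed.

Lemma Cpow_pow_n (z : C) (n : nat) : @pow_n C_AbsRing z n = (z ^ n)%C.
Proof. induction n; simpl; [reflexivity|rewrite IHn; reflexivity]. Qed.

Lemma is_pseries_Cser (c : nat -> C) (z l : C) :
  @is_pseries C_AbsRing C_NormedModule c z l <-> Cser (fun n => c n * z ^ n)%C l.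
Proof.
  assert (E : forall n, @scal C_AbsRing C_NormedModule (@pow_n C_AbsRing z n) (c n) = (c n * z ^ n)%C).
  { intros n. rewrite Cpow_pow_n. exact (Cmult_comm _ _). }
  unfold is_pseries, Cser; split; apply is_series_ext; intros n; rewrite E; reflexivity.
Qed.

Lemma fam_analytic (r M : R) (g : C -> C) (z0 : C) : 0 < r ->
  fam r M (fun _ w => g (z0 + w)%C) -> analytic_at g z0.
Proof.
  intros Hr (c & m & H1 & H2 & H3 & H4).
  exists (fun n => c n 0), r; split; auto. intros z Hz.
  apply is_pseries_Cser. assert (E := H4 0 (z - z0)%C ltac:(lra)).
  replace (z0 + (z - z0))%C with z in E by ring. exact E.
Qed.

End Families.

(** * Identity theorem *)

Section Identity.
Local Open Scope R_scope.

Lemma analytic_minus (f g : C -> C) (z0 : C) :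
  analytic_at f z0 -> analytic_at g z0 -> analytic_at (fun z => f z - g z)%C z0.
Proof.
  intros (c & r & Hr & H) (c' & r' & Hr' & H').
  exists (fun n => c n - c' n)%C, (Rmin r r'); split; [apply Rmin_pos; auto|].
  intros z Hz. apply is_pseries_Cser.
  assert (A := H z (Rlt_le_trans _ _ _ Hz (Rmin_l _ _))).
  assert (B := H' z (Rlt_le_trans _ _ _ Hz (Rmin_r _ _))).
  apply is_pseries_Cser in A; apply is_pseries_Cser in B.
  apply Cser_ext with (2 := Cser_minus _ _ _ _ A B). intros; ring.
Qed.

Lemma analytic_affine (f : C -> C) (a u t : C) :
  analytic_at f (a + t * u)%C -> analytic_at (fun s => f (a + s * u)%C) t.
Proof.
  intros (c & r & Hr & H). assert (P := Cmod_ge_0 u).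
  exists (fun n => c n * u ^ n)%C, (r / (Cmod u + 1)); split.
  { apply Rdiv_lt_0_compat; lra. }
  intros z Hz. apply is_pseries_Cser.
  assert (A : Cmod (a + z * u - (a + t * u))%C < r).
  { replace (a + z * u - (a + t * u))%C with ((z - t) * u)%C by ring.
    rewrite Cmod_mult. apply Rle_lt_trans with (Cmod (z - t)%C * (Cmod u + 1)).
    - apply Rmult_le_compat_l; [apply Cmod_ge_0|lra].
    - apply Rmult_lt_reg_r with (/ (Cmod u + 1)); [apply Rinv_0_lt_compat; lra|].
      rewrite Rmult_assoc, Rinv_r, Rmult_1_r by lra. exact Hz. }
  assert (B := H _ A). apply is_pseries_Cser in B.
  apply Cser_ext with (2 := B). intros n.
  replace (a + z * u - (a + t * u))%C with (u * (z - t))%C by ring.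
  rewrite Cpow_mult_l. ring.
Qed.

(** Since the sum is 0, [- c 0] is [t] times the series of shifted coefficients, which is bounded
    uniformly for [t <= rho / 2]. Small [t] forces [c 0 = 0], and division by [t] then gives the
    same hypothesis for the shifted series. *)
Lemma pseries_zero_step (c : nat -> C) (rho B delta : R) : 0 < rho -> 0 < delta <= rho / 2 ->
  (forall k, Cmod (c k) * rho ^ k <= B) ->
  (forall t : R, 0 < t < delta -> Cser (fun k => c k * RtoC t ^ k)%C 0) ->
  c O = 0 /\ (forall t : R, 0 < t < delta -> Cser (fun k => c (S k) * RtoC t ^ k)%C 0).
Proof.
  intros Hr Hd HB H.
  assert (B0 : 0 <= B).
  { eapply Rle_trans; [|apply (HB O)]. simpl. rewrite Rmult_1_r. apply Cmod_ge_0. }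
  assert (S1 : forall t, 0 < t < delta -> Cser (fun k => RtoC t * (c (S k) * RtoC t ^ k))%C (- c O)%C).
  { intros t Ht. assert (A := Cser_incr_1 _ _ (H t Ht)).
    replace (- c O)%C with (0 - c O * RtoC t ^ 0)%C by (simpl; ring).
    apply Cser_ext with (2 := A). intros; simpl; ring. }
  (* Comes from [|c (k+1)| t^k <= (B / rho) (t / rho)^k] and [t / rho <= 1/2]. *)
  set (M := fun k => B / rho * (1 / 2) ^ k).
  assert (EM : is_series M (B / rho * 2)).
  { unfold M. replace (B / rho * 2) with (scal (B / rho) (/ (1 - 1/2))).
    - apply (@is_series_scal R_AbsRing R_NormedModule). apply is_series_geom.
      rewrite Rabs_pos_eq; lra.
    - unfold scal; simpl; unfold mult; simpl. field. lra. }
  assert (BT : forall t k, 0 < t < delta -> Cmod (c (S k) * RtoC t ^ k)%C <= M k).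
  { intros t k Ht. rewrite Cmod_mult, Cmod_pow, Cmod_R, Rabs_pos_eq by lra.
    unfold M. specialize (HB (S k)). simpl in HB.
    assert (Hk : 0 < rho ^ k) by (apply pow_lt; auto).
    apply Rmult_le_reg_r with (rho * rho ^ k); [apply Rmult_lt_0_compat; auto|].
    assert (t ^ k <= (1/2) ^ k * rho ^ k).
    { rewrite <- Rpow_mult_distr. apply pow_incr; lra. }
    replace (B / rho * (1 / 2) ^ k * (rho * rho ^ k)) with (B * ((1/2) ^ k * rho ^ k)) by (field; lra).
    replace (Cmod (c (S k)) * t ^ k * (rho * rho ^ k)) with (Cmod (c (S k)) * (rho * rho ^ k) * t ^ k) by ring.
    apply Rmult_le_compat; auto.
    - apply Rmult_le_pos; [apply Cmod_ge_0|]. apply Rmult_le_pos; lra.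
    - apply pow_le; lra. }
  assert (Z : c O = 0).
  { destruct (Req_dec (Cmod (c O)) 0) as [E|E]; [apply Cmod_eq_0; auto|].
    assert (P : 0 < Cmod (c O)) by (generalize (Cmod_ge_0 (c O)); lra).
    set (K := B / rho * 2 + 1).
    assert (KP : 0 < K).
    { unfold K. assert (0 <= B / rho); [|lra]. apply Rmult_le_pos; auto.
      left; apply Rinv_0_lt_compat; auto. }
    (* [K] exceeds the bound [2 B / rho] of the shifted series, so this [t] would give
       [|c 0| <= t K <= |c 0| / 2]. *)
    set (t := Rmin (delta / 2) (Cmod (c O) / K / 2)).
    assert (Q : 0 < Cmod (c O) / K) by (apply Rdiv_lt_0_compat; auto).
    assert (Ht : 0 < t < delta).
    { unfold t; split; [apply Rmin_pos; lra|]. eapply Rle_lt_trans; [apply Rmin_l|lra]. }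
    assert (L : Cmod (- c O)%C <= t * (B / rho * 2)).
    { apply (Cser_Cmod_le _ (fun k => t * M k) _ _ (S1 t Ht)).
      - intros n. rewrite Cmod_mult, Cmod_R, Rabs_pos_eq by lra.
        apply Rmult_le_compat_l; [lra|]. auto.
      - intros N. rewrite (sum_n_mult_l (K := R_Ring)). apply Rmult_le_compat_l; [lra|].
        rewrite <- (is_series_unique _ _ EM). apply Series_partial_le.
        + intros n. unfold M. apply Rmult_le_pos; [|apply pow_le; lra].
          apply Rmult_le_pos; auto. left; apply Rinv_0_lt_compat; auto.
        + eexists; exact EM. }
    rewrite Cmod_opp in L.
    assert (t <= Cmod (c O) / K / 2) by apply Rmin_r.
    assert (t * K <= Cmod (c O) / 2).
    { apply Rmult_le_reg_r with (/ K); [apply Rinv_0_lt_compat; auto|].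
      rewrite Rmult_assoc, Rinv_r, Rmult_1_r by lra. unfold Rdiv in *. lra. }
    unfold K in *. nra. }
  split; auto.
  intros t Ht. assert (A := S1 t Ht). rewrite Z in A.
  assert (T0 : RtoC t <> 0) by (intros E; apply RtoC_inj in E; lra).
  replace (RtoC 0) with (/ RtoC t * - 0)%C by ring.
  apply Cser_ext with (2 := Cser_scal (/ RtoC t) _ _ A).
  intros n. field; auto.
Qed.

(** Convergence at [r] bounds [|c k| r^k], because the terms tend to 0; [pseries_zero_step] then
    removes one coefficient at a time. *)
Lemma pseries_zero (c : nat -> C) (r delta : R) (l : C) : 0 < r -> 0 < delta ->
  Cser (fun k => c k * RtoC r ^ k)%C l ->
  (forall t : R, 0 < t < delta -> Cser (fun k => c k * RtoC t ^ k)%C 0) ->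
  forall k, c k = 0.
Proof.
  intros Hr Hd Hl H.
  assert (HB : exists B, forall k, Cmod (c k) * r ^ k <= B).
  { apply Cser_re_im in Hl; destruct Hl as [A B].
    assert (A' := ex_series_lim_0 _ (ex_intro _ _ A)).
    assert (B' := ex_series_lim_0 _ (ex_intro _ _ B)).
    assert (D : Clim (fun k => c k * RtoC r ^ k)%C 0) by (apply Clim_re_im; auto).
    apply is_lim_seq_spec in D. destruct (D (mkposreal 1 Rlt_0_1)) as [N HN]; simpl in HN.
    assert (HN' : forall n, (N <= n)%nat -> Cmod (c n) * r ^ n <= 1).
    { intros n Hn; specialize (HN n Hn). revert HN.
      replace (c n * RtoC r ^ n - 0)%C with (c n * RtoC r ^ n)%C by ring.
      rewrite Rminus_0_r, Rabs_pos_eq by apply Cmod_ge_0.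
      rewrite Cmod_mult, Cmod_pow, Cmod_R, Rabs_pos_eq by lra. lra. }
    clear -HN'.
    assert (G : forall L, exists B, 1 <= B /\ forall n, (n < L)%nat -> Cmod (c n) * r ^ n <= B).
    { induction L as [|L [B [B1 IH]]]; [exists 1; split; [lra|intros; lia]|].
      exists (Rmax B (Cmod (c L) * r ^ L)); split; [eapply Rle_trans; [exact B1|apply Rmax_l]|].
      intros n Hn. destruct (Nat.eq_dec n L) as [->|E]; [apply Rmax_r|].
      eapply Rle_trans; [apply IH; lia|apply Rmax_l]. }
    destruct (G N) as [B [B1 HB]]. exists B; intros k.
    destruct (Nat.lt_ge_cases k N); auto. eapply Rle_trans; [apply HN'; auto|auto]. }
  destruct HB as [B HB].
  set (d := Rmin delta (r / 2)).
  assert (Hd' : 0 < d <= r / 2) by (unfold d; split; [apply Rmin_pos; lra|apply Rmin_r]).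
  assert (H' : forall t : R, 0 < t < d -> Cser (fun k => c k * RtoC t ^ k)%C 0).
  { intros t Ht; apply H. split; [lra|]. eapply Rlt_le_trans; [apply Ht|apply Rmin_l]. }
  clearbody d. clear H Hl Hd.
  assert (G : forall k, (exists B, forall j, Cmod (c (k + j)%nat) * r ^ j <= B) /\
    (forall t : R, 0 < t < d -> Cser (fun j => c (k + j)%nat * RtoC t ^ j)%C 0)).
  { induction k as [|k [[B' IH1] IH2]]; [split; [exists B|]; auto|].
    destruct (pseries_zero_step (fun j => c (k + j)%nat) r B' d Hr Hd' IH1 IH2) as [_ Q].
    split.
    - exists (B' / r). intros j. specialize (IH1 (S j)). simpl in IH1.
      rewrite <- plus_n_Sm in IH1. simpl.
      apply Rmult_le_reg_r with r; auto. unfold Rdiv. rewrite (Rmult_assoc B'), Rinv_l, Rmult_1_r by lra.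
      eapply Rle_trans; [|exact IH1]. right; ring.
    - intros t Ht. apply Cser_ext with (2 := Q t Ht). intros n.
      rewrite <- plus_n_Sm; reflexivity. }
  intros k. destruct (G k) as [[B' G1] G2].
  destruct (pseries_zero_step (fun j => c (k + j)%nat) r B' d Hr Hd' G1 G2) as [Q _].
  rewrite Nat.add_0_r in Q; auto.
Qed.

(** Zeros on one side of [t0] annihilate all Taylor coefficients at [t0], so [f] vanishes on the
    other side too. *)
Lemma analytic_zero_right (f : C -> C) (t0 t1 : R) : t0 < t1 ->
  analytic_at f (RtoC t0) -> (forall t : R, t0 < t < t1 -> f (RtoC t) = 0) ->
  exists r, 0 < r /\ forall t : R, Rabs (t - t0) < r -> f (RtoC t) = 0.
Proof.
  intros Ht (c & r & Hr & H) Hz. exists r; split; auto.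
  assert (C0 : forall k, c k = 0).
  { apply (pseries_zero c (r / 2) (Rmin r (t1 - t0)) (f (RtoC (t0 + r / 2)))).
    - lra.
    - apply Rmin_pos; lra.
    - assert (A := H (RtoC (t0 + r / 2))). rewrite RtoC_plus in *.
      replace (RtoC t0 + RtoC (r / 2) - RtoC t0)%C with (RtoC (r / 2)) in A by ring.
      rewrite Cmod_R, Rabs_pos_eq in A by lra. specialize (A ltac:(lra)).
      apply is_pseries_Cser in A; exact A.
    - intros t Htt. assert (A := H (RtoC (t0 + t))).
      assert (t < r) by (eapply Rlt_le_trans; [apply Htt|apply Rmin_l]).
      assert (t < t1 - t0) by (eapply Rlt_le_trans; [apply Htt|apply Rmin_r]).
      rewrite Hz in A by lra. rewrite RtoC_plus in A.
      replace (RtoC t0 + RtoC t - RtoC t0)%C with (RtoC t) in A by ring.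
      rewrite Cmod_R, Rabs_pos_eq in A by lra. specialize (A ltac:(lra)).
      apply is_pseries_Cser in A; exact A. }
  intros t Htt. assert (A := H (RtoC t)). rewrite <- RtoC_minus, Cmod_R in A.
  specialize (A Htt). apply is_pseries_Cser in A.
  apply (Cser_unique _ _ _ A).
  apply Cser_ext with (fun _ => RtoC 0); [intros n; rewrite C0; ring|].
  apply (Cser_single (fun _ => RtoC 0)); auto.
Qed.

(** Connectedness of the segment: let [T] be the supremum of the lengths for which [f] vanishes on
    [(1 - T, 1]]. Analyticity at [1 - T] pushes the zeros further left, unless [T = 1], and then it
    gives the value at 0 itself. *)
Lemma identity_on_segment (f : C -> C) (sigma : R) : 0 <= sigma < 1 ->
  (forall t : R, 0 <= t <= 1 -> analytic_at f (RtoC t)) ->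
  (forall t : R, sigma < t <= 1 -> f (RtoC t) = 0) -> f 0 = 0.
Proof.
  intros Hs Ha Hz.
  set (E := fun T => 0 <= T <= 1 /\ forall s : R, 1 - T < s <= 1 -> f (RtoC s) = 0).
  assert (E0 : E (1 - sigma)).
  { split; [lra|]. intros s Hss; apply Hz; lra. }
  destruct (completeness E) as [T [T1 T2]].
  { exists 1; intros x [Hx _]; lra. }
  { exists (1 - sigma); auto. }
  assert (HT1 : T <= 1) by (apply T2; intros x [Hx _]; lra).
  assert (HT0 : 1 - sigma <= T) by (apply T1; auto).
  assert (HT : forall s : R, 1 - T < s <= 1 -> f (RtoC s) = 0).
  { intros s Hss. destruct (classic (exists x, E x /\ 1 - s < x)) as [[x [[_ Hx] Hx']]|N].
    - apply Hx; lra.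
    - exfalso. assert (T <= 1 - s); [|lra]. apply T2. intros x Hx.
      apply Rnot_lt_le; intros L. apply N; exists x; split; auto. }
  destruct (analytic_zero_right f (1 - T) 1) as [r [Hr Hfr]].
  - lra.
  - apply Ha; lra.
  - intros t Ht; apply HT; lra.
  - destruct (Rle_lt_dec 1 T) as [L|L].
    + apply (Hfr 0). replace (0 - (1 - T)) with 0 by lra. rewrite Rabs_R0; auto.
    + exfalso. set (d := Rmin (r / 2) (1 - T)).
      assert (Hd : 0 < d) by (apply Rmin_pos; lra).
      assert (d <= r / 2) by apply Rmin_l. assert (d <= 1 - T) by apply Rmin_r.
      assert (T + d <= T); [|lra]. apply T1. split; [lra|].
      intros s Hss. destruct (Rlt_le_dec (1 - T) s); [apply HT; lra|].
      apply Hfr. apply Rabs_lt_between; lra.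
Qed.

(** A segment that avoids 1 leads from [a] into the half-plane where both functions equal the
    series. *)
Lemma hurwitz_unique (y : R) (h1 h2 : C -> C) : is_hurwitz_zeta y h1 -> is_hurwitz_zeta y h2 ->
  forall a : C, a <> 1 -> h1 a = h2 a.
Proof.
  intros [A1 B1] [A2 B2] a Ha.
  (* The real part at time [t] is [Re a + t K], which exceeds 1 as soon as [t > 1 - 1/K]. *)
  set (K := 2 + Rabs (Re a)). assert (HK := Rabs_pos (Re a)).
  assert (HK2 : 0 <= Re a + Rabs (Re a)).
  { generalize (Rle_abs (- Re a)). rewrite Rabs_Ropp. lra. }
  (* With this vertical speed the imaginary part can vanish only at [t = 0], where the point is [a]
     itself and differs from 1. *)
  set (q := if Req_dec_T (Im a) 0 then 1 else Im a).
  assert (Q : forall t : R, 0 <= t <= 1 -> (a + RtoC t * (K, q))%C <> 1).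
  { intros t Ht E. assert (ER := f_equal Re E). assert (EI := f_equal Im E).
    unfold q in *. destruct a as [a1 a2]. simpl in ER, EI, Ha.
    simpl in *. destruct (Req_dec_T a2 0) as [E0|E0].
    - assert (t = 0) by lra. subst t. apply Ha.
      unfold RtoC; f_equal; lra.
    - apply E0. nra. }
  set (g := fun s : C => (h1 (a + s * (K, q)) - h2 (a + s * (K, q)))%C).
  assert (G : g 0 = 0).
  { apply identity_on_segment with (1 - 1 / K).
    - assert (0 < 1 / K) by (apply Rdiv_lt_0_compat; unfold K; lra).
      assert (1 / K <= 1); [|lra]. apply Rmult_le_reg_r with K; [unfold K; lra|].
      unfold Rdiv. rewrite Rmult_assoc, Rinv_l by (unfold K; lra). unfold K; lra.
    - intros t Ht. apply analytic_minus; apply analytic_affine; auto.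
    - intros t Ht. unfold g.
      assert (R1 : (1 < Re (a + RtoC t * (K, q))%C)%R).
      { destruct a as [a1 a2]; simpl. simpl in *.
        assert (K - 1 < t * K).
        { replace (K - 1) with ((1 - 1 / K) * K) by (field; unfold K; lra).
          apply Rmult_lt_compat_r; [unfold K; lra|lra]. }
        unfold K in *. lra. }
      rewrite (Cser_unique _ _ _ (B1 _ R1) (B2 _ R1)). ring. }
  unfold g in G. rewrite !Cmult_0_l, !Cplus_0_r in G.
  replace (h1 a) with (h1 a - h2 a + h2 a)%C by ring. rewrite G; ring.
Qed.

End Identity.

(** * The Hurwitz zeta function *)

Section Zeta.
Local Open Scope R_scope.

Lemma Rpower_pos (x y : R) : 0 < Rpower x y.
Proof. apply exp_pos. Qed.

Lemma Rpower_anti (x y s : R) : s <= 0 -> 0 < x <= y -> Rpower y s <= Rpower x s.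
Proof.
  intros Hs Hx. replace s with (- (- s)) by ring. rewrite !(Rpower_Ropp _ (- s)).
  apply Rinv_le_contravar; [apply Rpower_pos|]. apply Rle_Rpower_l; lra.
Qed.

Lemma ln_mono (x y : R) : 0 < x <= y -> ln x <= ln y.
Proof.
  intros [H1 [H2|H2]]; [left; apply ln_increasing; auto|subst; apply Rle_refl].
Qed.

Lemma ln_nonneg (x : R) : 1 <= x -> 0 <= ln x.
Proof. intros H; rewrite <- ln_1; apply ln_mono; lra. Qed.

Lemma INR_S_pos (k : nat) : 0 < INR (S k).
Proof. apply lt_0_INR; lia. Qed.

Lemma INR_S_ge_1 (k : nat) : 1 <= INR (S k).
Proof. rewrite S_INR. generalize (pos_INR k); lra. Qed.

(** Integral comparison: by the mean value theorem each term after the first is at most the decrease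
    of [x^(1-sigma) / (sigma-1)] over a unit interval, and these decreases telescope. *)
Lemma ex_series_Riemann (sigma : R) : 1 < sigma -> ex_series (fun k => Rpower (INR (S k)) (- sigma)).
Proof.
  intros Hs. apply ex_series_pos_bound with (1 + / (sigma - 1)).
  { intros; left; apply Rpower_pos. }
  assert (Hi : 0 < / (sigma - 1)) by (apply Rinv_0_lt_compat; lra).
  assert (G : forall N, sum_n (fun k => Rpower (INR (S k)) (- sigma)) N
     <= 1 + / (sigma - 1) * (1 - Rpower (INR (S N)) (1 - sigma))).
  { induction N as [|N IH].
    - rewrite sum_O. simpl INR. unfold Rpower. rewrite ln_1, !Rmult_0_r, exp_0. lra.
    - rewrite sum_Sn. eapply Rle_trans; [apply Rplus_le_compat_r, IH|].
      set (n := INR (S N)). assert (Hn : 1 <= n) by apply INR_S_ge_1.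
      replace (INR (S (S N))) with (n + 1) by (unfold n; rewrite (S_INR (S N)); auto).
      destruct (MVT_gen (fun t => Rpower t (1 - sigma)) n (n + 1)
         (fun t => (1 - sigma) * Rpower t (1 - sigma - 1))) as [c [Hc E]].
      + rewrite Rmin_left, Rmax_right by lra. intros x Hx.
        apply is_derive_Reals. apply derivable_pt_lim_power; lra.
      + rewrite Rmin_left, Rmax_right by lra. intros x Hx.
        apply derivable_continuous_pt. exists ((1 - sigma) * Rpower x (1 - sigma - 1)).
        apply derivable_pt_lim_power; lra.
      + rewrite Rmin_left, Rmax_right in Hc by lra.
        replace (1 - sigma - 1) with (- sigma) in E by ring.
        assert (M : Rpower (n + 1) (- sigma) <= Rpower c (- sigma)) by (apply Rpower_anti; lra).
        assert (D : / (sigma - 1) * (Rpower n (1 - sigma) - Rpower (n + 1) (1 - sigma))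
           = Rpower c (- sigma)).
        { replace (Rpower n (1 - sigma) - Rpower (n + 1) (1 - sigma)) with
            (- (Rpower (n + 1) (1 - sigma) - Rpower n (1 - sigma))) by ring.
          rewrite E. field. lra. }
        lra. }
  intros N; eapply Rle_trans; [apply G|].
  assert (P := Rpower_pos (INR (S N)) (1 - sigma)). nra.
Qed.

Lemma hurwitz_term_bound (k : nat) (y : R) (s : C) : 0 <= Re s -> 1 <= y ->
  Cmod (Rcpow (INR k + y) (- s)) <= Rpower (INR (S k)) (- Re s).
Proof.
  intros Hs Hy. rewrite Cmod_Rcpow. replace (Re (- s)%C) with (- Re s) by (destruct s; auto).
  apply Rpower_anti; [lra|]. split; [apply INR_S_pos|]. rewrite S_INR; lra.
Qed.

Definition hurwitz_sum (s : C) (y : R) : C := Csum (fun k => Rcpow (INR k + y) (- s)).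

Lemma hurwitz_sum_correct (s : C) (y : R) : (1 < Re s)%R -> 1 <= y ->
  Cser (fun k => Rcpow (INR k + y) (- s)) (hurwitz_sum s y).
Proof.
  intros Hs Hy. apply Cser_Csum with (fun k => Rpower (INR (S k)) (- Re s)).
  - intros; apply hurwitz_term_bound; lra.
  - apply ex_series_Riemann; auto.
Qed.

(* By Euler summation,
   [(s-1) zeta(s,y) = y^(1-s) + (s-1) s int_y^(y+1) (1+y-u) zeta(s+1,u) du];
   iterating this [p] times continues [(s-1) zeta(s,y)] to [Re s > 1 - p]. *)
Fixpoint phi (p : nat) (s : C) (y : R) : C :=
  match p with
  | O => (s - 1) * hurwitz_sum s y
  | S p => Rcpow y (1 - s) + (s - 1) * CInt (fun u => RtoC (1 + y - u) * phi p (s + 1) u) y (y + 1)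
  end%C.

(** As a function of [w] the power is a constant times [exp(u ln(v) w)], so bounds on [v^(Re s0)]
    and [|ln v|] determine the norm. *)
Lemma fam_Rcpow (r A L : R) (v : R -> R) (s0 u : C) : 0 < r ->
  (forall x, 0 < v x) -> (forall x, continuous v x) ->
  (forall x, Rpower (v x) (Re s0) <= A) -> (forall x, Rabs (ln (v x)) <= L) ->
  fam r (A * exp (Cmod u * L * r)) (fun x w => Rcpow (v x) (s0 + u * w)).
Proof.
  intros Hr Hv Hc HA HL.
  apply fam_ext with (fun x w => Rcpow (v x) s0 * Cexp ((u * RtoC (ln (v x))) * w))%C.
  - intros x w _. rewrite Rcpow_add. f_equal. unfold Rcpow. f_equal. ring.
  - apply (fam_scal r _ A (fun x => Rcpow (v x) s0)); auto.
    + intros x. apply (Ccont_comp (fun t => Rcpow t s0) v); auto. apply Ccont_Rcpow; auto.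
    + intros x. rewrite Cmod_Rcpow; auto.
    + apply fam_exp; auto.
      * intros x. apply Ccont_scal, Ccont_RtoC.
        apply (continuous_comp v ln); auto. apply continuity_pt_filterlim.
        apply derivable_continuous_pt. exists (/ v x). apply derivable_pt_lim_ln; auto.
      * intros x. rewrite Cmod_mult, Cmod_R. apply Rmult_le_compat_l; auto using Cmod_ge_0.
Qed.

Lemma fam_Rcpow_clamp (r Y : R) (s0 u : C) : 0 < r -> 1 <= Y ->
  exists M, fam r M (fun x w => Rcpow (clamp 1 Y x) (s0 + u * w)).
Proof.
  intros Hr HY. eexists.
  apply (fam_Rcpow r (Rpower Y (Rabs (Re s0))) (ln Y) (clamp 1 Y)); auto.
  - intros x; generalize (clamp_range 1 Y x HY); lra.
  - intros; apply clamp_cont.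
  - intros x. assert (H := clamp_range 1 Y x HY).
    apply Rle_trans with (Rpower (clamp 1 Y x) (Rabs (Re s0))).
    + apply Rle_Rpower; [lra|apply Rle_abs].
    + apply Rle_Rpower_l; [apply Rabs_pos|lra].
  - intros x. assert (H := clamp_range 1 Y x HY).
    rewrite Rabs_pos_eq by (apply ln_nonneg; lra). apply ln_mono; lra.
Qed.

Lemma Re_affine_bound (s0 u w : C) (r : R) : Cmod w <= r -> Re s0 - r * Cmod u <= Re (s0 + u * w)%C.
Proof.
  intros Hw. assert (H := re_le_Cmod (u * w)%C). rewrite Cmod_mult in H.
  assert (Cmod u * Cmod w <= Cmod u * r) by (apply Rmult_le_compat_l; auto using Cmod_ge_0).
  assert (G := Rle_abs (- Re (u * w)%C)). rewrite Rabs_Ropp in G.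
  replace (Re (s0 + u * w)%C) with (Re s0 + Re (u * w)%C) by (destruct s0; auto). lra.
Qed.

(** On the disc the real part of the exponent stays at least [sigma > 1]. The factor [Y^(r |u|)]
    comes from [k + Y <= (k + 1) Y], which brings the growth in [w] back to the base [k + 1]. *)
Lemma fam_hurwitz_sum (r Y : R) (s0 u : C) : 0 < r -> 1 <= Y -> 1 < Re s0 - r * Cmod u ->
  exists M, fam r M (fun x w => hurwitz_sum (s0 + u * w) (clamp 1 Y x)).
Proof.
  intros Hr HY Hs. assert (Pu := Cmod_ge_0 u).
  assert (Hru : 0 <= r * Cmod u) by (apply Rmult_le_pos; lra).
  assert (Hs0 : 1 < Re s0) by lra.
  set (sigma := Re s0 - r * Cmod u) in *.
  exists (Series (fun k => Rpower Y (r * Cmod u) * Rpower (INR (S k)) (- sigma))).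
  apply fam_series with (fun k x w => Rcpow (INR k + clamp 1 Y x) (- (s0 + u * w))); auto.
  - intros k. assert (Hk := pos_INR k).
    assert (CR : forall x, INR (S k) <= INR k + clamp 1 Y x <= INR k + Y).
    { intros x. rewrite S_INR. generalize (clamp_range 1 Y x HY); lra. }
    assert (HS := INR_S_ge_1 k).
    apply fam_ext with (fun x w => Rcpow (INR k + clamp 1 Y x) (- s0 + (- u) * w)).
    { intros; f_equal; ring. }
    eapply fam_le; [|apply (fam_Rcpow r (Rpower (INR (S k)) (- Re s0)) (ln (INR k + Y))
       (fun x => INR k + clamp 1 Y x)); auto].
    + rewrite Cmod_opp.
      replace (exp (Cmod u * ln (INR k + Y) * r)) with (Rpower (INR k + Y) (r * Cmod u))
        by (unfold Rpower; f_equal; ring).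
      replace (- sigma) with (- Re s0 + r * Cmod u) by (unfold sigma; ring).
      rewrite Rpower_plus.
      apply Rle_trans with (Rpower (INR (S k)) (- Re s0) * Rpower (INR (S k) * Y) (r * Cmod u)).
      * apply Rmult_le_compat_l; [left; apply Rpower_pos|]. apply Rle_Rpower_l; auto.
        rewrite S_INR in *. split; [lra|]. assert (INR k * 1 <= INR k * Y) by (apply Rmult_le_compat_l; lra). lra.
      * rewrite <- Rpower_mult_distr by lra. right; ring.
    + intros x; generalize (CR x); lra.
    + intros x; apply Rcont_plus; [apply continuous_const|apply clamp_cont].
    + intros x. replace (Re (- s0)%C) with (- Re s0) by (destruct s0; auto).
      apply Rpower_anti; [lra|]. generalize (CR x); lra.
    + intros x. destruct (CR x) as [A B].
      rewrite Rabs_pos_eq by (apply ln_nonneg; lra). apply ln_mono; lra.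
  - destruct (ex_series_Riemann sigma Hs) as [l Hl]. eexists.
    apply (@is_series_scal R_AbsRing R_NormedModule _ _ _ Hl).
  - intros x w Hw. apply hurwitz_sum_correct.
    + assert (H := Re_affine_bound s0 u w r Hw). unfold sigma in Hs. lra.
    + apply (clamp_range 1 Y x HY).
Qed.

(** The integral over [[y, y + 1]] reaches beyond [Y], so the induction hypothesis is taken on the
    range up to [Y + 1], with the exponent raised by one. *)
Lemma fam_phi (p : nat) : forall (r Y : R) (s0 u : C), 0 < r -> 1 <= Y ->
  1 - INR p < Re s0 - r * Cmod u ->
  exists M, fam r M (fun x w => phi p (s0 + u * w) (clamp 1 Y x)).
Proof.
  induction p as [|p IH]; intros r Y s0 u Hr HY Hs.
  - simpl INR in Hs. destruct (fam_hurwitz_sum r Y s0 u) as [M HM]; auto; [lra|].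
    eexists. simpl. apply fam_mult; auto; [|exact HM].
    apply fam_ext with (fun (_ : R) w => (s0 - 1) + u * w)%C; [intros; ring|].
    apply fam_affine; auto.
  - rewrite S_INR in Hs.
    destruct (IH r (Y + 1) (s0 + 1)%C u Hr) as [M HM]; [lra| |].
    { replace (Re (s0 + 1)%C) with (Re s0 + 1) by (destruct s0; auto). lra. }
    destruct (fam_Rcpow_clamp r Y (1 - s0) (- u)) as [M' HM']; auto.
    eexists. apply fam_ext with (fun x w =>
      Rcpow (clamp 1 Y x) ((1 - s0) + (- u) * w) +
      ((s0 - 1) + u * w) * CInt (fun t => RtoC (1 + clamp 1 Y x - t) *
         phi p (s0 + 1 + u * w) (clamp 1 (Y + 1) t)) (clamp 1 Y x) (clamp 1 Y x + 1))%C.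
    + intros x w Hw. simpl. f_equal; [f_equal; ring|]. f_equal; [ring|].
      apply CInt_ext. rewrite Rmin_left, Rmax_right by lra. intros t Ht.
      assert (H := clamp_range 1 Y x HY). rewrite (clamp_id _ _ t) by lra.
      f_equal. f_equal; ring.
    + apply fam_plus; [exact HM'|]. apply fam_mult; auto; [apply fam_affine; auto|].
      apply fam_int_window with (f := fun t w => phi p (s0 + 1 + u * w) (clamp 1 (Y + 1) t)); auto.
      * intros; apply clamp_cont.
      * exact HM.
Qed.

Lemma is_lim_seq_Rpower_neg (d : R) : 0 < d -> is_lim_seq (fun k => Rpower (INR (S k)) (- d)) 0.
Proof.
  intros Hd. apply is_lim_seq_spec; intros eps. destruct eps as [eps He]; simpl.
  set (B := Rpower (/ eps) (1 / d)).
  destruct (INR_unbounded B) as [N HN]. exists N; intros n Hn.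
  rewrite Rminus_0_r, Rabs_pos_eq by (left; apply Rpower_pos).
  assert (HB : 0 < B) by apply Rpower_pos.
  assert (L : B < INR (S n)).
  { apply Rlt_le_trans with (INR N); auto. apply le_INR; lia. }
  replace eps with (Rpower B (- d)).
  - rewrite !Rpower_Ropp. apply Rinv_lt_contravar; [apply Rmult_lt_0_compat; apply Rpower_pos|].
    unfold Rpower. apply exp_increasing, Rmult_lt_compat_l; auto. apply ln_increasing; auto.
  - unfold B. rewrite Rpower_mult. replace (1 / d * - d) with (- (1)) by (field; lra).
    rewrite Rpower_Ropp, Rpower_1 by (apply Rinv_0_lt_compat; auto). apply Rinv_inv.
Qed.

Lemma Cser_telescope (g : nat -> C) : Clim g 0 -> Cser (fun k => g (S k) - g k)%C (- g O)%C.
Proof.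
  intros H. apply Cser_Clim.
  apply Clim_ext with (fun N => g (S N) + - g O)%C.
  - intros N; induction N; [rewrite sum_O; auto|]. rewrite sum_Sn, <- IHN.
    change plus with Cplus. ring.
  - replace (- g O)%C with (0 + - g O)%C at 1 by ring.
    apply Clim_plus; [apply (Clim_incr_1 g); auto|apply Clim_const].
Qed.

Lemma is_derive_shift (c x : R) : is_derive (fun u => c + u) x 1.
Proof.
  evar_last; [apply (@is_derive_plus R_AbsRing R_NormedModule);
    [apply (@is_derive_const R_AbsRing R_NormedModule)|apply (@is_derive_id R_AbsRing)]|].
  unfold plus, zero, one; simpl. ring.
Qed.

Lemma is_derive_reflect (c x : R) : is_derive (fun u => c - u) x (- (1)).
Proof.
  evar_last; [apply (@is_derive_minus R_AbsRing R_NormedModule);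
    [apply (@is_derive_const R_AbsRing R_NormedModule)|apply (@is_derive_id R_AbsRing)]|].
  unfold minus, plus, opp, zero, one; simpl. ring.
Qed.

Lemma Ccont_Rcpow_shift (s : C) (c x : R) : 0 < c + x -> Ccont (fun u => Rcpow (c + u) s) x.
Proof.
  intros H. apply (Ccont_comp (fun u => Rcpow u s) (fun u => c + u)).
  - apply Rcont_plus; [apply continuous_const|apply continuous_id].
  - apply Ccont_Rcpow; auto.
Qed.

(** The primitive [A] comes from an integration by parts. Its weighted part vanishes at [u = y + 1],
    which leaves the term of the zeta series and a difference that telescopes when [c] runs through
    the integers. *)
Lemma Euler_summation_term (s : C) (c y : R) : s <> 1 -> 0 < c + y ->
  is_CInt (fun u => RtoC (1 + y - u) * (s * Rcpow (c + u) (- (s + 1))))%C y (y + 1)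
   (Rcpow (c + y) (- s) + / (s - 1) * (Rcpow (c + (y + 1)) (1 - s) - Rcpow (c + y) (1 - s)))%C.
Proof.
  intros Hs Hc.
  assert (Hs' : (s - 1)%C <> 0).
  { intros E; apply Hs. replace s with (s - 1 + 1)%C by ring. rewrite E; ring. }
  set (A := fun u => (- RtoC (1 + y - u) * Rcpow (c + u) (- s) + / (s - 1) * Rcpow (c + u) (1 - s))%C).
  replace (Rcpow (c + y) (- s) + / (s - 1) * (Rcpow (c + (y + 1)) (1 - s) - Rcpow (c + y) (1 - s)))%C
   with (A (y + 1)%R - A y)%C.
  - apply (is_CInt_derive A); rewrite Rmin_left, Rmax_right by lra; intros x Hx.
    + assert (D : forall z, is_Cder (fun u => Rcpow (c + u) z) x (1 * (z * Rcpow (c + x) (z - 1)))%C).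
      { intros z. apply (is_Cder_comp (fun t => Rcpow t z) (fun u => c + u) x _ 1).
        - apply is_Cder_Rcpow; lra.
        - apply is_derive_shift. }
      assert (E1 : is_Cder (fun u => RtoC (1 + y - u)) x (RtoC (- (1)))).
      { apply is_Cder_RtoC. apply is_derive_reflect. }
      generalize (is_Cder_plus _ _ _ _ _
        (is_Cder_scal (- (1)) _ _ _ (is_Cder_mult _ _ _ _ _ E1 (D (- s)%C)))
        (is_Cder_scal (/ (s - 1)) _ _ _ (D (1 - s)%C))).
      intros G. apply is_Cder_ext with (g := A) in G; [|intros t; unfold A; ring].
      match goal with |- is_Cder _ _ ?v => match type of G with is_Cder _ _ ?w => replace v with w; [exact G|] end end.
      replace (- s - 1)%C with (- (s + 1))%C by ring.
      replace (1 - s - 1)%C with (- s)%C by ring. rewrite RtoC_opp. field; auto.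
    + apply Ccont_mult; [|apply Ccont_scal, Ccont_Rcpow_shift; lra].
      apply Ccont_RtoC, Rcont_minus; [apply continuous_const|apply continuous_id].
  - unfold A. replace (1 + y - (y + 1)) with 0 by ring. replace (1 + y - y) with 1 by ring. ring.
Qed.

(** Where the series converges, an Euler step changes nothing: sum [Euler_summation_term] with
    [c = k] over [k]; the boundary powers telescope to [- y^(1-s) / (s-1)]. *)
Lemma phi_step_0 (s : C) (y : R) : 1 < Re s -> 1 <= y -> phi 1 s y = phi 0 s y.
Proof.
  intros Hs Hy.
  assert (Hs1 : s <> 1) by (intros E; rewrite E in Hs; simpl in Hs; lra).
  assert (Hs' : (s - 1)%C <> 0).
  { intros E; apply Hs1. replace s with (s - 1 + 1)%C by ring. rewrite E; ring. }
  assert (Rs : Re (s + 1)%C = Re s + 1) by (destruct s; auto).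
  destruct (is_CInt_series_on (fun k u => RtoC (1 + y - u) * (s * Rcpow (INR k + u) (- (s + 1))))%C
    (fun u => RtoC (1 + y - u) * (s * hurwitz_sum (s + 1) u))%C
    (fun k => Cmod s * Rpower (INR (S k)) (- (Re s + 1))) y (y + 1)) as [_ HS].
  - lra.
  - intros k x Hx. apply Ccont_mult; [|apply Ccont_scal, Ccont_Rcpow_shift; generalize (pos_INR k); lra].
    apply Ccont_RtoC, Rcont_minus; [apply continuous_const|apply continuous_id].
  - intros k x Hx. rewrite !Cmod_mult, Cmod_R.
    rewrite <- (Rmult_1_l (Cmod s * Rpower _ _)). rewrite <- Rs.
    apply Rmult_le_compat; [apply Rabs_pos|apply Rmult_le_pos; apply Cmod_ge_0|apply Rabs_le; lra|].
    apply Rmult_le_compat_l; [apply Cmod_ge_0|]. apply hurwitz_term_bound; lra.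
  - destruct (ex_series_Riemann (Re s + 1)) as [l Hl]; [lra|]. eexists.
    apply (@is_series_scal R_AbsRing R_NormedModule _ _ _ Hl).
  - intros x Hx. apply Cser_scal, Cser_scal, hurwitz_sum_correct; lra.
  - assert (T : Cser (fun k => Rcpow (INR k + y) (- s) +
        / (s - 1) * (Rcpow (INR (S k) + y) (1 - s) - Rcpow (INR k + y) (1 - s)))%C
        (hurwitz_sum s y + / (s - 1) * (- Rcpow (INR 0 + y) (1 - s)))%C).
    { apply Cser_plus; [apply hurwitz_sum_correct; auto|]. apply Cser_scal.
      apply (Cser_telescope (fun k => Rcpow (INR k + y) (1 - s))).
      apply Clim_0_bound with (fun k => Rpower (INR (S k)) (- (Re s - 1))).
      - intros k. rewrite Cmod_Rcpow. replace (Re (1 - s)%C) with (- (Re s - 1)) by (destruct s; simpl; ring).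
        apply Rpower_anti; [lra|]. rewrite S_INR. generalize (pos_INR k); lra.
      - apply is_lim_seq_Rpower_neg; lra. }
    assert (E : CInt (fun u => RtoC (1 + y - u) * (s * hurwitz_sum (s + 1) u))%C y (y + 1) =
      (hurwitz_sum s y + / (s - 1) * (- Rcpow (INR 0 + y) (1 - s)))%C).
    { apply (Cser_unique _ _ _ HS). apply Cser_ext with (2 := T). intros k.
      symmetry. apply CInt_eq.
      replace (INR (S k) + y) with (INR k + (y + 1)) by (rewrite S_INR; ring).
      apply Euler_summation_term; auto. generalize (pos_INR k); lra. }
    simpl.
    replace (CInt _ y (y + 1)) with (CInt (fun u => RtoC (1 + y - u) * (s * hurwitz_sum (s + 1) u))%C y (y + 1)).
    + rewrite E. simpl INR. rewrite Rplus_0_l. field; auto.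
    + apply CInt_ext. intros x _. f_equal. f_equal. ring.
Qed.

Lemma phi_step (p : nat) : forall (s : C) (y : R), 1 - INR p < Re s -> 1 <= y ->
  phi (S p) s y = phi p s y.
Proof.
  induction p as [|p IH]; intros s y Hs Hy.
  - apply phi_step_0; auto. simpl in Hs; lra.
  - change (phi (S (S p)) s y) with (Rcpow y (1 - s) + (s - 1) *
      CInt (fun u => RtoC (1 + y - u) * phi (S p) (s + 1) u) y (y + 1))%C.
    change (phi (S p) s y) with (Rcpow y (1 - s) + (s - 1) *
      CInt (fun u => RtoC (1 + y - u) * phi p (s + 1) u) y (y + 1))%C.
    f_equal. f_equal. apply CInt_ext. rewrite Rmin_left, Rmax_right by lra. intros u Hu.
    rewrite IH; auto; [|lra]. rewrite S_INR in Hs.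
    replace (Re (s + 1)%C) with (Re s + 1) by (destruct s; auto). lra.
Qed.

Lemma phi_stable (p q : nat) (s : C) (y : R) : (p <= q)%nat -> 1 - INR p < Re s -> 1 <= y ->
  phi q s y = phi p s y.
Proof.
  intros Hpq Hs Hy. induction Hpq as [|q Hq IH]; auto.
  rewrite phi_step; auto. apply le_INR in Hq. lra.
Qed.

Lemma phi_index_exists (s : C) : exists p : nat, 1 - INR p < Re s.
Proof. destruct (INR_unbounded (1 - Re s)) as [p Hp]; exists p; lra. Qed.

(** Which level is picked is immaterial by [phi_stable]; picking it from [s] glues the continuations
    to half-planes into one function on the plane. *)
Definition phi_index (s : C) : nat :=
  proj1_sig (constructive_indefinite_description _ (phi_index_exists s)).

(* The entire function [(s - 1) zeta(s, y)]. *)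
Definition Phi (s : C) (y : R) : C := phi (phi_index s) s y.

Lemma Phi_eq (p : nat) (s : C) (y : R) : 1 - INR p < Re s -> 1 <= y -> Phi s y = phi p s y.
Proof.
  intros Hs Hy. unfold Phi, phi_index.
  destruct (constructive_indefinite_description _ (phi_index_exists s)) as [q Hq]; simpl.
  destruct (Nat.le_ge_cases p q).
  - apply phi_stable; auto.
  - symmetry; apply phi_stable; auto.
Qed.

Lemma fam_Phi (r Y : R) (s0 u : C) : 0 < r -> 1 <= Y ->
  exists M, fam r M (fun x w => Phi (s0 + u * w) (clamp 1 Y x)).
Proof.
  intros Hr HY. destruct (INR_unbounded (1 - (Re s0 - r * Cmod u))) as [p Hp].
  destruct (fam_phi p r Y s0 u Hr HY) as [M HM]; [lra|].
  exists M. apply fam_ext with (2 := HM). intros x w Hw. symmetry; apply Phi_eq.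
  - assert (H := Re_affine_bound s0 u w r Hw). lra.
  - apply (clamp_range 1 Y x HY).
Qed.

(** This is the residue 1 of the zeta function. Level [p = 1] already reaches [s = 1], and there the
    factor [s - 1] kills the integral. *)
Lemma Phi_1 (y : R) : 1 <= y -> Phi 1 y = 1.
Proof.
  intros Hy. rewrite (Phi_eq 1); auto; [|simpl; lra].
  change (Rcpow y (1 - 1) + (1 - 1) *
      CInt (fun u => RtoC (1 + y - u) * phi 0 (1 + 1) u) y (y + 1) = 1)%C.
  replace (1 - 1)%C with (RtoC 0) by ring. rewrite Rcpow_0. ring.
Qed.

Lemma Cminus_neq_0 (a b : C) : a <> b -> (a - b)%C <> 0.
Proof. intros H E; apply H. replace a with (a - b + b)%C by ring. rewrite E; ring. Qed.

Lemma is_hurwitz_zeta_Phi (y : R) : 1 <= y -> is_hurwitz_zeta y (fun a => Phi a y / (a - 1))%C.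
Proof.
  intros Hy; split.
  - intros a Ha.
    assert (Hd : 0 < Cmod (a - 1)%C) by (apply Cmod_gt_0, Cminus_neq_0; auto).
    (* Half the distance to the pole keeps [a - 1 + w] away from 0. *)
    set (r := Cmod (a - 1)%C / 2).
    assert (Hr : 0 < r) by (unfold r; lra).
    destruct (fam_Phi r y a 1 Hr Hy) as [M HM].
    apply (fam_analytic r (M * (2 / Cmod (a - 1)%C))); auto.
    apply fam_ext with (fun (_ : R) w => Phi (a + 1 * w) (clamp 1 y y) * / ((a - 1) + 1 * w))%C.
    + intros _ w _. rewrite clamp_id by lra. unfold Cdiv. f_equal; f_equal; ring.
    + apply fam_mult; auto.
      * apply (fam_reparam r M _ (fun _ => y)) in HM; auto. intros; apply continuous_const.
      * apply fam_inv_affine; auto; [lra|]. rewrite Cmod_1. unfold r; lra.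
  - intros a Ha. rewrite (Phi_eq 0) by (simpl; lra).
    assert (H1 : (a - 1)%C <> 0).
    { apply Cminus_neq_0. intros E; rewrite E in Ha; simpl in Ha; lra. }
    replace (phi 0 a y / (a - 1))%C with (hurwitz_sum a y) by (simpl; field; auto).
    apply hurwitz_sum_correct; auto.
Qed.

(** The chosen continuation is some function with the defining property, and uniqueness identifies
    it with the explicit one away from 1. All later knowledge about [hurwitz_zeta] passes through
    this equation. *)
Lemma hurwitz_zeta_eq (a : C) (y : R) : a <> 1 -> 1 <= y -> hurwitz_zeta a y = (Phi a y / (a - 1))%C.
Proof.
  intros Ha Hy. unfold hurwitz_zeta.
  apply (hurwitz_unique y (epsilon _ _) (fun a => Phi a y / (a - 1))%C); auto.
  - apply epsilon_spec. exists (fun a => Phi a y / (a - 1))%C. apply is_hurwitz_zeta_Phi; auto.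
  - apply is_hurwitz_zeta_Phi; auto.
Qed.

Lemma hurwitz_zeta_series (a : C) (y : R) : 1 < Re a -> 1 <= y -> hurwitz_zeta a y = hurwitz_sum a y.
Proof.
  intros Ha Hy. assert (H1 : a <> 1) by (intros E; rewrite E in Ha; simpl in Ha; lra).
  rewrite hurwitz_zeta_eq, (Phi_eq 0) by (auto; simpl; lra). simpl. field.
  apply Cminus_neq_0; auto.
Qed.

End Zeta.

(** * The integral *)

Section Integral.
Local Open Scope R_scope.

(** For [x] in [[0, 1]] the argument [x + 1] lies in [[1, 2]] and [clamp] does nothing; it only lets
    the parameter range over the whole line, as [fam] requires. *)
Definition Phi_left (a : C) (x : R) : C := Phi a (clamp 1 2 (x + 1)).
Definition Phi_right (b : C) (x : R) : C := Phi b (clamp 1 2 (1 - x + 1)).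

Definition JPhi (a b : C) : C := CInt (fun x => Phi_left a x * Phi_right b x)%C 0 1.

Lemma fam_Phi_left (r : R) (s0 u : C) : 0 < r ->
  exists M, fam r M (fun x w => Phi_left (s0 + u * w) x).
Proof.
  intros Hr. destruct (fam_Phi r 2 s0 u Hr) as [M HM]; [lra|].
  exists M. apply (fam_reparam r M _ (fun x => x + 1)) in HM; auto.
  intros; apply Rcont_plus; [apply continuous_id|apply continuous_const].
Qed.

Lemma fam_Phi_right (r : R) (s0 u : C) : 0 < r ->
  exists M, fam r M (fun x w => Phi_right (s0 + u * w) x).
Proof.
  intros Hr. destruct (fam_Phi r 2 s0 u Hr) as [M HM]; [lra|].
  exists M. apply (fam_reparam r M _ (fun x => 1 - x + 1)) in HM; auto.
  intros; apply Rcont_plus; [apply Rcont_minus|]; auto using continuous_id, continuous_const.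
Qed.

Lemma Phi_left_cont (a : C) (x : R) : Ccont (Phi_left a) x.
Proof.
  destruct (fam_Phi_left 1 a 0 Rlt_0_1) as [M HM].
  assert (H := fam_cont 1 M _ 0 Rlt_0_1 HM). rewrite Cmod_0 in H.
  apply Ccont_ext with (2 := H ltac:(lra) x). intros; f_equal; ring.
Qed.

Lemma Phi_right_cont (a : C) (x : R) : Ccont (Phi_right a) x.
Proof.
  destruct (fam_Phi_right 1 a 0 Rlt_0_1) as [M HM].
  assert (H := fam_cont 1 M _ 0 Rlt_0_1 HM). rewrite Cmod_0 in H.
  apply Ccont_ext with (2 := H ltac:(lra) x). intros; f_equal; ring.
Qed.

Lemma zeta1_left (a : C) (x : R) : a <> 1 -> 0 <= x <= 1 -> zeta1 a x = (Phi_left a x / (a - 1))%C.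
Proof.
  intros Ha Hx. unfold zeta1, Phi_left. rewrite hurwitz_zeta_eq, clamp_id by (auto; lra). auto.
Qed.

Lemma zeta1_right (a : C) (x : R) : a <> 1 -> 0 <= x <= 1 ->
  zeta1 a (1 - x) = (Phi_right a x / (a - 1))%C.
Proof.
  intros Ha Hx. unfold zeta1, Phi_right. rewrite hurwitz_zeta_eq, clamp_id by (auto; lra). auto.
Qed.

Lemma is_CInt_JPhi (a b : C) : is_CInt (fun x => Phi_left a x * Phi_right b x)%C 0 1 (JPhi a b).
Proof.
  apply is_CInt_CInt. intros; apply Ccont_mult; auto using Phi_left_cont, Phi_right_cont.
Qed.

Lemma is_CInt_J (a b : C) : a <> 1 -> b <> 1 ->
  is_CInt (J_integrand a b) 0 1 (JPhi a b / ((a - 1) * (b - 1)))%C.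
Proof.
  intros Ha Hb.
  apply is_CInt_ext with (fun x => / ((a - 1) * (b - 1)) * (Phi_left a x * Phi_right b x))%C.
  - rewrite Rmin_left, Rmax_right by lra. intros x Hx. unfold J_integrand.
    rewrite zeta1_left, zeta1_right by (auto; lra). field.
    split; apply Cminus_neq_0; auto.
  - unfold Cdiv. rewrite (Cmult_comm (JPhi a b)). apply is_CInt_scal, is_CInt_JPhi.
Qed.

Lemma J_eq (a b : C) : a <> 1 -> b <> 1 -> J a b = (JPhi a b / ((a - 1) * (b - 1)))%C.
Proof. intros Ha Hb. apply CInt_eq, is_CInt_J; auto. Qed.

(** The directions [u] and [v] are arbitrary, which covers both the diagonal [a = b] and the segment
    used for the continuation. *)
Lemma fam_JPhi (r : R) (a0 b0 u v : C) : 0 < r ->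
  exists M, fam r M (fun _ w => JPhi (a0 + u * w) (b0 + v * w)).
Proof.
  intros Hr. destruct (fam_Phi_left r a0 u Hr) as [M1 H1].
  destruct (fam_Phi_right r b0 v Hr) as [M2 H2].
  exists (M1 * M2).
  apply (fam_int01 r _ (fun x w => Phi_left (a0 + u * w) x * Phi_right (b0 + v * w) x)%C); auto.
  apply fam_mult; auto.
Qed.

Lemma JPhi_1 : JPhi 1 1 = 1.
Proof.
  apply CInt_eq. apply is_CInt_ext with (fun _ => RtoC 1).
  - intros x _. unfold Phi_left, Phi_right.
    rewrite !Phi_1 by (apply clamp_range; lra). ring.
  - assert (H : is_CInt (fun _ => RtoC 1) 0 1 (RtoC 1 - RtoC 0)%C).
    { apply (is_CInt_derive RtoC).
      - intros x _. apply (is_Cder_RtoC (fun t => t) x 1). apply (@is_derive_id R_AbsRing).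
      - intros; apply Ccont_const. }
    replace (1 - 0)%C with (RtoC 1) in H by ring. exact H.
Qed.

(** [(a - 1)^2 J(a, a)] is [JPhi a a], which is analytic at 1 and has the value 1 there. *)
Lemma J_double_pole : has_pole_of_order 2 (fun a : C => J a a) (RtoC 1).
Proof.
  exists (fun a => JPhi a a), 1. split; [lra|split; [|split]].
  - destruct (fam_JPhi 1 1 1 1 1 Rlt_0_1) as [M HM].
    apply (fam_analytic 1 M); [lra|]. apply fam_ext with (2 := HM).
    intros _ w _. f_equal; ring.
  - rewrite JPhi_1. intros E; apply RtoC_inj in E; lra.
  - intros z Hz. assert (z <> 1).
    { intros E. rewrite E in Hz. replace (1 - 1)%C with (RtoC 0) in Hz by ring.
      rewrite Cmod_0 in Hz; lra. }
    rewrite J_eq by auto. simpl. rewrite Cmult_1_r. auto.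
Qed.

(** Needed twice for the double power series of [J]: with [h] a Taylor coefficient of the left
    factor it sums over the second variable, and with [h] the right factor it sums over the
    first. *)
Lemma fam_pairing (r M B : R) (f : R -> C -> C) (c : nat -> R -> C) (m : nat -> R) (h : R -> C) (w : C) :
  0 < r -> (forall n x, Ccont (c n) x) -> (forall n x, Cmod (c n x) <= m n) ->
  (forall N, sum_n (fun n => m n * r ^ n) N <= M) ->
  (forall x w, Cmod w <= r -> Cser (fun n => c n x * w ^ n)%C (f x w)) ->
  (forall x, Ccont h x) -> (forall x, Cmod (h x) <= B) -> Cmod w <= r ->
  Cser (fun n => CInt (fun x => h x * c n x)%C 0 1 * w ^ n)%C (CInt (fun x => h x * f x w)%C 0 1).
Proof.
  intros Hr H1 H2 H3 H4 Hh HB Hw.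
  destruct (fam_terms c m r M Hr H2 H3) as (P1 & P2 & P3 & P4).
  assert (B0 : 0 <= B) by (eapply Rle_trans; [apply Cmod_ge_0|apply (HB 0)]).
  assert (S := is_CInt_series (fun n x => h x * (c n x * w ^ n))%C (fun x => h x * f x w)%C
    (fun n => B * (m n * r ^ n)) 0 1).
  apply Cser_ext with (fun n => CInt (fun x => h x * (c n x * w ^ n))%C 0 1).
  - intros n. apply CInt_eq. apply is_CInt_ext with (fun x => w ^ n * (h x * c n x))%C.
    + intros; ring.
    + rewrite (Cmult_comm _ (w ^ n)). apply is_CInt_scal, is_CInt_CInt.
      intros; apply Ccont_mult; auto.
  - apply S; [lra| | | |].
    + intros; apply Ccont_mult; auto. apply Ccont_mult; auto using Ccont_const.
    + intros k x. rewrite Cmod_mult. apply Rmult_le_compat; auto using Cmod_ge_0.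
    + destruct P3 as [l Hl]. exists (B * l).
      apply (@is_series_scal R_AbsRing R_NormedModule _ _ _ Hl).
    + intros x. apply Cser_scal; auto.
Qed.

(** Both factors are expanded separately for each [x]. The double Taylor coefficient is the integral
    of the product of the two coefficients, and their sup norms multiply to give the required
    bound. *)
Lemma J_analytic2 (a0 b0 : C) : a0 <> 1 -> b0 <> 1 -> analytic2_at J a0 b0.
Proof.
  intros Ha Hb.
  assert (Da : 0 < Cmod (a0 - 1)%C) by (apply Cmod_gt_0, Cminus_neq_0; auto).
  assert (Db : 0 < Cmod (b0 - 1)%C) by (apply Cmod_gt_0, Cminus_neq_0; auto).
  (* Half the distances to 1, so that the polydisc meets neither pole. *)
  set (r := Rmin (Cmod (a0 - 1)%C / 2) (Cmod (b0 - 1)%C / 2)).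
  assert (Hr : 0 < r) by (apply Rmin_pos; lra).
  assert (Ra : r <= Cmod (a0 - 1)%C / 2) by apply Rmin_l.
  assert (Rb : r <= Cmod (b0 - 1)%C / 2) by apply Rmin_r.
  clearbody r.
  destruct (fam_Phi_left r a0 1 Hr) as [M1 F1]. destruct (fam_Phi_right r b0 1 Hr) as [M2 F2].
  assert (G1 : fam r (M1 * (2 / Cmod (a0 - 1)%C))
     (fun x w => Phi_left (a0 + 1 * w) x * / ((a0 - 1) + 1 * w))%C).
  { apply fam_mult; auto. apply fam_inv_affine; auto; [lra|rewrite Cmod_1; lra]. }
  assert (G2 : fam r (M2 * (2 / Cmod (b0 - 1)%C))
     (fun x w => Phi_right (b0 + 1 * w) x * / ((b0 - 1) + 1 * w))%C).
  { apply fam_mult; auto. apply fam_inv_affine; auto; [lra|rewrite Cmod_1; lra]. }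
  set (f := fun x w => (Phi_left (a0 + 1 * w) x * / ((a0 - 1) + 1 * w))%C) in *.
  set (g := fun x w => (Phi_right (b0 + 1 * w) x * / ((b0 - 1) + 1 * w))%C) in *.
  set (A := M1 * (2 / Cmod (a0 - 1)%C)) in *. set (B := M2 * (2 / Cmod (b0 - 1)%C)) in *.
  assert (PA := fam_M_pos _ _ _ Hr G1). assert (PB := fam_M_pos _ _ _ Hr G2).
  assert (G2' := G2).
  destruct G1 as (c & m & C1 & C2 & C3 & C4). destruct G2 as (d & l & D1 & D2 & D3 & D4).
  destruct (fam_terms c m r A Hr C2 C3) as (P1 & P2 & _ & _).
  destruct (fam_terms d l r B Hr D2 D3) as (Q1 & Q2 & _ & _).
  exists (fun i j => CInt (fun x => c i x * d j x)%C 0 1), r, (A * B).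
  split; auto. split.
  - intros i j.
    assert (X : Cmod (CInt (fun x => c i x * d j x)%C 0 1) <= (1 - 0) * (m i * l j)).
    { apply (is_CInt_Cmod_le_const (fun x => c i x * d j x)%C 0 1); [lra| |].
      - intros x _. rewrite Cmod_mult. apply Rmult_le_compat; auto using Cmod_ge_0.
      - apply is_CInt_CInt. intros; apply Ccont_mult; auto. }
    apply Rle_trans with ((m i * r ^ i) * (l j * r ^ j)).
    + replace ((m i * r ^ i) * (l j * r ^ j)) with ((1 - 0) * (m i * l j) * (r ^ i * r ^ j)) by ring.
      rewrite Rmult_assoc. apply Rmult_le_compat_r; auto.
      apply Rmult_le_pos; apply pow_le; lra.
    + apply Rmult_le_compat; auto; apply Rmult_le_pos; auto; apply pow_le; lra.
  - intros a b Hab Hbb.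
    exists (fun i => CInt (fun x => c i x * g x (b - b0)%C)%C 0 1). split.
    + intros i. apply is_pseries_Cser.
      apply (fam_pairing r B (m i) g d l (c i) (b - b0)%C); auto. lra.
    + apply is_pseries_Cser.
      assert (S := fam_pairing r A B f c m (fun x => g x (b - b0)%C) (a - a0)%C Hr C1 C2 C3 C4).
      assert (E : J a b = CInt (fun x => g x (b - b0)%C * f x (a - a0)%C)%C 0 1).
      { assert (a <> 1).
        { intros E. rewrite E in Hab. replace (1 - a0)%C with (- (a0 - 1))%C in Hab by ring.
          rewrite Cmod_opp in Hab. lra. }
        assert (b <> 1).
        { intros E. rewrite E in Hbb. replace (1 - b0)%C with (- (b0 - 1))%C in Hbb by ring.
          rewrite Cmod_opp in Hbb. lra. }
        rewrite J_eq by auto. symmetry. apply CInt_eq.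
        apply is_CInt_ext with (fun x => / ((a - 1) * (b - 1)) * (Phi_left a x * Phi_right b x))%C.
        - intros x _. unfold f, g.
          replace (a0 + 1 * (a - a0))%C with a by ring.
          replace (b0 + 1 * (b - b0))%C with b by ring.
          replace (a0 - 1 + 1 * (a - a0))%C with (a - 1)%C by ring.
          replace (b0 - 1 + 1 * (b - b0))%C with (b - 1)%C by ring.
          field. split; apply Cminus_neq_0; auto.
        - unfold Cdiv. rewrite (Cmult_comm (JPhi a b)). apply is_CInt_scal, is_CInt_JPhi. }
      rewrite E.
      apply Cser_ext with (fun i => CInt (fun x => g x (b - b0) * c i x)%C 0 1 * (a - a0) ^ i)%C.
      * intros i. f_equal. apply CInt_ext. intros; ring.
      * apply S; [| |lra].
        -- apply (fam_cont r B g); auto; lra.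
        -- intros x; apply (fam_bound r B g); auto; lra.
Qed.

End Integral.

(** * Gamma and beta functions *)

Section Gamma.
Local Open Scope R_scope.

(** Convergence of an infinite product in additive form: [|u n|] is at most [|u 0|] times the
    product of the [1 + e k], hence at most [|u 0| exp(sum of e)], and so the increments are
    summable. *)
Lemma Clim_ratio (u : nat -> C) (e : nat -> R) :
  (forall n, Cmod (u (S n) - u n)%C <= e n * Cmod (u n)) -> (forall n, 0 <= e n) -> ex_series e ->
  exists l, Clim u l.
Proof.
  intros Hu He Ee.
  set (E := Cmod (u O) * exp (Series e)).
  assert (HE : forall n, Cmod (u n) <= E).
  { assert (G : forall n, Cmod (u n) <= Cmod (u O) * exp (sum_n e n)).
    { assert (St : forall n a, Cmod (u n) <= Cmod (u O) * exp a -> Cmod (u (S n)) <= Cmod (u O) * exp (a + e n)).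
      { intros n a IH. replace (u (S n)) with (u n + (u (S n) - u n))%C by ring.
        eapply Rle_trans; [apply Cmod_triangle|].
        apply Rle_trans with ((1 + e n) * (Cmod (u O) * exp a)).
        - apply Rle_trans with ((1 + e n) * Cmod (u n)); [specialize (Hu n); lra|].
          apply Rmult_le_compat_l; auto. specialize (He n); lra.
        - rewrite exp_plus. assert (X := exp_ineq1_le (e n)).
          assert (0 <= Cmod (u O) * exp a) by (apply Rmult_le_pos; [apply Cmod_ge_0|left; apply exp_pos]).
          nra. }
      assert (G : forall n, Cmod (u (S n)) <= Cmod (u O) * exp (sum_n e n)).
      { induction n; [|rewrite sum_Sn; apply St; auto]. rewrite sum_O.
        rewrite <- (Rplus_0_l (e O)). apply St. rewrite exp_0. lra. }
      assert (Pn : forall n, 0 <= sum_n e n).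
      { induction n; [rewrite sum_O; auto|rewrite sum_Sn]. unfold plus; simpl. specialize (He (S n)); lra. }
      intros n. destruct n.
      - rewrite <- (Rmult_1_r (Cmod (u O))) at 1. apply Rmult_le_compat_l; [apply Cmod_ge_0|].
        rewrite <- exp_0. destruct (Pn O) as [Q|Q]; [left; apply exp_increasing; auto|rewrite <- Q; lra].
      - eapply Rle_trans; [apply G|]. apply Rmult_le_compat_l; [apply Cmod_ge_0|].
        rewrite sum_Sn. unfold plus; simpl. destruct (He (S n)) as [Q|Q].
        + left; apply exp_increasing; lra.
        + rewrite <- Q, Rplus_0_r; lra. }
    intros n; eapply Rle_trans; [apply G|]. apply Rmult_le_compat_l; [apply Cmod_ge_0|].
    assert (L := Series_partial_le e n He Ee). destruct L as [L|L]; [left; apply exp_increasing; auto|rewrite L; lra]. }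
  assert (S1 : Cser (fun n => u (S n) - u n)%C (Csum (fun n => u (S n) - u n)%C)).
  { apply Cser_Csum with (fun n => e n * E).
    - intros n; eapply Rle_trans; [apply Hu|]. apply Rmult_le_compat_l; auto.
    - destruct Ee as [l Hl]; exists (l * E). apply is_series_scal_r; auto. }
  exists (u O + Csum (fun n => u (S n) - u n)%C)%C.
  apply Clim_incr_1. apply Cser_Clim in S1.
  apply Clim_ext with (2 := Clim_plus _ _ _ _ (Clim_const (u O)) S1).
  induction n; [rewrite sum_O; ring|]. rewrite sum_Sn. change plus with Cplus.
  rewrite Cplus_assoc, IHn. ring.
Qed.

Definition gauss (z : C) (n : nat) : C :=
  (Cpochhammer z (S (S n)) / (RtoC (INR (fact (S n))) * Rcpow (INR (S n)) z))%C.

(** At [t = 1/(n+2)] this is the quotient of two successive terms of the Gauss sequence. *)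
Definition gauss_ratio (z : C) (t : R) : C := ((1 + z * RtoC t) * Rcpow (1 - t) z)%C.

Lemma RtoC_neq_0 (x : R) : x <> 0 -> RtoC x <> 0.
Proof. intros H E; apply RtoC_inj in E; auto. Qed.

Lemma Cmult_neq_0 (x y : C) : x <> 0 -> y <> 0 -> (x * y)%C <> 0.
Proof.
  intros Hx Hy E. apply Cmod_gt_0 in Hx. apply Cmod_gt_0 in Hy.
  assert (H := Cmod_mult x y). rewrite E, Cmod_0 in H. nra.
Qed.

Lemma RtoC_fact_neq_0 (n : nat) : RtoC (INR (fact n)) <> 0.
Proof. apply RtoC_neq_0, INR_fact_neq_0. Qed.

Lemma gauss_step (z : C) (n : nat) :
  gauss z (S n) = (gauss_ratio z (/ INR (S (S n))) * gauss z n)%C.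
Proof.
  unfold gauss, gauss_ratio.
  change (Cpochhammer z (S (S (S n)))) with (Cpochhammer z (S (S n)) * (z + RtoC (INR (S (S n)))))%C.
  rewrite (fact_S_R (S n)).
  assert (P1 := INR_S_pos n). assert (P2 := INR_S_pos (S n)).
  replace (1 - / INR (S (S n))) with (INR (S n) * / INR (S (S n))).
  2:{ rewrite (S_INR (S n)) in *. field. lra. }
  rewrite Rcpow_mult_base by (auto; apply Rinv_0_lt_compat; auto).
  replace (Rcpow (/ INR (S (S n))) z) with (/ Rcpow (INR (S (S n))) z)%C.
  2:{ rewrite <- Rcpow_opp. unfold Rcpow. rewrite ln_Rinv by auto. f_equal. rewrite RtoC_opp. ring. }
  rewrite RtoC_mult, RtoC_inv by lra.
  assert (N1 := Rcpow_neq_0 (INR (S n)) z). assert (N2 := Rcpow_neq_0 (INR (S (S n))) z).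
  assert (N3 := RtoC_fact_neq_0 (S n)).
  assert (N4 : RtoC (INR (S (S n))) <> 0) by (apply RtoC_neq_0; lra).
  set (X := Cpochhammer z (S (S n))). clearbody X.
  field. repeat split; auto.
Qed.

(** The terms of first order in [t] cancel: the derivative is [- z (1 + z) t (1 - t)^(z-1)], which
    is [O(t)], so the integral is [O(t^2)]. *)
Lemma gauss_ratio_bound (z : C) : exists K : R, 0 <= K /\
  forall t, 0 <= t <= 1 / 2 -> Cmod (gauss_ratio z t - 1)%C <= K * t ^ 2.
Proof.
  (* Bounds [(1 - s)^(z-1)] for [0 <= s <= 1/2], where [1 - s] lies between 1/2 and 1. *)
  set (B := exp (Rabs (Re (z - 1)%C) * ln 2)).
  set (K := Cmod (z * (1 + z))%C * B).
  assert (HB : 0 < B) by apply exp_pos.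
  assert (HK : 0 <= K) by (apply Rmult_le_pos; [apply Cmod_ge_0|lra]).
  exists K; split; auto. intros t Ht.
  assert (I : is_CInt (fun s => - (z * (1 + z)) * RtoC s * Rcpow (1 - s) (z - 1))%C 0 t
     (gauss_ratio z t - gauss_ratio z 0)%C).
  { apply (is_CInt_derive (gauss_ratio z)); rewrite Rmin_left, Rmax_right by lra; intros x Hx.
    - assert (D1 : is_Cder (fun s => 1 + z * RtoC s)%C x (0 + z * RtoC 1)%C).
      { apply is_Cder_plus; [apply is_Cder_const|]. apply is_Cder_scal.
        apply (is_Cder_RtoC (fun s => s)). apply (@is_derive_id R_AbsRing). }
      assert (D2 : is_Cder (fun s => Rcpow (1 - s) z) x (RtoC (- (1)) * (z * Rcpow (1 - x) (z - 1)))%C).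
      { apply (is_Cder_comp (fun u => Rcpow u z) (fun s => 1 - s)); [apply is_Cder_Rcpow; lra|].
        apply is_derive_reflect. }
      assert (D := is_Cder_mult _ _ _ _ _ D1 D2).
      match goal with |- is_Cder _ _ ?v => match type of D with is_Cder _ _ ?w => replace v with w; [exact D|] end end.
      replace (Rcpow (1 - x) z) with (Rcpow (1 - x) (z - 1) * RtoC (1 - x))%C.
      + rewrite RtoC_opp, RtoC_minus. ring.
      + rewrite <- (Rcpow_1 (1 - x)) by lra. rewrite <- Rcpow_add. f_equal; ring.
    - apply Ccont_mult; [apply Ccont_scal, Ccont_RtoC, continuous_id|].
      apply (Ccont_comp (fun u => Rcpow u (z - 1)) (fun s => 1 - s)).
      + apply Rcont_minus; [apply continuous_const|apply continuous_id].
      + apply Ccont_Rcpow; lra. }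
  replace (gauss_ratio z 0) with (RtoC 1) in I.
  2:{ unfold gauss_ratio. rewrite Rminus_0_r, Rcpow_1_l. ring. }
  replace (K * t ^ 2) with ((t - 0) * (K * t)) by ring.
  apply (is_CInt_Cmod_le_const _ 0 t) with (3 := I); [lra|].
  intros x Hx. rewrite !Cmod_mult, Cmod_opp, Cmod_R, Rabs_pos_eq by lra.
  unfold K. rewrite (Rmult_assoc _ B), (Rmult_comm B), <- Rmult_assoc.
  apply Rmult_le_compat; auto using Cmod_ge_0.
  - apply Rmult_le_pos; [apply Cmod_ge_0|lra].
  - apply Rmult_le_compat_l; [apply Cmod_ge_0|lra].
  - rewrite Cmod_Rcpow. unfold Rpower, B.
    assert (L : Re (z - 1)%C * ln (1 - x) <= Rabs (Re (z - 1)%C) * ln 2).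
    { eapply Rle_trans; [apply Rle_abs|]. rewrite Rabs_mult. apply Rmult_le_compat_l; [apply Rabs_pos|].
      rewrite Rabs_left1.
      - rewrite <- ln_Rinv by lra. apply ln_mono. split; [apply Rinv_0_lt_compat; lra|].
        replace 2 with (/ (1/2)) by field. apply Rinv_le_contravar; lra.
      - rewrite <- ln_1. apply ln_mono; lra. }
    destruct L as [L|L]; [left; apply exp_increasing; auto|rewrite L; lra].
Qed.

Lemma gauss_step_bound (z : C) : exists e : nat -> R,
  (forall n, 0 <= e n) /\ ex_series e /\
  (forall n, Cmod (gauss_ratio z (/ INR (S (S n))) - 1)%C <= e n).
Proof.
  destruct (gauss_ratio_bound z) as [K [HK H]].
  exists (fun n => K * Rpower (INR (S n)) (- (2))). split; [|split].
  - intros; apply Rmult_le_pos; auto. left; apply Rpower_pos.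
  - destruct (ex_series_Riemann 2) as [l Hl]; [lra|]. eexists.
    apply (@is_series_scal R_AbsRing R_NormedModule _ _ _ Hl).
  - intros n. assert (P := INR_S_ge_1 n).
    assert (Q : INR (S (S n)) = INR (S n) + 1) by (rewrite (S_INR (S n)); auto).
    eapply Rle_trans; [apply H|].
    + split; [left; apply Rinv_0_lt_compat; lra|]. replace (1/2) with (/2) by field.
      apply Rinv_le_contravar; lra.
    + apply Rmult_le_compat_l; auto. rewrite Rpower_Ropp.
      replace (Rpower (INR (S n)) 2) with (INR (S n) ^ 2).
      2:{ replace 2 with (INR 2) by (simpl; ring). rewrite Rpower_pow; auto; lra. }
      rewrite pow_inv. apply Rinv_le_contravar; [nra|]. apply pow_incr; lra.
Qed.

Lemma gauss_lim_exists (z : C) : exists l, Clim (gauss z) l.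
Proof.
  destruct (gauss_step_bound z) as (e & He & Ee & H).
  apply Clim_ratio with e; auto.
  intros n. rewrite gauss_step.
  replace (gauss_ratio z (/ INR (S (S n))) * gauss z n - gauss z n)%C
    with ((gauss_ratio z (/ INR (S (S n))) - 1) * gauss z n)%C by ring.
  rewrite Cmod_mult. apply Rmult_le_compat_r; auto using Cmod_ge_0.
Qed.

Lemma Crgamma_lim (z : C) : Clim (gauss z) (Crgamma z).
Proof.
  destruct (gauss_lim_exists z) as [l Hl].
  replace (Crgamma z) with l; auto. symmetry. apply Clim_seq_correct; auto.
Qed.

Definition not_nonpos_int (z : C) : Prop := forall n : nat, z <> RtoC (- INR n).

Lemma Cpochhammer_neq_0 (z : C) (n : nat) : not_nonpos_int z -> Cpochhammer z n <> 0.
Proof.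
  intros H; induction n; simpl.
  - intros E; apply RtoC_inj in E; lra.
  - apply Cmult_neq_0; auto. intros E. apply (H n). rewrite RtoC_opp.
    replace z with (z + RtoC (INR n) - RtoC (INR n))%C by ring. rewrite E; ring.
Qed.

Lemma gauss_neq_0 (z : C) (n : nat) : not_nonpos_int z -> gauss z n <> 0.
Proof.
  intros H. unfold gauss. apply Cmult_neq_0; [apply Cpochhammer_neq_0; auto|].
  intros E. assert (N : (RtoC (INR (fact (S n))) * Rcpow (INR (S n)) z)%C <> 0).
  { apply Cmult_neq_0; [apply RtoC_fact_neq_0|apply Rcpow_neq_0]. }
  assert (F : (RtoC (INR (fact (S n))) * Rcpow (INR (S n)) z * / (RtoC (INR (fact (S n))) * Rcpow (INR (S n)) z) = 1)%C).
  { apply Cinv_r; auto. }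
  rewrite E, Cmult_0_r in F. apply RtoC_inj in F; lra.
Qed.

Lemma Clim_shift (u : nat -> C) (l : C) (N : nat) : Clim (fun n => u (n + N)%nat) l <-> Clim u l.
Proof.
  unfold Clim. symmetry. apply (is_lim_seq_incr_n (fun n => Cmod (u n - l)%C)).
Qed.

(** Once [e n < 1/2] the ratios have modulus at least 1/2, so the reciprocals satisfy [Clim_ratio]
    as well, with [2 e]. Since the reciprocals converge, the limit itself cannot be 0. *)
Lemma Crgamma_spec (z : C) : not_nonpos_int z ->
  Crgamma z <> 0 /\ Clim (fun n => / gauss z n)%C (/ Crgamma z)%C.
Proof.
  intros Hz. destruct (gauss_step_bound z) as (e & He & Ee & H).
  assert (L := ex_series_lim_0 _ Ee). apply is_lim_seq_spec in L.
  destruct (L (mkposreal (1/2) ltac:(lra))) as [N HN]; simpl in HN.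
  assert (X : exists l, Clim (fun n => / gauss z (n + N)%nat)%C l).
  { apply Clim_ratio with (fun n => 2 * e (n + N)%nat).
    - intros n. specialize (HN (n + N)%nat ltac:(lia)). specialize (H (n + N)%nat). specialize (He (n + N)%nat).
      rewrite Rminus_0_r, Rabs_pos_eq in HN by auto.
      change (S n + N)%nat with (S (n + N)). rewrite gauss_step.
      set (q := gauss_ratio z (/ INR (S (S (n + N))))) in *.
      assert (G := gauss_neq_0 z (n + N) Hz).
      assert (Q : 1 / 2 <= Cmod q).
      { assert (T := Cmod_triangle q (- (q - 1))%C). rewrite Cmod_opp in T.
        replace (q + - (q - 1))%C with (RtoC 1) in T by ring. rewrite Cmod_1 in T. lra. }
      assert (Q0 : q <> 0) by (apply Cmod_gt_0; lra).
      replace (/ (q * gauss z (n + N)) - / gauss z (n + N))%C with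
        (- (q - 1) * / q * / gauss z (n + N)%nat)%C by (field; auto).
      rewrite !Cmod_mult, Cmod_opp. apply Rmult_le_compat_r; [apply Cmod_ge_0|].
      rewrite (Cmod_inv q) by auto.
      apply Rmult_le_reg_r with (Cmod q); [lra|]. rewrite Rmult_assoc, Rinv_l by lra.
      assert (0 <= Cmod (q - 1)%C) by apply Cmod_ge_0. nra.
    - intros n; specialize (He (n + N)%nat); lra.
    - apply (ex_series_ext (fun k => scal 2 (e (N + k)%nat))).
      + intros n. rewrite Nat.add_comm. reflexivity.
      + apply (@ex_series_scal R_AbsRing R_NormedModule 2 (fun k => e (N + k)%nat)).
        apply -> (ex_series_incr_n e N); auto. }
  destruct X as [l Hl]. apply (Clim_shift (fun n => / gauss z n)%C) in Hl.
  assert (One : (Crgamma z * l = 1)%C).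
  { apply (Clim_unique (fun n => gauss z n * / gauss z n)%C).
    - apply Clim_mult; auto. apply Crgamma_lim.
    - apply Clim_ext with (fun _ => RtoC 1); [|apply Clim_const].
      intros n. symmetry; apply Cinv_r. apply gauss_neq_0; auto. }
  assert (N0 : Crgamma z <> 0).
  { intros E. rewrite E, Cmult_0_l in One. apply RtoC_inj in One; lra. }
  split; auto. replace (/ Crgamma z)%C with l; auto.
  replace l with (/ Crgamma z * (Crgamma z * l))%C by (field; auto).
  rewrite One; ring.
Qed.

Lemma Cpochhammer_succ_l (z : C) (n : nat) :
  Cpochhammer z (S n) = (z * Cpochhammer (z + 1) n)%C.
Proof.
  induction n.
  - simpl. ring.
  - change (Cpochhammer z (S (S n))) with (Cpochhammer z (S n) * (z + RtoC (INR (S n))))%C.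
    rewrite IHn. simpl Cpochhammer. rewrite S_INR, RtoC_plus. ring.
Qed.

(** The Gauss quotients of [x], [y] and [x + y] combined: the powers of [n + 1] cancel and a
    rational expression remains. *)
Definition beta_term (x y : C) (n : nat) : C :=
  (Cpochhammer (x + y) (S (S n)) * RtoC (INR (fact (S n))) /
    (Cpochhammer x (S (S n)) * Cpochhammer y (S (S n))))%C.

Lemma beta_term_gauss (x y : C) (n : nat) : not_nonpos_int x -> not_nonpos_int y ->
  beta_term x y n = (/ gauss x n * / gauss y n * gauss (x + y) n)%C.
Proof.
  intros Hx Hy. unfold beta_term, gauss. rewrite Rcpow_add.
  assert (A := Cpochhammer_neq_0 x (S (S n)) Hx). assert (B := Cpochhammer_neq_0 y (S (S n)) Hy).
  assert (N1 := Rcpow_neq_0 (INR (S n)) x). assert (N2 := Rcpow_neq_0 (INR (S n)) y).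
  assert (N3 := RtoC_fact_neq_0 (S n)).
  set (P := Cpochhammer x (S (S n))) in *. set (Q := Cpochhammer y (S (S n))) in *.
  set (T := Cpochhammer (x + y) (S (S n))). clearbody P Q T.
  field. repeat split; auto.
Qed.

Lemma Cbeta_lim (x y : C) : not_nonpos_int x -> not_nonpos_int y -> Clim (beta_term x y) (Cbeta x y).
Proof.
  intros Hx Hy. apply Clim_ext with (fun n => / gauss x n * / gauss y n * gauss (x + y) n)%C.
  - intros; symmetry; apply beta_term_gauss; auto.
  - unfold Cbeta, Cgamma. apply Clim_mult; [|apply Crgamma_lim].
    apply Clim_mult; apply Crgamma_spec; auto.
Qed.

Lemma not_nonpos_int_succ (x : C) : not_nonpos_int x -> not_nonpos_int (x + 1).
Proof.
  intros H n E. apply (H (S n)). rewrite S_INR.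
  replace x with (x + 1 - 1)%C by ring. rewrite E, !RtoC_opp, RtoC_plus. ring.
Qed.

(** The recurrence holds for the terms of the Gauss limit up to factors that tend to 1, and so it
    passes to the limit, even where [x + y] is a pole of Gamma. *)
Lemma Cbeta_succ (x y : C) : not_nonpos_int x -> not_nonpos_int y ->
  (x * Cbeta x y = (x + y) * Cbeta (x + 1) y)%C.
Proof.
  intros Hx Hy.
  assert (X : forall z, Clim (fun n => (z + RtoC (INR (S (S n)))) * / RtoC (INR (S (S n))))%C 1).
  { intros z. apply Clim_ext with (fun n => 1 + z * RtoC (/ INR (S (S n))))%C.
    - intros n. assert (INR (S (S n)) <> 0) by (apply not_0_INR; lia).
      rewrite RtoC_inv by auto. field. apply RtoC_neq_0; auto.
    - replace (RtoC 1) with (1 + z * 0)%C at 1 by ring.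
      apply Clim_plus; [apply Clim_const|apply Clim_mult; [apply Clim_const|]].
      apply Clim_0_bound with (fun n => Rpower (INR (S n)) (- (1))); [|apply is_lim_seq_Rpower_neg; lra].
      intros n. assert (P := INR_S_pos n). rewrite Cmod_R, Rabs_pos_eq.
      + rewrite Rpower_Ropp, Rpower_1 by auto. apply Rinv_le_contravar; auto. apply le_INR; lia.
      + left; apply Rinv_0_lt_compat, INR_S_pos. }
  (* [(x+y)_N (x+y+N) = (x+y) (x+y+1)_N] avoids dividing by [x+y+N]. *)
  assert (E : forall n, (x * beta_term x y n * ((x + y + RtoC (INR (S (S n)))) * / RtoC (INR (S (S n)))) =
     (x + y) * beta_term (x + 1) y n * ((x + RtoC (INR (S (S n)))) * / RtoC (INR (S (S n)))))%C).
  { intros n. unfold beta_term.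
    assert (E1 := Cpochhammer_succ_l x (S (S n))).
    assert (E2 := Cpochhammer_succ_l (x + y) (S (S n))).
    change (Cpochhammer x (S (S (S n)))) with (Cpochhammer x (S (S n)) * (x + RtoC (INR (S (S n)))))%C in E1.
    change (Cpochhammer (x + y) (S (S (S n)))) with
      (Cpochhammer (x + y) (S (S n)) * (x + y + RtoC (INR (S (S n)))))%C in E2.
    replace (x + 1 + y)%C with (x + y + 1)%C by ring.
    assert (A := Cpochhammer_neq_0 x (S (S n)) Hx). assert (B := Cpochhammer_neq_0 y (S (S n)) Hy).
    assert (A' := Cpochhammer_neq_0 (x + 1) (S (S n)) (not_nonpos_int_succ x Hx)).
    set (P := Cpochhammer x (S (S n))) in *. set (Q := Cpochhammer y (S (S n))) in *.
    set (T := Cpochhammer (x + y) (S (S n))) in *. set (P' := Cpochhammer (x + 1) (S (S n))) in *.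
    set (T' := Cpochhammer (x + y + 1) (S (S n))) in *.
    set (w := (/ RtoC (INR (S (S n))))%C). set (N := RtoC (INR (S (S n)))) in *.
    set (F := RtoC (INR (fact (S n)))). clearbody P Q T P' T' w N F.
    replace (x * (T * F / (P * Q)) * ((x + y + N) * w))%C with
      ((T * (x + y + N)) * (x * P') * F * w / (P * Q * P'))%C by (field; auto).
    rewrite E2, <- E1. field; auto. }
  replace (x * Cbeta x y)%C with (x * Cbeta x y * 1)%C by ring.
  replace ((x + y) * Cbeta (x + 1) y)%C with ((x + y) * Cbeta (x + 1) y * 1)%C by ring.
  apply (Clim_unique (fun n => x * beta_term x y n * ((x + y + RtoC (INR (S (S n)))) * / RtoC (INR (S (S n)))))%C).
  - apply Clim_mult; [apply Clim_mult; [apply Clim_const|apply Cbeta_lim; auto]|apply X].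
  - apply Clim_ext with (1 := fun n => eq_sym (E n)).
    apply Clim_mult; [apply Clim_mult; [apply Clim_const|apply Cbeta_lim; auto]|apply X].
    apply not_nonpos_int_succ; auto.
Qed.

Lemma Cbeta_sym (x y : C) : Cbeta x y = Cbeta y x.
Proof. unfold Cbeta. rewrite (Cplus_comm x y). ring. Qed.

End Gamma.

(** * Euler's beta integral and its agreement with the Gauss limit *)

Section Beta.
Local Open Scope R_scope.

(* [Rcpow 0 s = 1] since [ln 0 = 0], so the power has to be cut off at [0] to
   be continuous there. *)
Definition Rcpow0 (s : C) (t : R) : C := if Rle_dec t 0 then 0 else Rcpow t s.

Lemma Rcpow0_pos (s : C) (t : R) : 0 < t -> Rcpow0 s t = Rcpow t s.
Proof. intros H; unfold Rcpow0. destruct (Rle_dec t 0); [lra|auto]. Qed.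

Lemma Rcpow0_neg (s : C) (t : R) : t <= 0 -> Rcpow0 s t = 0.
Proof. intros H; unfold Rcpow0. destruct (Rle_dec t 0); [auto|lra]. Qed.

Lemma Rcpow0_succ (s : C) (t : R) : Rcpow0 (s + 1) t = (RtoC t * Rcpow0 s t)%C.
Proof.
  destruct (Rle_dec t 0).
  - rewrite !Rcpow0_neg by auto. ring.
  - rewrite !Rcpow0_pos, Rcpow_add, Rcpow_1 by lra. ring.
Qed.

Lemma Rcpow0_add_nat (s : C) (n : nat) (t : R) :
  Rcpow0 (s + RtoC (INR n)) t = (RtoC (t ^ n) * Rcpow0 s t)%C.
Proof.
  induction n.
  - simpl. rewrite Cplus_0_r. ring.
  - rewrite S_INR, RtoC_plus, Cplus_assoc, Rcpow0_succ, IHn. simpl. rewrite RtoC_mult. ring.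
Qed.

Lemma Ccont_ext_loc (f g : R -> C) (x d : R) : 0 < d ->
  (forall t, x - d < t < x + d -> f t = g t) -> Ccont f x -> Ccont g x.
Proof.
  intros Hd H Hf. apply (continuous_ext_loc g f x); auto.
  exists (mkposreal d Hd). intros u Hu.
  assert (A : Rabs (u - x) < d) by exact Hu. apply Rabs_lt_between in A. apply H; lra.
Qed.

Lemma is_Cder_ext_loc (f g : R -> C) (x d : R) (l : C) : 0 < d ->
  (forall t, x - d < t < x + d -> f t = g t) -> is_Cder f x l -> is_Cder g x l.
Proof.
  intros Hd H Hf. apply (@is_derive_ext_loc R_AbsRing C_R_NormedModule f g x l); auto.
  exists (mkposreal d Hd). intros u Hu.
  assert (A : Rabs (u - x) < d) by exact Hu. apply Rabs_lt_between in A. apply H; lra.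
Qed.

Lemma Rcpow0_cont (s : C) (t : R) : 0 < Re s -> Ccont (Rcpow0 s) t.
Proof.
  intros Hs. destruct (Rtotal_order t 0) as [H|[H|H]].
  - apply (Ccont_ext_loc (fun _ => RtoC 0) _ t (- t)); [lra| |apply Ccont_const].
    intros u Hu. rewrite Rcpow0_neg; auto; lra.
  - subst t. apply Ccont_eps; intros eps He.
    (* The radius [eps^(1 / Re s)] is where [t^(Re s)] reaches [eps]. *)
    assert (HB := Rpower_pos eps (1 / Re s)).
    exists (mkposreal _ HB). intros u Hu. rewrite (Rcpow0_neg s 0) by lra.
    assert (A : Rabs (u - 0) < Rpower eps (1 / Re s)) by exact Hu. apply Rabs_lt_between in A.
    replace (Rcpow0 s u - 0)%C with (Rcpow0 s u) by ring.
    destruct (Rle_dec u 0).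
    + rewrite Rcpow0_neg, Cmod_0; auto.
    + rewrite Rcpow0_pos, Cmod_Rcpow by lra.
      replace eps with (Rpower (Rpower eps (1 / Re s)) (Re s)).
      * unfold Rpower at 1 2. apply exp_increasing, Rmult_lt_compat_l; auto.
        apply ln_increasing; lra.
      * rewrite Rpower_mult. replace (1 / Re s * Re s) with 1 by (field; lra). apply Rpower_1; auto.
  - apply (Ccont_ext_loc (fun u => Rcpow u s) _ t t); [lra| |apply Ccont_Rcpow; auto].
    intros u Hu. rewrite Rcpow0_pos; auto; lra.
Qed.

(** The difference quotient at 0 is [g] itself. It supplies the derivative of [t^s = t t^(s-1)] at
    the point where the power is cut off. *)
Lemma is_derive_id_mult_0 (g : R -> R) : continuous g 0 -> is_derive (fun t => t * g t) 0 (g 0).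
Proof.
  intros H. apply is_derive_Reals. intros eps He.
  assert (A := H (fun y => ball (g 0) (mkposreal _ He) y) (locally_ball _ _)).
  destruct A as [d Hd]. exists d. intros h Hh Hhd.
  replace (((0 + h) * g (0 + h) - 0 * g 0) / h - g 0) with (g h - g 0).
  - apply (Hd h). change (Rabs (h - 0) < d). rewrite Rminus_0_r; auto.
  - rewrite Rplus_0_l. field; auto.
Qed.

Lemma is_Cder_Rcpow0 (s : C) (t : R) : 1 < Re s -> is_Cder (Rcpow0 s) t (s * Rcpow0 (s - 1) t)%C.
Proof.
  intros Hs. assert (Hs1 : 0 < Re (s - 1)%C) by (destruct s; simpl in *; lra).
  destruct (Rtotal_order t 0) as [H|[H|H]].
  - rewrite (Rcpow0_neg _ t) by lra. rewrite Cmult_0_r.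
    apply (is_Cder_ext_loc (fun _ => RtoC 0) _ t (- t)); [lra| |apply is_Cder_const].
    intros u Hu. rewrite Rcpow0_neg; auto; lra.
  - subst t.
    assert (K := Rcpow0_cont (s - 1) 0 Hs1). apply Ccont_re_im in K. destruct K as [K1 K2].
    rewrite (Rcpow0_neg _ 0) by lra. rewrite Cmult_0_r.
    apply is_Cder_ext with (fun t => RtoC t * Rcpow0 (s - 1) t)%C.
    { intros t. rewrite <- Rcpow0_succ. f_equal; ring. }
    apply is_Cder_re_im.
    + apply is_derive_id_mult_0 in K1. rewrite (Rcpow0_neg _ 0) in K1 by lra.
      apply (is_derive_ext _ _ _ _ ) with (2 := K1). intros t; destruct (Rcpow0 (s - 1) t); simpl; ring.
    + apply is_derive_id_mult_0 in K2. rewrite (Rcpow0_neg _ 0) in K2 by lra.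
      apply (is_derive_ext _ _ _ _ ) with (2 := K2). intros t; destruct (Rcpow0 (s - 1) t); simpl; ring.
  - rewrite (Rcpow0_pos _ t) by lra.
    apply (is_Cder_ext_loc (fun u => Rcpow u s) _ t t); [lra| |apply is_Cder_Rcpow; auto].
    intros u Hu. rewrite Rcpow0_pos; auto; lra.
Qed.

Lemma Rcpow0_reflect_cont (s : C) (c t : R) : 0 < Re s -> Ccont (fun t => Rcpow0 s (c - t)) t.
Proof.
  intros H. apply (Ccont_comp (Rcpow0 s) (fun t => c - t)); [|apply Rcpow0_cont; auto].
  apply Rcont_minus; [apply continuous_const|apply continuous_id].
Qed.

Lemma is_Cder_Rcpow0_reflect (s : C) (c t : R) : 1 < Re s ->
  is_Cder (fun t => Rcpow0 s (c - t)) t (- (s * Rcpow0 (s - 1) (c - t)))%C.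
Proof.
  intros H.
  assert (D := is_Cder_comp (Rcpow0 s) (fun t => c - t) t _ _ (is_Cder_Rcpow0 s (c - t) H)
    (is_derive_reflect c t)).
  rewrite RtoC_opp in D.
  replace (- (s * Rcpow0 (s - 1) (c - t)))%C with (- (1) * (s * Rcpow0 (s - 1) (c - t)))%C by ring.
  exact D.
Qed.

Lemma Re_plus_1 (s : C) : Re (s + 1)%C = Re s + 1.
Proof. destruct s; auto. Qed.

Lemma Re_minus_1 (s : C) : Re (s - 1)%C = Re s - 1.
Proof. destruct s; auto. Qed.

(** Euler's beta integral. It is used for real parts above 1, where the integrand is continuous up
    to the end points and the integral is proper. *)
Definition betaI (x y : C) : C := CInt (fun t => Rcpow0 (x - 1) t * Rcpow0 (y - 1) (1 - t))%C 0 1.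

Lemma is_CInt_betaI (x y : C) : 1 < Re x -> 1 < Re y ->
  is_CInt (fun t => Rcpow0 (x - 1) t * Rcpow0 (y - 1) (1 - t))%C 0 1 (betaI x y).
Proof.
  intros Hx Hy. apply is_CInt_CInt. intros t _. apply Ccont_mult.
  - apply Rcpow0_cont. rewrite Re_minus_1; lra.
  - apply Rcpow0_reflect_cont. rewrite Re_minus_1; lra.
Qed.

(** This is [t + (1 - t) = 1] under the integral sign. *)
Lemma betaI_split (x y : C) : 1 < Re x -> 1 < Re y -> betaI x y = (betaI (x + 1) y + betaI x (y + 1))%C.
Proof.
  intros Hx Hy. apply CInt_eq.
  apply is_CInt_ext with (fun t => Rcpow0 (x + 1 - 1) t * Rcpow0 (y - 1) (1 - t) +
     Rcpow0 (x - 1) t * Rcpow0 (y + 1 - 1) (1 - t))%C.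
  - intros t _. replace (x + 1 - 1)%C with (x - 1 + 1)%C by ring.
    replace (y + 1 - 1)%C with (y - 1 + 1)%C by ring. rewrite !Rcpow0_succ, RtoC_minus. ring.
  - apply is_CInt_plus; apply is_CInt_betaI; rewrite ?Re_plus_1; lra.
Qed.

Lemma betaI_by_parts (x y : C) : 1 < Re x -> 1 < Re y -> (x * betaI x (y + 1) = y * betaI (x + 1) y)%C.
Proof.
  intros Hx Hy.
  assert (I : is_CInt (fun t => x * (Rcpow0 (x - 1) t * Rcpow0 (y + 1 - 1) (1 - t)) -
     y * (Rcpow0 (x + 1 - 1) t * Rcpow0 (y - 1) (1 - t)))%C 0 1
     (Rcpow0 x 1 * Rcpow0 y (1 - 1) - Rcpow0 x 0 * Rcpow0 y (1 - 0))%C).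
  { apply (is_CInt_derive (fun t => Rcpow0 x t * Rcpow0 y (1 - t))%C).
    - intros t _. assert (D := is_Cder_mult _ _ _ _ _ (is_Cder_Rcpow0 x t Hx) (is_Cder_Rcpow0_reflect y 1 t Hy)).
      match goal with |- is_Cder _ _ ?v => match type of D with is_Cder _ _ ?w => replace v with w; [exact D|] end end.
      replace (x + 1 - 1)%C with x by ring. replace (y + 1 - 1)%C with y by ring. ring.
    - intros t _. apply Ccont_minus; apply Ccont_scal; (apply Ccont_mult;
        [apply Rcpow0_cont|apply Rcpow0_reflect_cont]); rewrite ?Re_minus_1, ?Re_plus_1; lra. }
  replace (1 - 1) with 0 in I by ring. rewrite !(Rcpow0_neg _ 0) in I by lra.
  assert (I2 := is_CInt_minus _ _ _ _ _ _ (is_CInt_scal x _ _ _ _ (is_CInt_betaI x (y + 1) Hx ltac:(rewrite Re_plus_1; lra)))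
     (is_CInt_scal y _ _ _ _ (is_CInt_betaI (x + 1) y ltac:(rewrite Re_plus_1; lra) Hy))).
  apply CInt_eq in I. apply CInt_eq in I2. rewrite I in I2.
  replace (x * betaI x (y + 1))%C with (x * betaI x (y + 1) - y * betaI (x + 1) y + y * betaI (x + 1) y)%C by ring.
  rewrite <- I2. ring.
Qed.

Lemma betaI_succ (x y : C) : 1 < Re x -> 1 < Re y -> (x * betaI x y = (x + y) * betaI (x + 1) y)%C.
Proof.
  intros Hx Hy. rewrite betaI_split by auto. rewrite Cmult_plus_distr_l, betaI_by_parts by auto. ring.
Qed.

Lemma betaI_iter (x y : C) (n : nat) : 1 < Re x -> 1 < Re y ->
  (Cpochhammer x n * betaI x y = Cpochhammer (x + y) n * betaI (x + RtoC (INR n)) y)%C.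
Proof.
  intros Hx Hy. induction n.
  - simpl. rewrite Cplus_0_r. ring.
  - simpl Cpochhammer.
    replace (Cpochhammer x n * (x + INR n) * betaI x y)%C with
      ((x + INR n) * (Cpochhammer x n * betaI x y))%C by ring.
    rewrite IHn.
    replace ((x + INR n) * (Cpochhammer (x + y) n * betaI (x + INR n) y))%C with
      (Cpochhammer (x + y) n * ((x + INR n) * betaI (x + INR n) y))%C by ring.
    rewrite betaI_succ; auto.
    + rewrite S_INR, RtoC_plus, Cplus_assoc. ring.
    + replace (Re (x + INR n)%C) with (Re x + INR n) by (destruct x; auto). generalize (pos_INR n); lra.
Qed.

(** The beta integral at [(n + 1, y)]; the integer power makes the closed form [monoI_eq] available
    by induction. *)
Definition monoI (n : nat) (y : C) : C := CInt (fun t => RtoC (t ^ n) * Rcpow0 (y - 1) (1 - t))%C 0 1.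

Lemma pow_cont (n : nat) (t : R) : continuous (fun t => t ^ n) t.
Proof. apply (ex_derive_continuous (fun t => t ^ n)). auto_derive. auto. Qed.

Lemma is_CInt_monoI (n : nat) (y : C) : 1 < Re y ->
  is_CInt (fun t => RtoC (t ^ n) * Rcpow0 (y - 1) (1 - t))%C 0 1 (monoI n y).
Proof.
  intros Hy. apply is_CInt_CInt. intros t _. apply Ccont_mult.
  - apply Ccont_RtoC, pow_cont.
  - apply Rcpow0_reflect_cont. rewrite Re_minus_1; lra.
Qed.

Lemma monoI_0 (y : C) : 1 < Re y -> (y * monoI 0 y = 1)%C.
Proof.
  intros Hy.
  assert (I : is_CInt (fun t => y * (RtoC (t ^ 0) * Rcpow0 (y - 1) (1 - t)))%C 0 1
     (- Rcpow0 y (1 - 1) - - Rcpow0 y (1 - 0))%C).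
  { apply (is_CInt_derive (fun t => - Rcpow0 y (1 - t))%C).
    - intros t _. assert (D := is_Cder_scal (- (1)) _ _ _ (is_Cder_Rcpow0_reflect y 1 t Hy)).
      apply is_Cder_ext with (g := fun t => (- Rcpow0 y (1 - t))%C) in D; [|intros; ring].
      match goal with |- is_Cder _ _ ?v => match type of D with is_Cder _ _ ?w => replace v with w; [exact D|] end end.
      simpl. ring.
    - intros t _. apply Ccont_scal, Ccont_mult; [apply Ccont_RtoC, pow_cont|].
      apply Rcpow0_reflect_cont. rewrite Re_minus_1; lra. }
  assert (I2 := is_CInt_scal y _ _ _ _ (is_CInt_monoI 0 y Hy)).
  apply CInt_eq in I. apply CInt_eq in I2. rewrite I in I2. rewrite <- I2.
  rewrite Rcpow0_neg by lra. rewrite Rcpow0_pos by lra. rewrite Rminus_0_r, Rcpow_1_l. ring.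
Qed.

Lemma monoI_succ (n : nat) (y : C) : 1 < Re y -> (y * monoI (S n) y = RtoC (INR (S n)) * monoI n (y + 1))%C.
Proof.
  intros Hy.
  assert (I : is_CInt (fun t => RtoC (INR (S n)) * (RtoC (t ^ n) * Rcpow0 (y + 1 - 1) (1 - t)) -
     y * (RtoC (t ^ S n) * Rcpow0 (y - 1) (1 - t)))%C 0 1
     (RtoC (1 ^ S n) * Rcpow0 y (1 - 1) - RtoC (0 ^ S n) * Rcpow0 y (1 - 0))%C).
  { apply (is_CInt_derive (fun t => RtoC (t ^ S n) * Rcpow0 y (1 - t))%C).
    - intros t _.
      assert (D1 : is_Cder (fun t => RtoC (t ^ S n)) t (RtoC (INR (S n) * t ^ n))).
      { apply is_Cder_RtoC. evar_last; [apply is_derive_pow, is_derive_id|].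
        change (INR (S n) * 1 * t ^ n = INR (S n) * t ^ n). ring. }
      assert (D := is_Cder_mult _ _ _ _ _ D1 (is_Cder_Rcpow0_reflect y 1 t Hy)).
      match goal with |- is_Cder _ _ ?v => match type of D with is_Cder _ _ ?w => replace v with w; [exact D|] end end.
      replace (y + 1 - 1)%C with y by ring. rewrite RtoC_mult. ring.
    - intros t _. apply Ccont_minus; apply Ccont_scal; (apply Ccont_mult;
        [apply Ccont_RtoC, pow_cont|apply Rcpow0_reflect_cont]); rewrite ?Re_minus_1, ?Re_plus_1; lra. }
  assert (I2 := is_CInt_minus _ _ _ _ _ _ (is_CInt_scal (RtoC (INR (S n))) _ _ _ _ (is_CInt_monoI n (y + 1) ltac:(rewrite Re_plus_1; lra)))
     (is_CInt_scal y _ _ _ _ (is_CInt_monoI (S n) y Hy))).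
  apply CInt_eq in I. apply CInt_eq in I2. rewrite I in I2.
  replace (1 - 1) with 0 in I2 by ring. rewrite (Rcpow0_neg _ 0) in I2 by lra.
  rewrite (pow_ne_zero (S n)) in I2 by lia.
  replace (y * monoI (S n) y)%C with (INR (S n) * monoI n (y + 1) - (INR (S n) * monoI n (y + 1) - y * monoI (S n) y))%C by ring.
  rewrite <- I2. ring.
Qed.

Lemma monoI_eq (n : nat) : forall y : C, 1 < Re y -> (Cpochhammer y (S n) * monoI n y = RtoC (INR (fact n)))%C.
Proof.
  induction n; intros y Hy.
  - simpl. rewrite Cplus_0_r, Cmult_1_l. apply monoI_0; auto.
  - rewrite Cpochhammer_succ_l.
    replace (y * Cpochhammer (y + 1) (S n) * monoI (S n) y)%C with
     (Cpochhammer (y + 1) (S n) * (y * monoI (S n) y))%C by ring.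
    rewrite monoI_succ by auto.
    replace (Cpochhammer (y + 1) (S n) * (RtoC (INR (S n)) * monoI n (y + 1)))%C with
      (RtoC (INR (S n)) * (Cpochhammer (y + 1) (S n) * monoI n (y + 1)))%C by ring.
    rewrite IHn by (rewrite Re_plus_1; lra). rewrite fact_S_R, RtoC_mult. auto.
Qed.

Lemma not_nonpos_int_Re (x : C) : 0 < Re x -> not_nonpos_int x.
Proof. intros H n E. rewrite E in H. simpl in H. generalize (pos_INR n); lra. Qed.

(** Since [Re x > 1], the derivative [x t^(x-1)] is at most [|x|] in modulus on [[0, 1]]. *)
Lemma Rcpow0_minus_1 (x : C) (t : R) : 1 < Re x -> 0 <= t <= 1 ->
  Cmod (Rcpow0 x t - 1)%C <= Cmod x * (1 - t).
Proof.
  intros Hx Ht.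
  assert (I : is_CInt (fun s => x * Rcpow0 (x - 1) s)%C t 1 (Rcpow0 x 1 - Rcpow0 x t)%C).
  { apply (is_CInt_derive (Rcpow0 x)); intros s _; [apply is_Cder_Rcpow0; auto|].
    apply Ccont_scal, Rcpow0_cont. rewrite Re_minus_1; lra. }
  rewrite (Rcpow0_pos x 1), Rcpow_1_l in I by lra.
  replace (Rcpow0 x t - 1)%C with (- (1 - Rcpow0 x t))%C by ring. rewrite Cmod_opp, Rmult_comm.
  apply (is_CInt_Cmod_le_const _ t 1) with (3 := I); [lra|].
  intros s Hs. rewrite Cmod_mult. rewrite <- (Rmult_1_r (Cmod x)) at 2.
  apply Rmult_le_compat_l; [apply Cmod_ge_0|].
  destruct (Rle_dec s 0); [rewrite Rcpow0_neg, Cmod_0; lra|].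
  rewrite Rcpow0_pos, Cmod_Rcpow, Re_minus_1 by lra.
  unfold Rpower. apply Rle_trans with (exp 0); [|rewrite exp_0; lra].
  assert (L : (Re x - 1) * ln s <= 0).
  { assert (ln s <= 0) by (rewrite <- ln_1; apply ln_mono; lra). nra. }
  destruct L as [L|L]; [left; apply exp_increasing; auto|rewrite L; lra].
Qed.

Lemma Rcpow0_real (e u : R) : Rcpow0 (RtoC e) u = RtoC (if Rle_dec u 0 then 0 else Rpower u e).
Proof.
  unfold Rcpow0. destruct (Rle_dec u 0); auto.
  unfold Rcpow, Cexp, Rpower. simpl.
  replace (e * ln u - 0 * 0) with (e * ln u) by ring. replace (e * 0 + 0 * ln u) with 0 by ring.
  rewrite cos_0, sin_0. unfold Cmult, RtoC; simpl; f_equal; ring.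
Qed.

(** The integrands differ by the factor [t^x - 1], of modulus at most [|x| (1 - t)]. The extra
    [1 - t] raises the second exponent by one, which gains the order [1/n] needed in
    [Cbeta_betaI]. *)
Lemma monoI_diff (x y : C) (n : nat) : 1 < Re x -> 1 < Re y ->
  Cmod (monoI (S n) y - betaI (x + RtoC (INR (S (S n)))) y)%C <=
    Cmod x * Cmod (monoI (S n) (RtoC (Re y) + 1)).
Proof.
  intros Hx Hy. set (e := Re y) in *.
  assert (He : 1 < Re (RtoC e + 1)%C) by (simpl; lra).
  assert (I1 := is_CInt_monoI (S n) (RtoC e + 1) He).
  assert (I2 := is_CInt_minus _ _ _ _ _ _ (is_CInt_monoI (S n) y Hy)
    (is_CInt_betaI (x + RtoC (INR (S (S n)))) y
     ltac:(replace (Re (x + RtoC (INR (S (S n))))%C) with (Re x + INR (S (S n))) by (destruct x; auto); generalize (pos_INR (S (S n))); lra) Hy)).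
  apply is_CInt_re_im in I1. destruct I1 as [I1 _].
  eapply Rle_trans with (Cmod x * Re (monoI (S n) (RtoC e + 1))).
  - eapply is_CInt_Cmod_le with (3 := I2) (g := fun t => Cmod x * Re (RtoC (t ^ S n) * Rcpow0 (RtoC e + 1 - 1) (1 - t))%C).
    + lra.
    + intros t Ht.
      replace (x + RtoC (INR (S (S n))) - 1)%C with (x + RtoC (INR (S n)))%C
        by (rewrite (S_INR (S n)), RtoC_plus; ring).
      rewrite Rcpow0_add_nat. replace (RtoC e + 1 - 1)%C with (RtoC e) by ring.
      replace (RtoC (t ^ S n) * Rcpow0 (y - 1) (1 - t) - RtoC (t ^ S n) * Rcpow0 x t * Rcpow0 (y - 1) (1 - t))%C
        with (- (RtoC (t ^ S n) * ((Rcpow0 x t - 1) * Rcpow0 (y - 1) (1 - t))))%C by ring.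
      rewrite Cmod_opp, !Cmod_mult, Cmod_R, (Rabs_pos_eq (t ^ S n)) by (apply pow_le; lra).
      rewrite Rcpow0_real, <- RtoC_mult. simpl Re.
      replace (Cmod x * (t * t ^ n * (if Rle_dec (1 - t) 0 then 0 else Rpower (1 - t) e)))
       with (t ^ S n * (Cmod x * (1 - t) * (if Rle_dec (1 - t) 0 then 0 else Rpower (1 - t) (e - 1)))).
      * apply Rmult_le_compat_l; [apply pow_le; lra|].
        apply Rmult_le_compat; try apply Cmod_ge_0; [apply Rcpow0_minus_1; auto|].
        destruct (Rle_dec (1 - t) 0).
        -- rewrite Rcpow0_neg, Cmod_0; lra.
        -- rewrite Rcpow0_pos, Cmod_Rcpow, Re_minus_1 by lra. unfold e; lra.
      * destruct (Rle_dec (1 - t) 0); [ring|].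
        replace (Rpower (1 - t) e) with ((1 - t) * Rpower (1 - t) (e - 1)); [simpl; ring|].
        rewrite <- (Rpower_1 (1 - t)) at 1 by lra. rewrite <- Rpower_plus. f_equal; ring.
    + apply (@is_RInt_scal R_NormedModule). exact I1.
  - apply Rmult_le_compat_l; [apply Cmod_ge_0|]. eapply Rle_trans; [apply Rle_abs|apply re_le_Cmod].
Qed.

(** Raising [x] by [n + 2] through the recurrence, and then replacing [t^(x+n+1)] by [t^(n+1)],
    turns the integral into [beta_term]. The error, multiplied by the Pochhammer quotient [q], tends
    to 0. *)
Lemma Cbeta_betaI (x y : C) : 1 < Re x -> 1 < Re y -> Cbeta x y = betaI x y.
Proof.
  intros Hx Hy.
  assert (Nx := not_nonpos_int_Re x ltac:(lra)). assert (Ny := not_nonpos_int_Re y ltac:(lra)).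
  set (e := (RtoC (Re y) + 1)%C).
  assert (Re_e : Re e = Re y + 1) by (unfold e; simpl; ring).
  assert (Ne := not_nonpos_int_Re e ltac:(lra)).
  apply (Clim_unique (beta_term x y)); [apply Cbeta_lim; auto|].
  set (q := fun n => (Cpochhammer (x + y) (S (S n)) * / Cpochhammer x (S (S n)))%C).
  assert (E : forall n, (beta_term x y n - betaI x y = q n * (monoI (S n) y - betaI (x + RtoC (INR (S (S n)))) y))%C).
  { intros n. unfold q, beta_term.
    assert (A := Cpochhammer_neq_0 x (S (S n)) Nx). assert (B := Cpochhammer_neq_0 y (S (S n)) Ny).
    assert (M := monoI_eq (S n) y Hy). assert (G := betaI_iter x y (S (S n)) Hx Hy).
    rewrite <- M.
    replace (betaI x y) with (/ Cpochhammer x (S (S n)) * (Cpochhammer x (S (S n)) * betaI x y))%C by (field; auto).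
    rewrite G. set (P := Cpochhammer x (S (S n))) in *. set (Q := Cpochhammer y (S (S n))) in *.
    set (T := Cpochhammer (x + y) (S (S n))). clearbody P Q T. field; auto. }
  (* The Gauss quotients converge, so the error bound behaves like [(n+1)^(y-e)], whose modulus is
     exactly [1/(n+1)] by the choice of [e]. *)
  assert (Lim : Clim (fun n => gauss (x + y) n * / gauss x n * / gauss e n * x * Rcpow (INR (S n)) (y - e))%C
    (Crgamma (x + y) * / Crgamma x * / Crgamma e * x * 0)%C).
  { apply Clim_mult; [apply Clim_mult; [apply Clim_mult; [apply Clim_mult|]|]|].
    { apply Crgamma_lim. }
    { apply Crgamma_spec; auto. }
    { apply Crgamma_spec; auto. }
    { apply Clim_const. }
    apply Clim_0_bound with (fun n => Rpower (INR (S n)) (- (1))); [|apply is_lim_seq_Rpower_neg; lra].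
    intros n. rewrite Cmod_Rcpow. unfold e. replace (Re (y - (RtoC (Re y) + 1))%C) with (- (1)).
    - lra.
    - destruct y; simpl; ring. }
  replace (Crgamma (x + y) * / Crgamma x * / Crgamma e * x * 0)%C with (RtoC 0) in Lim by ring.
  apply is_lim_seq_le_le with (3 := Lim) (u := fun _ => 0); [|apply is_lim_seq_const].
  intros n. split; [apply Cmod_ge_0|]. rewrite E. cbv beta.
  rewrite (ltac:(intros; ring) : forall z : C, (z - RtoC 0)%C = z).
  replace (gauss (x + y) n * / gauss x n * / gauss e n * x * Rcpow (INR (S n)) (y - e))%C
    with (q n * (x * monoI (S n) e))%C.
  - rewrite !(Cmod_mult (q n)). apply Rmult_le_compat_l; [apply Cmod_ge_0|].
    rewrite Cmod_mult. apply monoI_diff; auto.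
  - assert (M := monoI_eq (S n) e ltac:(lra)).
    assert (A := Cpochhammer_neq_0 x (S (S n)) Nx). assert (B := Cpochhammer_neq_0 e (S (S n)) Ne).
    assert (M' : monoI (S n) e = (/ Cpochhammer e (S (S n)) * RtoC (INR (fact (S n))))%C).
    { rewrite <- M. field; auto. }
    rewrite M'. unfold q, gauss.
    replace (y - e)%C with (y + - e)%C by ring. rewrite !Rcpow_add, Rcpow_opp.
    assert (N1 := Rcpow_neq_0 (INR (S n)) x). assert (N2 := Rcpow_neq_0 (INR (S n)) y).
    assert (N4 := Rcpow_neq_0 (INR (S n)) e).
    assert (N3 := RtoC_fact_neq_0 (S n)).
    set (P := Cpochhammer x (S (S n))) in *. set (Q := Cpochhammer e (S (S n))) in *.
    set (T := Cpochhammer (x + y) (S (S n))) in *. clearbody P Q T.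
    field. repeat split; auto.
Qed.

End Beta.

(** * Incomplete beta integrals *)

Section Incomplete.
Local Open Scope R_scope.

Fixpoint Rpoch (b : R) (n : nat) : R :=
  match n with O => 1 | S m => Rpoch b m * (b + INR m) end.

Lemma Rpoch_pos (b : R) (n : nat) : 0 < b -> 0 < Rpoch b n.
Proof.
  intros Hb; induction n; simpl; [lra|]. apply Rmult_lt_0_compat; auto. generalize (pos_INR n); lra.
Qed.

Lemma Rpoch_succ_l (b : R) (n : nat) : Rpoch b (S n) = b * Rpoch (b + 1) n.
Proof.
  induction n; [simpl; ring|].
  change (Rpoch b (S (S n))) with (Rpoch b (S n) * (b + INR (S n))). rewrite IHn, S_INR. simpl. ring.
Qed.

Lemma Cmod_Cpochhammer_le (c : C) (b : R) (n : nat) : Cmod c <= b -> Cmod (Cpochhammer c n) <= Rpoch b n.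
Proof.
  intros H; induction n; simpl; [rewrite Cmod_1; lra|].
  rewrite Cmod_mult. apply Rmult_le_compat; auto using Cmod_ge_0.
  eapply Rle_trans; [apply Cmod_triangle|]. rewrite Cmod_R, Rabs_pos_eq by apply pos_INR. lra.
Qed.

(* Coefficients of [(1 - 1/2)^(-b)]. *)
Definition binom_bound (b : R) (n : nat) : R := Rpoch b n / INR (fact n) * (1 / 2) ^ n.

Lemma binom_bound_pos (b : R) (n : nat) : 0 < b -> 0 < binom_bound b n.
Proof.
  intros Hb. apply Rmult_lt_0_compat; [|apply pow_lt; lra].
  apply Rdiv_lt_0_compat; [apply Rpoch_pos; auto|apply INR_fact_lt_0].
Qed.

Lemma is_lim_seq_inv_INR_S : is_lim_seq (fun n => / INR (S n)) 0.
Proof.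
  apply is_lim_seq_ext with (fun n => Rpower (INR (S n)) (- (1))).
  - intros n. rewrite Rpower_Ropp, Rpower_1 by apply INR_S_pos. auto.
  - apply is_lim_seq_Rpower_neg; lra.
Qed.

(** Ratio test: successive terms have quotient [(1/2) (n + b) / (n + 1)], which tends to 1/2. *)
Lemma ex_series_binom_bound (b : R) : 0 < b -> ex_series (binom_bound b).
Proof.
  intros Hb. apply ex_series_ext with (fun n => Rabs (binom_bound b n)).
  { intros n. apply Rabs_pos_eq. left; apply binom_bound_pos; auto. }
  apply ex_series_DAlembert with (1/2); [lra| |].
  - intros n. apply Rgt_not_eq, binom_bound_pos; auto.
  - apply is_lim_seq_ext with (fun n => 1 / 2 * (1 + (b - 1) * / INR (S n))).
    + intros n. assert (P := INR_S_pos n). assert (Q := pos_INR n).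
      rewrite Rabs_pos_eq.
      * unfold binom_bound. rewrite fact_S_R. simpl Rpoch. simpl pow.
        rewrite S_INR in *. field. repeat split; try lra; try apply INR_fact_neq_0.
        -- apply pow_nonzero; lra.
        -- apply Rgt_not_eq, Rpoch_pos; auto.
      * left. apply Rdiv_lt_0_compat; apply binom_bound_pos; auto.
    + replace (1/2) with (1/2 * (1 + (b - 1) * 0)) at 1 by field.
      apply is_lim_seq_mult'; [apply is_lim_seq_const|].
      apply is_lim_seq_plus'; [apply is_lim_seq_const|].
      apply is_lim_seq_mult'; [apply is_lim_seq_const|apply is_lim_seq_inv_INR_S].
Qed.

(* Taylor coefficients at [u = 0] of [(m - u)^(-b)]. *)
Definition binom_coef (m : R) (b : C) (n : nat) : C :=
  (Cpochhammer b n / RtoC (INR (fact n)) * Rcpow m (- (b + RtoC (INR n))))%C.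

Lemma Cmod_fact (n : nat) : Cmod (RtoC (INR (fact n))) = INR (fact n).
Proof. rewrite Cmod_R. apply Rabs_pos_eq, pos_INR. Qed.

Lemma RtoC_INR_S_neq_0 (n : nat) : RtoC (INR (S n)) <> 0.
Proof. apply RtoC_neq_0, not_0_INR; lia. Qed.

Lemma Rpower_shift_nat_le (m s : R) (n : nat) : 2 <= m -> Rpower m (- (s + INR n)) <= Rpower m (- s) * (1 / 2) ^ n.
Proof.
  intros Hm. replace (- (s + INR n)) with (- s + - INR n) by ring. rewrite Rpower_plus.
  apply Rmult_le_compat_l; [left; apply Rpower_pos|].
  rewrite Rpower_Ropp, Rpower_pow by lra. rewrite <- pow_inv. apply pow_incr.
  split; [left; apply Rinv_0_lt_compat; lra|].
  replace (1/2) with (/2) by field. apply Rinv_le_contravar; lra.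
Qed.

Lemma Cmod_Rcpow_shift_le (m : R) (b : C) (n : nat) : 2 <= m ->
  Cmod (Rcpow m (- (b + RtoC (INR n)))) <= Rpower m (- Re b) * (1 / 2) ^ n.
Proof.
  intros Hm. rewrite Cmod_Rcpow.
  replace (Re (- (b + RtoC (INR n)))%C) with (- (Re b + INR n)) by (destruct b; auto).
  apply Rpower_shift_nat_le; auto.
Qed.

Lemma Cmod_poch_fact_le (b : C) (B : R) (n : nat) : Cmod b <= B ->
  Cmod (Cpochhammer b n / RtoC (INR (fact n)))%C <= Rpoch B n / INR (fact n).
Proof.
  intros HB. rewrite Cmod_div, Cmod_fact by apply RtoC_fact_neq_0.
  apply Rmult_le_compat_r; [left; apply Rinv_0_lt_compat, INR_fact_lt_0|].
  apply Cmod_Cpochhammer_le; auto.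
Qed.

Lemma binom_coef_le (m : R) (b : C) (n : nat) : 2 <= m ->
  Cmod (binom_coef m b n) <= Rpower m (- Re b) * binom_bound (Cmod b + 1) n.
Proof.
  intros Hm. unfold binom_coef, binom_bound. rewrite Cmod_mult.
  replace (Rpower m (- Re b) * (Rpoch (Cmod b + 1) n / INR (fact n) * (1 / 2) ^ n)) with
    (Rpoch (Cmod b + 1) n / INR (fact n) * (Rpower m (- Re b) * (1 / 2) ^ n)) by ring.
  apply Rmult_le_compat; auto using Cmod_ge_0.
  - apply Cmod_poch_fact_le; lra.
  - apply Cmod_Rcpow_shift_le; auto.
Qed.

(** Coefficient form of the differential equation [(m - u) f' = b f] of [(m - u)^(-b)]. *)
Lemma binom_coef_succ (m : R) (b : C) (n : nat) : 0 < m ->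
  (RtoC m * (RtoC (INR (S n)) * binom_coef m b (S n)) = (RtoC (INR n) + b) * binom_coef m b n)%C.
Proof.
  intros Hm. unfold binom_coef.
  replace (- (b + RtoC (INR (S n))))%C with (- (b + RtoC (INR n)) + - (1))%C by (rewrite S_INR, RtoC_plus; ring).
  rewrite (Rcpow_add m _ (- (1))), (Rcpow_opp m 1), Rcpow_1 by auto.
  rewrite fact_S_R, RtoC_mult. simpl Cpochhammer.
  assert (A := RtoC_INR_S_neq_0 n). assert (B := RtoC_fact_neq_0 n).
  field. repeat split; auto. apply RtoC_neq_0; lra.
Qed.

Lemma ex_series_Rscal (c : R) (u : nat -> R) : ex_series u -> ex_series (fun n => c * u n).
Proof. intros [l Hl]; exists (c * l). apply (@is_series_scal R_AbsRing R_NormedModule _ _ _ Hl). Qed.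

(** The sum satisfies [(m - u) f' = b f], so [(m - u)^b f] is constant, with value 1 at 0. The end
    point [u = 1] lies inside the disc of convergence because [m >= 2]. *)
Lemma binomial_series (m : R) (b : C) (u : R) : 2 <= m -> 0 <= u <= 1 ->
  Cser (fun n => binom_coef m b n * RtoC (u ^ n))%C (Rcpow (m - u) (- b)).
Proof.
  intros Hm Hu.
  set (p := binom_coef m b).
  (* Coefficients of the derivative. Their majorant [Q] has [B + 1] in place of [B], since
     [(n + B) (B)_n = B (B+1)_n]. *)
  set (q := fun n => (RtoC (INR (S n)) * p (S n))%C).
  (* The added 1 keeps the majorants positive also for [b = 0]. *)
  set (B := Cmod b + 1). assert (HB : 0 < B) by (unfold B; generalize (Cmod_ge_0 b); lra).
  set (P := fun n => Rpower m (- Re b) * binom_bound B n).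
  set (Q := fun n => Rpower m (- Re b) * (B / m) * binom_bound (B + 1) n).
  assert (HP : forall n, Cmod (p n) <= P n) by (intros; apply binom_coef_le; auto).
  assert (EP : ex_series P) by (apply ex_series_Rscal, ex_series_binom_bound; auto).
  assert (EQ : ex_series Q) by (apply ex_series_Rscal, ex_series_binom_bound; lra).
  assert (m0 : RtoC m <> 0) by (apply RtoC_neq_0; lra).
  assert (qE : forall n, q n = ((RtoC (INR n) + b) / RtoC m * p n)%C).
  { intros n. unfold q. replace (RtoC (INR (S n)) * p (S n))%C with
     (/ RtoC m * (RtoC m * (RtoC (INR (S n)) * p (S n))))%C by (field; auto).
    unfold p. rewrite binom_coef_succ by lra. field; auto. }
  assert (HQ : forall n, Cmod (q n) <= Q n).
  { intros n. rewrite qE, Cmod_mult, Cmod_div, Cmod_R, (Rabs_pos_eq m) by (auto; lra).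
    apply Rle_trans with ((INR n + B) / m * P n).
    - apply Rmult_le_compat; auto using Cmod_ge_0.
      + apply Rmult_le_pos; [apply Cmod_ge_0|left; apply Rinv_0_lt_compat; lra].
      + apply Rmult_le_compat_r; [left; apply Rinv_0_lt_compat; lra|].
        eapply Rle_trans; [apply Cmod_triangle|]. rewrite Cmod_R, Rabs_pos_eq by apply pos_INR.
        unfold B; lra.
    - right. unfold P, Q, binom_bound. assert (E := Rpoch_succ_l B n). simpl in E.
      transitivity (Rpower m (- Re b) / m / INR (fact n) * (1/2) ^ n * (B * Rpoch (B + 1) n)).
      + rewrite <- E. field; split; solve [lra|apply INR_fact_neq_0].
      + field; split; solve [lra|apply INR_fact_neq_0]. }
  assert (Hpow : forall t n, 0 <= t <= 1 -> 0 <= t ^ n <= 1).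
  { intros t n Ht. split; [apply pow_le; lra|]. rewrite <- (pow1 n). apply pow_incr; lra. }
  assert (bound : forall (c : C) (M t : R) n, Cmod c <= M -> 0 <= t <= 1 -> Cmod (c * RtoC (t ^ n))%C <= M).
  { intros c M t n Hc Ht. destruct (Hpow t n Ht). rewrite Cmod_mult, Cmod_R, Rabs_pos_eq by auto.
    rewrite <- (Rmult_1_r M). apply Rmult_le_compat; auto using Cmod_ge_0. }
  set (ps := fun t => Csum (fun n => p n * RtoC (t ^ n))%C).
  set (qs := fun t => Csum (fun n => q n * RtoC (t ^ n))%C).
  assert (Sp : forall t, 0 <= t <= 1 -> Cser (fun n => p n * RtoC (t ^ n))%C (ps t)).
  { intros t Ht. apply Cser_Csum with P; auto. }
  assert (Sq : forall t, 0 <= t <= 1 -> Cser (fun n => q n * RtoC (t ^ n))%C (qs t)).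
  { intros t Ht. apply Cser_Csum with Q; auto. }
  assert (ode : forall t, 0 <= t <= 1 -> (RtoC (m - t) * qs t = b * ps t)%C).
  { intros t Ht.
    assert (S1 : Cser (fun n => RtoC (INR n) * p n * RtoC (t ^ n))%C (RtoC t * qs t)%C).
    { replace (RtoC t * qs t)%C with (RtoC t * qs t + RtoC (INR 0) * p 0%nat * RtoC (t ^ 0))%C by (simpl; ring).
      apply (Cser_decr_1 (fun n => RtoC (INR n) * p n * RtoC (t ^ n))%C).
      apply Cser_ext with (2 := Cser_scal (RtoC t) _ _ (Sq t Ht)).
      intros n. unfold q. simpl pow. rewrite RtoC_mult. ring. }
    assert (S2 := Cser_minus _ _ _ _ (Cser_scal (RtoC m) _ _ (Sq t Ht)) S1).
    rewrite RtoC_minus. replace ((RtoC m - RtoC t) * qs t)%C with (RtoC m * qs t - RtoC t * qs t)%C by ring.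
    apply (Cser_unique _ _ _ S2). apply Cser_ext with (2 := Cser_scal b _ _ (Sp t Ht)).
    intros n. rewrite qE. field; auto. }
  (* Extended constantly outside [[0, 1]], so that the primitive [sol] has two-sided derivatives at
     0 and 1. *)
  set (qc := fun t => qs (clamp 0 1 t)).
  assert (R01 : forall t, 0 <= clamp 0 1 t <= 1) by (intros; apply clamp_range; lra).
  assert (cq : forall t, Ccont qc t).
  { apply (Ccont_series (fun n t => q n * RtoC (clamp 0 1 t ^ n))%C _ Q); auto.
    - intros k x. apply Ccont_scal, Ccont_RtoC.
      apply (continuous_comp (clamp 0 1) (fun t => t ^ k)); [apply clamp_cont|apply pow_cont]. }
  set (sol := fun t => (p 0%nat + CInt qc 0 t)%C).
  assert (RE : forall t, 0 <= t <= 1 -> sol t = ps t).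
  { intros t Ht. unfold sol.
    destruct (is_CInt_series_on (fun n s => q n * RtoC (s ^ n))%C qs Q 0 t) as [_ I]; try lra; auto.
    - intros k x _. apply Ccont_scal, Ccont_RtoC, pow_cont.
    - intros k x Hx. apply bound; auto; lra.
    - intros x Hx. apply Sq; lra.
    - replace (CInt qc 0 t) with (CInt qs 0 t).
      + symmetry. apply (Cser_unique _ _ _ (Sp t Ht)).
        replace (p 0%nat + CInt qs 0 t)%C with (CInt qs 0 t + p 0%nat * RtoC (t ^ 0))%C by (simpl; ring).
        apply (Cser_decr_1 (fun n => p n * RtoC (t ^ n))%C).
        apply Cser_ext with (2 := I). intros n. apply CInt_eq.
        replace (p (S n) * RtoC (t ^ S n))%C with (q n * (RtoC (t ^ S n / INR (S n) - 0 ^ S n / INR (S n))))%C.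
        * apply is_CInt_scal. apply is_CInt_re_im. split; simpl.
          -- apply is_RInt_pow.
          -- evar_last; [apply (@is_RInt_const R_NormedModule)|].
             change ((t - 0) * 0 = 0). ring.
        * unfold q. rewrite (pow_ne_zero (S n)) by lia.
          replace (t ^ S n / INR (S n) - 0 / INR (S n)) with (t ^ S n / INR (S n)) by (unfold Rdiv; ring).
          assert (A := INR_S_pos n). rewrite RtoC_div by lra. field. apply RtoC_INR_S_neq_0.
      + apply CInt_ext. rewrite Rmin_left, Rmax_right by lra. intros x Hx. unfold qc.
        rewrite clamp_id; auto; lra. }
  assert (DR : forall t, is_Cder sol t (qc t)).
  { intros t. rewrite <- (Cplus_0_l (qc t)). apply is_Cder_plus; [apply is_Cder_const|].
    apply (@is_derive_RInt C_R_NormedModule qc (fun y => CInt qc 0 y) 0 t); [|apply cq].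
    exists (mkposreal _ Rlt_0_1). intros s _. apply is_CInt_CInt; auto. }
  assert (I : is_CInt (fun _ => RtoC 0) 0 u (Rcpow (m - u) b * sol u - Rcpow (m - 0) b * sol 0)%C).
  { apply (is_CInt_derive (fun t => Rcpow (m - t) b * sol t)%C); rewrite Rmin_left, Rmax_right by lra.
    - intros t Ht.
      assert (D1 : is_Cder (fun t => Rcpow (m - t) b) t (RtoC (- (1)) * (b * Rcpow (m - t) (b - 1)))%C).
      { apply (is_Cder_comp (fun u => Rcpow u b) (fun s => m - s)); [apply is_Cder_Rcpow; lra|].
        apply is_derive_reflect. }
      assert (D := is_Cder_mult _ _ _ _ _ D1 (DR t)).
      match goal with |- is_Cder _ _ ?v => match type of D with is_Cder _ _ ?w => replace v with w; [exact D|] end end.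
      rewrite RE by lra. unfold qc. rewrite clamp_id by lra.
      replace (Rcpow (m - t) b) with (Rcpow (m - t) (b - 1) * RtoC (m - t))%C.
      + replace (Rcpow (m - t) (b - 1) * RtoC (m - t) * qs t)%C with (Rcpow (m - t) (b - 1) * (RtoC (m - t) * qs t))%C by ring.
        rewrite ode by lra. rewrite RtoC_opp. ring.
      + rewrite <- (Rcpow_1 (m - t)) by lra. rewrite <- Rcpow_add. f_equal; ring.
    - intros; apply Ccont_const. }
  assert (I0 : is_CInt (fun _ => RtoC 0) 0 u (RtoC 0)).
  { assert (Z := is_CInt_derive (fun _ => RtoC 0) (fun _ => RtoC 0) 0 u (fun x _ => is_Cder_const 0 x) (fun x _ => Ccont_const 0 x)).
    cbv beta in Z. replace (RtoC 0 - RtoC 0)%C with (RtoC 0) in Z by ring. exact Z. }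
  apply CInt_eq in I. apply CInt_eq in I0. rewrite I in I0.
  replace (Rcpow (m - u) (- b)) with (ps u); [apply Sp; auto|].
  rewrite <- RE by auto.
  assert (R0 : sol 0 = Rcpow m (- b)).
  { rewrite RE by lra. apply Csum_eq.
    replace (Rcpow m (- b)) with (p 0%nat * RtoC (0 ^ 0))%C.
    - apply (Cser_single (fun n => p n * RtoC (0 ^ n))%C). intros n. rewrite pow_ne_zero by lia. ring.
    - unfold p, binom_coef. simpl. rewrite Cplus_0_r. field. }
  rewrite R0, Rminus_0_r, Rcpow_opp in I0. rewrite Rcpow_opp.
  assert (N1 := Rcpow_neq_0 m b). assert (N2 := Rcpow_neq_0 (m - u) b).
  rewrite Cinv_r in I0 by auto.
  replace (sol u) with (/ Rcpow (m - u) b * (Rcpow (m - u) b * sol u - 1 + 1))%C by (field; auto).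
  rewrite I0. ring.
Qed.

End Incomplete.

(** * Decomposition of the beta integral over [[0, m]] *)

Section IncompleteBeta.
Local Open Scope R_scope.

Definition not_pos_int (a : C) : Prop := forall n : nat, a <> RtoC (INR (S n)).

Lemma not_pos_int_neq_0 (a : C) (n : nat) : not_pos_int a -> (RtoC (INR n) + 1 - a)%C <> 0.
Proof.
  intros H E. apply (H n). rewrite S_INR, RtoC_plus.
  replace a with (RtoC (INR n) + 1 - (RtoC (INR n) + 1 - a))%C by ring. rewrite E; ring.
Qed.

(** None of the denominators vanishes, and all but finitely many have modulus at least 1. *)
Lemma not_pos_int_dist (a : C) : not_pos_int a ->
  exists d, 0 < d <= 1 /\ forall n, d <= Cmod (RtoC (INR n) + 1 - a)%C.
Proof.
  intros H. destruct (INR_unbounded (Cmod a)) as [N HN].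
  assert (HL : forall n, (N <= n)%nat -> 1 <= Cmod (RtoC (INR n) + 1 - a)%C).
  { intros n Hn. apply le_INR in Hn.
    assert (T := Cmod_triangle (RtoC (INR n) + 1 - a) a).
    replace (RtoC (INR n) + 1 - a + a)%C with (RtoC (INR n + 1)) in T by (rewrite RtoC_plus; ring).
    rewrite Cmod_R, Rabs_pos_eq in T by (generalize (pos_INR n); lra). lra. }
  assert (G : forall L, exists d, 0 < d <= 1 /\ forall n, (n < L)%nat -> d <= Cmod (RtoC (INR n) + 1 - a)%C).
  { induction L as [|L [d [Hd IH]]]; [exists 1; split; [lra|intros; lia]|].
    assert (P : 0 < Cmod (RtoC (INR L) + 1 - a)%C) by (apply Cmod_gt_0, not_pos_int_neq_0; auto).
    exists (Rmin d (Cmod (RtoC (INR L) + 1 - a)%C)). split.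
    - split; [apply Rmin_pos; lra|]. eapply Rle_trans; [apply Rmin_l|lra].
    - intros n Hn. destruct (Nat.eq_dec n L) as [->|E]; [apply Rmin_r|].
      eapply Rle_trans; [apply Rmin_l|apply IH; lia]. }
  destruct (G N) as [d [Hd HG]]. exists d; split; auto.
  intros n. destruct (Nat.lt_ge_cases n N) as [L|L]; auto.
  eapply Rle_trans; [|apply HL; auto]. lra.
Qed.

Lemma not_pos_int_pred (a : C) : not_pos_int a -> not_pos_int (a - 1).
Proof.
  intros H n E. apply (H (S n)). rewrite (S_INR (S n)), RtoC_plus, <- E. ring.
Qed.

Lemma not_pos_int_reflect (a : C) : not_pos_int a -> not_nonpos_int (1 - a).
Proof.
  intros H n E. apply (H n). rewrite S_INR, RtoC_plus.
  replace a with (1 - (1 - a))%C by ring. rewrite E, RtoC_opp. ring.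
Qed.

Definition incomplete_term (m : R) (a b : C) (n : nat) : C :=
  (Cpochhammer b n / RtoC (INR (fact n)) * (Rcpow m (- (b + RtoC (INR n))) / (RtoC (INR n) + 1 - a)))%C.

(* The analytic continuation in [a] of [int_0^1 u^(-a) (m - u)^(-b) du]. *)
Definition incomplete (m : R) (a b : C) : C := Csum (incomplete_term m a b).

Lemma incomplete_term_eq (m : R) (a b : C) (n : nat) :
  incomplete_term m a b n = (binom_coef m b n / (RtoC (INR n) + 1 - a))%C.
Proof. unfold incomplete_term, binom_coef, Cdiv. ring. Qed.

Lemma incomplete_correct (m : R) (a b : C) : 2 <= m -> not_pos_int a ->
  Cser (fun n => binom_coef m b n / (RtoC (INR n) + 1 - a))%C (incomplete m a b).
Proof.
  intros Hm Ha. destruct (not_pos_int_dist a Ha) as [d [Hd HD]].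
  apply Cser_ext with (incomplete_term m a b); [intros; apply incomplete_term_eq|].
  apply Cser_Csum with (fun n => / d * (Rpower m (- Re b) * binom_bound (Cmod b + 1) n)).
  - intros n. rewrite incomplete_term_eq. unfold Cdiv. rewrite Cmod_mult, Cmod_inv by (apply not_pos_int_neq_0; auto).
    rewrite Rmult_comm. apply Rmult_le_compat; auto using Cmod_ge_0.
    + left. apply Rinv_0_lt_compat. specialize (HD n); lra.
    + apply Rinv_le_contravar; [lra|auto].
    + apply binom_coef_le; auto.
  - apply ex_series_Rscal, ex_series_Rscal, ex_series_binom_bound. generalize (Cmod_ge_0 b); lra.
Qed.

Lemma binomial_series_1 (m : R) (b : C) : 2 <= m -> Cser (binom_coef m b) (Rcpow (m - 1) (- b)).
Proof.
  intros Hm. apply Cser_ext with (2 := binomial_series m b 1 Hm ltac:(lra)).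
  intros n. rewrite pow1. ring.
Qed.

(** For [Re a < 0] the left side is the integral over [[0, 1]] of the derivative of
    [u^(1-a) (m-u)^(1-b)], and the right side is its value at [u = 1]. Reading the identity off the
    coefficients makes it valid for the continued function. *)
Lemma incomplete_step_l (m : R) (a b : C) : 2 <= m -> not_pos_int a ->
  ((1 - a) * RtoC m * incomplete m a b - (2 - a - b) * incomplete m (a - 1) b
    = RtoC (m - 1) * Rcpow (m - 1) (- b))%C.
Proof.
  intros Hm Ha.
  set (p := binom_coef m b). set (s := Rcpow (m - 1) (- b)).
  set (A := incomplete m a b). set (A' := incomplete m (a - 1) b).
  assert (S0 : Cser p s) by (apply binomial_series_1; auto).
  assert (SA := incomplete_correct m a b Hm Ha). fold p A in SA.
  assert (SA' := incomplete_correct m (a - 1) b Hm (not_pos_int_pred a Ha)). fold p A' in SA'.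
  assert (N := fun n => not_pos_int_neq_0 a n Ha).
  assert (N' := fun n => not_pos_int_neq_0 (a - 1) n (not_pos_int_pred a Ha)).
  (* Uses [n / (n+1-a) = 1 - (1-a) / (n+1-a)]. The same series with its index shifted is then
     computed a second time by [binom_coef_succ]. *)
  assert (S1 : Cser (fun n => RtoC (INR n) * p n / (RtoC (INR n) + 1 - a))%C (s - (1 - a) * A)%C).
  { apply Cser_ext with (2 := Cser_minus _ _ _ _ S0 (Cser_scal (1 - a) _ _ SA)).
    intros n. specialize (N n). field; auto. }
  assert (S2 : Cser (fun n => RtoC m * (RtoC (INR (S n)) * p (S n) / (RtoC (INR (S n)) + 1 - a)))%C
     (RtoC m * (s - (1 - a) * A))%C).
  { apply Cser_scal. replace (s - (1 - a) * A)%C with (s - (1 - a) * A - RtoC (INR 0) * p 0%nat / (RtoC (INR 0) + 1 - a))%C.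
    - apply (Cser_incr_1 (fun n => RtoC (INR n) * p n / (RtoC (INR n) + 1 - a))%C); auto.
    - simpl INR. unfold Cdiv. ring. }
  assert (S3 : Cser (fun n => RtoC m * (RtoC (INR (S n)) * p (S n) / (RtoC (INR (S n)) + 1 - a)))%C
     (s + (a + b - 2) * A')%C).
  { apply Cser_ext with (2 := Cser_plus _ _ _ _ S0 (Cser_scal (a + b - 2) _ _ SA')).
    intros n. specialize (N' n). specialize (N (S n)).
    replace (RtoC m * (RtoC (INR (S n)) * p (S n) / (RtoC (INR (S n)) + 1 - a)))%C with
     (RtoC m * (RtoC (INR (S n)) * p (S n)) / (RtoC (INR (S n)) + 1 - a))%C by (field; auto).
    unfold p. rewrite binom_coef_succ by lra.
    replace (RtoC (INR (S n)) + 1 - a)%C with (RtoC (INR n) + 1 - (a - 1))%C by (rewrite S_INR, RtoC_plus; ring).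
    field; auto. }
  assert (E := Cser_unique _ _ _ S2 S3). rewrite RtoC_minus.
  replace ((1 - a) * RtoC m * A - (2 - a - b) * A')%C with
    (RtoC m * s - RtoC m * (s - (1 - a) * A) - (2 - a - b) * A')%C by ring.
  rewrite E. ring.
Qed.

Lemma binom_coef_pred (m : R) (a : C) (n : nat) : 0 < m ->
  ((a - 1 + RtoC (INR n)) * binom_coef m (a - 1) n = (a - 1) * RtoC m * binom_coef m a n)%C.
Proof.
  intros Hm. unfold binom_coef.
  assert (E := Cpochhammer_succ_l (a - 1) n). simpl in E.
  replace (a - 1 + 1)%C with a in E by ring.
  replace (- (a - 1 + RtoC (INR n)))%C with (- (a + RtoC (INR n)) + 1)%C by ring.
  rewrite (Rcpow_add m _ 1), Rcpow_1 by auto.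
  assert (B := RtoC_fact_neq_0 n).
  replace ((a - 1 + RtoC (INR n)) * (Cpochhammer (a - 1) n / RtoC (INR (fact n)) * (Rcpow m (- (a + RtoC (INR n))) * RtoC m)))%C
   with (Cpochhammer (a - 1) n * (a - 1 + RtoC (INR n)) / RtoC (INR (fact n)) * (Rcpow m (- (a + RtoC (INR n))) * RtoC m))%C by (field; auto).
  rewrite E. field; auto.
Qed.

(** The same recurrence for the piece over [[m - 1, m]], where [a] is the exponent that is expanded;
    its boundary is at [u = m - 1], a lower end point, hence the sign. *)
Lemma incomplete_step_r (m : R) (a b : C) : 2 <= m -> not_pos_int b ->
  ((1 - a) * RtoC m * incomplete m b a - (2 - a - b) * incomplete m b (a - 1)
    = - Rcpow (m - 1) (1 - a))%C.
Proof.
  intros Hm Hb.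
  set (q := binom_coef m a). set (q' := binom_coef m (a - 1)). set (s := Rcpow (m - 1) (1 - a)).
  set (A := incomplete m b a). set (A' := incomplete m b (a - 1)).
  assert (S0 : Cser q' s).
  { unfold s. replace (1 - a)%C with (- (a - 1))%C by ring. apply binomial_series_1; auto. }
  assert (SA := incomplete_correct m b a Hm Hb). fold q A in SA.
  assert (SA' := incomplete_correct m b (a - 1) Hm Hb). fold q' A' in SA'.
  assert (N := fun n => not_pos_int_neq_0 b n Hb).
  assert (S1 := Cser_scal ((a - 1) * RtoC m) _ _ SA).
  assert (S2 : Cser (fun n => (a - 1) * RtoC m * (q n / (RtoC (INR n) + 1 - b)))%C (s + (a + b - 2) * A')%C).
  { apply Cser_ext with (2 := Cser_plus _ _ _ _ S0 (Cser_scal (a + b - 2) _ _ SA')).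
    intros n. specialize (N n).
    replace ((a - 1) * RtoC m * (q n / (RtoC (INR n) + 1 - b)))%C with
      ((a - 1) * RtoC m * q n / (RtoC (INR n) + 1 - b))%C by (field; auto).
    unfold q. rewrite <- binom_coef_pred by lra. fold q'. field; auto. }
  assert (E := Cser_unique _ _ _ S1 S2).
  replace ((1 - a) * RtoC m * A)%C with (- ((a - 1) * RtoC m * A))%C by ring. rewrite E. ring.
Qed.

Definition beta_mid (m : R) (a b : C) : C :=
  CInt (fun u => Rcpow u (- a) * Rcpow (m - u) (- b))%C 1 (m - 1).

Lemma Ccont_Rcpow_reflect (s : C) (c t : R) : 0 < c - t -> Ccont (fun t => Rcpow (c - t) s) t.
Proof.
  intros H. apply (Ccont_comp (fun u => Rcpow u s) (fun u => c - u)).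
  - apply Rcont_minus; [apply continuous_const|apply continuous_id].
  - apply Ccont_Rcpow; auto.
Qed.

Lemma is_CInt_beta_mid (m : R) (a b : C) : 2 <= m ->
  is_CInt (fun u => Rcpow u (- a) * Rcpow (m - u) (- b))%C 1 (m - 1) (beta_mid m a b).
Proof.
  intros Hm. apply is_CInt_CInt. rewrite Rmin_left, Rmax_right by lra. intros x Hx.
  apply Ccont_mult; [apply Ccont_Rcpow; lra|apply Ccont_Rcpow_reflect; lra].
Qed.

Lemma is_Cder_Rcpow_reflect (s : C) (c t : R) : 0 < c - t ->
  is_Cder (fun t => Rcpow (c - t) s) t (- (s * Rcpow (c - t) (s - 1)))%C.
Proof.
  intros H.
  assert (D := is_Cder_comp (fun u => Rcpow u s) (fun t => c - t) t _ _ (is_Cder_Rcpow s (c - t) H)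
    (is_derive_reflect c t)).
  rewrite RtoC_opp in D.
  replace (- (s * Rcpow (c - t) (s - 1)))%C with (- (1) * (s * Rcpow (c - t) (s - 1)))%C by ring.
  exact D.
Qed.

(** Integral of the derivative of [u^(1-a) (m-u)^(1-b)], with [(1-a) (m-u) - (1-b) u] rewritten as
    [(1-a) m - (2-a-b) u]. *)
Lemma beta_mid_step (m : R) (a b : C) : 2 <= m ->
  ((1 - a) * RtoC m * beta_mid m a b - (2 - a - b) * beta_mid m (a - 1) b
    = Rcpow (m - 1) (1 - a) - Rcpow (m - 1) (1 - b))%C.
Proof.
  intros Hm.
  assert (I : is_CInt (fun u => (1 - a) * RtoC m * (Rcpow u (- a) * Rcpow (m - u) (- b)) -
     (2 - a - b) * (Rcpow u (- (a - 1)) * Rcpow (m - u) (- b)))%C 1 (m - 1)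
     (Rcpow (m - 1) (1 - a) * Rcpow (m - (m - 1)) (1 - b) - Rcpow 1 (1 - a) * Rcpow (m - 1) (1 - b))%C).
  { apply (is_CInt_derive (fun u => Rcpow u (1 - a) * Rcpow (m - u) (1 - b))%C);
    rewrite Rmin_left, Rmax_right by lra; intros t Ht.
    - assert (D := is_Cder_mult _ _ _ _ _ (is_Cder_Rcpow (1 - a) t ltac:(lra))
         (is_Cder_Rcpow_reflect (1 - b) m t ltac:(lra))).
      match goal with |- is_Cder _ _ ?v => match type of D with is_Cder _ _ ?w => replace v with w; [exact D|] end end.
      replace (1 - a - 1)%C with (- a)%C by ring. replace (1 - b - 1)%C with (- b)%C by ring.
      replace (- (a - 1))%C with (- a + 1)%C by ring.
      replace (1 - a)%C with (- a + 1)%C by ring. replace (1 - b)%C with (- b + 1)%C by ring.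
      rewrite !Rcpow_add, !Rcpow_1 by lra. rewrite RtoC_minus. ring.
    - apply Ccont_minus; apply Ccont_scal; (apply Ccont_mult;
        [apply Ccont_Rcpow; lra|apply Ccont_Rcpow_reflect; lra]). }
  assert (I2 := is_CInt_minus _ _ _ _ _ _ (is_CInt_scal ((1 - a) * RtoC m) _ _ _ _ (is_CInt_beta_mid m a b Hm))
     (is_CInt_scal (2 - a - b) _ _ _ _ (is_CInt_beta_mid m (a - 1) b Hm))).
  apply CInt_eq in I. apply CInt_eq in I2. rewrite <- I2, I.
  replace (m - (m - 1)) with 1 by ring. rewrite !Rcpow_1_l. ring.
Qed.

Lemma is_CInt_reflect (f : R -> C) (m a b : R) (l : C) :
  is_CInt f (m - b) (m - a) l -> is_CInt (fun u => f (m - u)) a b l.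
Proof.
  intros H. unfold is_CInt in *.
  assert (S := @is_RInt_swap C_R_NormedModule _ _ _ _ H).
  assert (G := @is_RInt_comp_lin C_R_NormedModule f (-1) m a b (opp l)).
  replace (-1 * a + m) with (m - a) in G by ring. replace (-1 * b + m) with (m - b) in G by ring.
  specialize (G S). apply (@is_RInt_scal C_R_NormedModule _ _ _ (-1)) in G.
  replace l with (@scal R_AbsRing C_R_NormedModule (-1) (opp l)).
  - eapply (@is_RInt_ext C_R_NormedModule); [|exact G]. intros x _. simpl.
    replace (m - x) with (-1 * x + m) by ring. generalize (f (-1 * x + m)). intros [p q].
    change ((-1 * (-1 * p), -1 * (-1 * q)) = (p, q)). f_equal; ring.
  - destruct l as [p q]. change ((-1 * - p, -1 * - q) = (p, q)). f_equal; ring.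
Qed.

Lemma beta_mid_sym (m : R) (a b : C) : 2 <= m -> beta_mid m a b = beta_mid m b a.
Proof.
  intros Hm. apply CInt_eq.
  apply is_CInt_ext with (fun u => Rcpow (m - u) (- b) * Rcpow (m - (m - u)) (- a))%C.
  - intros u _. replace (m - (m - u)) with u by ring. ring.
  - apply (is_CInt_reflect (fun u => Rcpow u (- b) * Rcpow (m - u) (- a))%C m 1 (m - 1)).
    replace (m - (m - 1)) with 1 by ring. apply is_CInt_beta_mid; auto.
Qed.

(** Termwise integration of [binomial_series]: [u^(n-a)] contributes [1/(n+1-a)]. The condition
    [Re a < 0] makes the integrand continuous at 0. *)
Lemma incomplete_integral (m : R) (a b : C) : 2 <= m -> Re a < 0 ->
  is_CInt (fun u => Rcpow0 (- a) u * Rcpow0 (- b) (m - u))%C 0 1 (incomplete m a b).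
Proof.
  intros Hm Ha.
  assert (Hna : not_pos_int a).
  { intros n E. rewrite E in Ha. change (INR (S n) < 0) in Ha. generalize (pos_INR (S n)); lra. }
  assert (Ra : Re (- a)%C = - Re a) by (destruct a; auto).
  assert (Hb1 : forall x, 0 <= x <= 1 -> Cmod (Rcpow0 (- a) x) <= 1).
  { intros x Hx. destruct (Rle_dec x 0); [rewrite Rcpow0_neg, Cmod_0; lra|].
    rewrite Rcpow0_pos, Cmod_Rcpow, Ra by lra. unfold Rpower.
    apply Rle_trans with (exp 0); [|rewrite exp_0; lra].
    assert (L : - Re a * ln x <= 0).
    { assert (ln x <= 0) by (rewrite <- ln_1; apply ln_mono; lra). nra. }
    destruct L as [L|L]; [left; apply exp_increasing; auto|rewrite L; lra]. }
  destruct (is_CInt_series_on (fun n u => binom_coef m b n * Rcpow0 (- a + RtoC (INR n)) u)%C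
    (fun u => Rcpow0 (- a) u * Rcpow (m - u) (- b))%C
    (fun n => Rpower m (- Re b) * binom_bound (Cmod b + 1) n) 0 1) as [I1 I2]; try lra.
  - intros n x _. apply Ccont_scal, Rcpow0_cont.
    replace (Re (- a + RtoC (INR n))%C) with (- Re a + INR n) by (destruct a; auto). generalize (pos_INR n); lra.
  - intros n x Hx. rewrite Rcpow0_add_nat, !Cmod_mult, Cmod_R, Rabs_pos_eq by (apply pow_le; lra).
    rewrite <- (Rmult_1_r (Rpower _ _ * _)). apply Rmult_le_compat; auto using Cmod_ge_0.
    + apply Rmult_le_pos; [apply pow_le; lra|apply Cmod_ge_0].
    + apply binom_coef_le; auto.
    + rewrite <- (Rmult_1_r 1). apply Rmult_le_compat; auto using Cmod_ge_0; [apply pow_le; lra|].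
      rewrite <- (pow1 n). apply pow_incr; lra.
  - apply ex_series_Rscal, ex_series_binom_bound. generalize (Cmod_ge_0 b); lra.
  - intros x Hx. apply Cser_ext with (2 := Cser_scal (Rcpow0 (- a) x) _ _ (binomial_series m b x Hm Hx)).
    intros n. rewrite Rcpow0_add_nat. ring.
  - apply is_CInt_ext with (fun u => Rcpow0 (- a) u * Rcpow (m - u) (- b))%C.
    { rewrite Rmin_left, Rmax_right by lra. intros u Hu. rewrite (Rcpow0_pos _ (m - u)) by lra. auto. }
    replace (incomplete m a b) with (CInt (fun u => Rcpow0 (- a) u * Rcpow (m - u) (- b))%C 0 1); auto.
    apply (Cser_unique _ _ _ I2).
    apply Cser_ext with (2 := incomplete_correct m a b Hm Hna).
    intros n. symmetry. apply CInt_eq.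
    assert (N := not_pos_int_neq_0 a n Hna).
    set (s := (RtoC (INR n) + 1 - a)%C) in *.
    assert (Rs : 1 < Re s).
    { unfold s. replace (Re (RtoC (INR n) + 1 - a)%C) with (INR n + 1 - Re a) by (destruct a; auto).
      generalize (pos_INR n); lra. }
    assert (I : is_CInt (fun u => s * Rcpow0 (s - 1) u)%C 0 1 (Rcpow0 s 1 - Rcpow0 s 0)%C).
    { apply (is_CInt_derive (Rcpow0 s)); intros t _; [apply is_Cder_Rcpow0; auto|].
      apply Ccont_scal, Rcpow0_cont. rewrite Re_minus_1; lra. }
    apply (is_CInt_scal (binom_coef m b n / s)) in I.
    rewrite (Rcpow0_neg s 0), (Rcpow0_pos s 1), Rcpow_1_l in I by lra.
    replace (binom_coef m b n / s)%C with (binom_coef m b n / s * (1 - 0))%C by ring.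
    apply is_CInt_ext with (2 := I). intros x _.
    replace (- a + RtoC (INR n))%C with (s - 1)%C by (unfold s; ring). field; auto.
Qed.

Lemma beta_scaled (m : R) (a b : C) : 0 < m -> Re a < 0 -> Re b < 0 ->
  CInt (fun u => Rcpow0 (- a) u * Rcpow0 (- b) (m - u))%C 0 m =
  (Rcpow m (1 - a - b) * betaI (1 - a) (1 - b))%C.
Proof.
  intros Hm Ha Hb.
  assert (Ra : Re (- a)%C = - Re a) by (destruct a; auto).
  assert (Rb : Re (- b)%C = - Re b) by (destruct b; auto).
  assert (C0 : forall x, Ccont (fun u => Rcpow0 (- a) u * Rcpow0 (- b) (m - u))%C x).
  { intros x; apply Ccont_mult; [apply Rcpow0_cont; lra|apply Rcpow0_reflect_cont; lra]. }
  assert (I : is_CInt (fun u => Rcpow0 (- a) u * Rcpow0 (- b) (m - u))%C (m * 0 + 0) (m * 1 + 0)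
     (CInt (fun u => Rcpow0 (- a) u * Rcpow0 (- b) (m - u))%C 0 m)).
  { replace (m * 0 + 0) with 0 by ring. replace (m * 1 + 0) with m by ring. apply is_CInt_CInt; auto. }
  apply (@is_RInt_comp_lin C_R_NormedModule) in I.
  symmetry. apply (CInt_eq (fun y => scal m (Rcpow0 (- a) (m * y + 0) * Rcpow0 (- b) (m - (m * y + 0))))%C 0 1) in I.
  rewrite <- I. symmetry. apply CInt_eq.
  assert (J := is_CInt_betaI (1 - a) (1 - b)).
  replace (Re (1 - a)%C) with (1 - Re a) in J by (destruct a; auto).
  replace (Re (1 - b)%C) with (1 - Re b) in J by (destruct b; auto).
  specialize (J ltac:(lra) ltac:(lra)).
  apply (is_CInt_scal (Rcpow m (1 - a - b))) in J.
  apply is_CInt_ext with (2 := J). rewrite Rmin_left, Rmax_right by lra. intros x Hx.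
  replace (m - (m * x + 0)) with (m * (1 - x)) by ring. rewrite Rplus_0_r.
  assert (0 < m * x) by (apply Rmult_lt_0_compat; lra).
  assert (0 < m * (1 - x)) by (apply Rmult_lt_0_compat; lra).
  rewrite !Rcpow0_pos, !Rcpow_mult_base by lra.
  replace (1 - a - 1)%C with (- a)%C by ring. replace (1 - b - 1)%C with (- b)%C by ring.
  replace (1 - a - b)%C with (1 + - a + - b)%C by ring. rewrite !Rcpow_add, Rcpow_1 by lra.
  set (X := Rcpow m (- a)). set (Y := Rcpow x (- a)). set (Z := Rcpow m (- b)). set (W := Rcpow (1 - x) (- b)).
  transitivity (RtoC m * (X * Y * (Z * W)))%C; [ring|].
  generalize (X * Y * (Z * W))%C. intros [z1 z2].
  change ((RtoC m * (z1, z2))%C = (m * z1, m * z2)). unfold RtoC, Cmult; simpl. f_equal; ring.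
Qed.

Definition beta_decomp (m : R) (a b : C) : Prop :=
  (beta_mid m a b + incomplete m a b + incomplete m b a =
    Rcpow m (1 - a - b) * Cbeta (1 - a) (1 - b))%C.

(** The integral over [[0, m]] cut at 1 and [m - 1]; the last piece is the reflection of the first,
    with [a] and [b] exchanged. *)
Lemma beta_decomp_base (m : R) (a b : C) : 2 <= m -> Re a < 0 -> Re b < 0 -> beta_decomp m a b.
Proof.
  intros Hm Ha Hb. unfold beta_decomp.
  rewrite Cbeta_betaI.
  2:{ replace (Re (1 - a)%C) with (1 - Re a) by (destruct a; auto). lra. }
  2:{ replace (Re (1 - b)%C) with (1 - Re b) by (destruct b; auto). lra. }
  rewrite <- beta_scaled by (auto; lra). symmetry. apply CInt_eq.
  replace (beta_mid m a b + incomplete m a b + incomplete m b a)%C with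
    (incomplete m a b + (beta_mid m a b + incomplete m b a))%C by ring.
  apply (@is_RInt_Chasles C_R_NormedModule _ 0 1 m); [apply incomplete_integral; auto|].
  apply (@is_RInt_Chasles C_R_NormedModule _ 1 (m - 1) m).
  - apply is_CInt_ext with (2 := is_CInt_beta_mid m a b Hm). rewrite Rmin_left, Rmax_right by lra.
    intros x Hx. rewrite !Rcpow0_pos by lra. auto.
  - apply is_CInt_ext with (fun u => Rcpow0 (- b) (m - u) * Rcpow0 (- a) (m - (m - u)))%C.
    + intros u _. replace (m - (m - u)) with u by ring. ring.
    + apply (is_CInt_reflect (fun u => Rcpow0 (- b) u * Rcpow0 (- a) (m - u))%C m (m - 1) m).
      replace (m - m) with 0 by ring. replace (m - (m - 1)) with 1 by ring.
      apply incomplete_integral; auto.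
Qed.

(** All four terms obey the same recurrence in [a], and the boundary terms of the three pieces add
    up to 0. What remains is to divide by [(1 - a) m]. *)
Lemma beta_decomp_step (m : R) (a b : C) : 2 <= m -> not_pos_int a -> not_pos_int b ->
  beta_decomp m (a - 1) b -> beta_decomp m a b.
Proof.
  unfold beta_decomp. intros Hm Ha Hb IH.
  assert (m0 : RtoC m <> 0) by (apply RtoC_neq_0; lra).
  assert (a1 : (1 - a)%C <> 0).
  { replace (1 - a)%C with (RtoC (INR 0) + 1 - a)%C by (simpl; ring). apply not_pos_int_neq_0; auto. }
  assert (E1 := incomplete_step_l m a b Hm Ha).
  assert (E2 := incomplete_step_r m a b Hm Hb).
  assert (E3 := beta_mid_step m a b Hm).
  assert (E4 := Cbeta_succ (1 - a) (1 - b) (not_pos_int_reflect a Ha) (not_pos_int_reflect b Hb)).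
  replace (1 - a + 1)%C with (1 - (a - 1))%C in E4 by ring.
  replace (Rcpow m (1 - (a - 1) - b)) with (RtoC m * Rcpow m (1 - a - b))%C in IH.
  2:{ rewrite <- (Rcpow_1 m) at 1 by lra. rewrite <- Rcpow_add. f_equal; ring. }
  replace (RtoC (m - 1) * Rcpow (m - 1) (- b))%C with (Rcpow (m - 1) (1 - b)) in E1.
  2:{ rewrite <- (Rcpow_1 (m - 1)) by lra. rewrite <- Rcpow_add. f_equal; ring. }
  set (K := beta_mid m a b) in *. set (K' := beta_mid m (a - 1) b) in *.
  set (G := incomplete m a b) in *. set (G' := incomplete m (a - 1) b) in *.
  set (H := incomplete m b a) in *. set (H' := incomplete m b (a - 1)) in *.
  set (B := Cbeta (1 - a) (1 - b)) in *. set (B' := Cbeta (1 - (a - 1)) (1 - b)) in *.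
  set (p := Rcpow m (1 - a - b)) in *.
  set (x1 := Rcpow (m - 1) (1 - a)) in *. set (x2 := Rcpow (m - 1) (1 - b)) in *.
  clearbody K K' G G' H H' B B' p x1 x2.
  assert (F : ((1 - a) * RtoC m * (K + G + H) = (1 - a) * RtoC m * (p * B))%C).
  { replace ((1 - a) * RtoC m * (K + G + H))%C with
     (((1 - a) * RtoC m * K - (2 - a - b) * K') + ((1 - a) * RtoC m * G - (2 - a - b) * G')
      + ((1 - a) * RtoC m * H - (2 - a - b) * H') + (2 - a - b) * (K' + G' + H'))%C by ring.
    rewrite E1, E2, E3, IH.
    replace ((1 - a) * RtoC m * (p * B))%C with (RtoC m * p * ((1 - a) * B))%C by ring.
    rewrite E4. ring. }
  replace (K + G + H)%C with (/ ((1 - a) * RtoC m) * ((1 - a) * RtoC m * (K + G + H)))%C by (field; auto).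
  rewrite F. field; auto.
Qed.

Lemma beta_decomp_sym (m : R) (a b : C) : 2 <= m -> beta_decomp m a b -> beta_decomp m b a.
Proof.
  unfold beta_decomp. intros Hm H. rewrite beta_mid_sym, Cbeta_sym by auto.
  replace (1 - b - a)%C with (1 - a - b)%C by ring. rewrite <- H. ring.
Qed.

(** [k] steps bring the real part of the first exponent below 0; [beta_decomposition] then treats
    the second exponent by symmetry. *)
Lemma beta_decomp_half (m : R) (k : nat) : forall a b : C, 2 <= m -> not_pos_int a -> not_pos_int b ->
  Re a < INR k -> (forall a', not_pos_int a' -> Re a' < 0 -> beta_decomp m a' b) -> beta_decomp m a b.
Proof.
  induction k; intros a b Hm Ha Hb Hk H0; [apply H0; auto|].
  apply beta_decomp_step; auto. apply IHk; auto using not_pos_int_pred.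
  rewrite S_INR in Hk. rewrite Re_minus_1; lra.
Qed.

Lemma beta_decomposition (m : R) (a b : C) : 2 <= m -> not_pos_int a -> not_pos_int b -> beta_decomp m a b.
Proof.
  intros Hm Ha Hb. destruct (INR_unbounded (Re a)) as [k Hk]. destruct (INR_unbounded (Re b)) as [l Hl].
  apply (beta_decomp_half m k); auto. intros a' Ha' Ra'.
  apply beta_decomp_sym; auto. apply (beta_decomp_half m l); auto.
  intros b' Hb' Rb'. apply beta_decomp_base; auto.
Qed.

End IncompleteBeta.

(** * The expansion *)

Section Convergent.
Local Open Scope R_scope.

(** Delaying row [j] by [j] places turns the antidiagonals of a double sequence into columns. *)
Definition shift_seq (j : nat) (u : nat -> C) (n : nat) : C := if Nat.leb j n then u (n - j)%nat else 0.

Lemma Cser_shift_seq (j : nat) (u : nat -> C) (l : C) : Cser u l -> Cser (shift_seq j u) l.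
Proof.
  intros H; induction j.
  - apply Cser_ext with (2 := H). intros n. unfold shift_seq. simpl. rewrite Nat.sub_0_r; auto.
  - replace l with (l + shift_seq (S j) u 0)%C by (unfold shift_seq; simpl; ring).
    apply (Cser_decr_1 (shift_seq (S j) u)). exact IHj.
Qed.

Lemma sum_shift_seq_le (j : nat) (u : nat -> C) (B : R) : 0 <= B ->
  (forall N, sum_n (fun n => Cmod (u n)) N <= B) ->
  forall N, sum_n (fun n => Cmod (shift_seq j u n)) N <= B.
Proof.
  intros HB H; induction j; intros N.
  - rewrite (sum_n_ext _ (fun n => Cmod (u n))); auto.
    intros n. unfold shift_seq. simpl. rewrite Nat.sub_0_r; auto.
  - destruct N.
    + rewrite sum_O. unfold shift_seq; simpl. rewrite Cmod_0; auto.
    + assert (E : sum_n (fun n => Cmod (shift_seq (S j) u n)) (S N) = sum_n (fun n => Cmod (shift_seq j u n)) N).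
      { clear. induction N.
        - rewrite sum_Sn, !sum_O. unfold plus; simpl. unfold shift_seq at 1. simpl. rewrite Cmod_0, Rplus_0_l. auto.
        - rewrite sum_Sn, IHN, sum_Sn. auto. }
      rewrite E; auto.
Qed.

Lemma Cser_finite (u : nat -> C) (n : nat) : (forall k, (n < k)%nat -> u k = 0) ->
  Cser u (@sum_n C_AbelianMonoid u n).
Proof.
  intros H. apply Cser_Clim. apply (Clim_shift _ _ n).
  apply Clim_ext with (fun _ => @sum_n C_AbelianMonoid u n); [|apply Clim_const].
  induction n0 as [|k IH]; [auto|]. simpl plus. change (S k + n)%nat with (S (k + n)).
  rewrite sum_Sn, <- IH, H by lia. symmetry. exact (Cplus_0_r _).
Qed.

(** After the delay [Cser_Fubini] applies, and column [n] is a finite sum, namely the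
    antidiagonal. *)
Lemma Cser_convolution (c : nat -> nat -> C) (A B : nat -> R) (row : nat -> C) (l : C) :
  (forall j k, Cmod (c j k) <= A j * B k) -> (forall j, 0 <= A j) -> (forall k, 0 <= B k) ->
  ex_series A -> ex_series B ->
  (forall j, Cser (c j) (row j)) -> Cser row l ->
  Cser (fun n => @sum_n C_AbelianMonoid (fun j => c j (n - j)%nat) n) l.
Proof.
  intros Hc HA HB EA EB Hrow Hl.
  assert (B0 : 0 <= Series B).
  { apply Rle_trans with (sum_n B 0); [rewrite sum_O; auto|apply Series_partial_le; auto]. }
  apply (Cser_Fubini (fun j n => shift_seq j (c j) n) (fun j => A j * Series B) row); auto.
  - intros j N. apply sum_shift_seq_le; [apply Rmult_le_pos; auto|].
    intros N'. apply Rle_trans with (sum_n (fun k => A j * B k) N').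
    + apply sum_n_m_le. auto.
    + rewrite (sum_n_mult_l (K := R_Ring)). apply Rmult_le_compat_l; auto. apply Series_partial_le; auto.
  - destruct EA as [s Hs]. exists (s * Series B). apply is_series_scal_r; auto.
  - intros j; apply Cser_shift_seq; auto.
  - intros n. replace (@sum_n C_AbelianMonoid (fun j => c j (n - j)%nat) n) with
      (@sum_n C_AbelianMonoid (fun j => shift_seq j (c j) n) n).
    + apply Cser_finite. intros k Hk. unfold shift_seq.
      destruct (Nat.leb_spec k n); [lia|auto].
    + apply sum_n_ext_loc. intros j Hj. unfold shift_seq. destruct (Nat.leb_spec j n); [auto|lia].
Qed.

(** One product of terms from the two Dirichlet series. With [u = j + 1 + x] and [m = j + k + 3] it
    is the integral of [u^(-a) (m-u)^(-b)] over [[j + 1, j + 2]]. *)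
Definition cell (a b : C) (j k : nat) : C :=
  CInt (fun x => Rcpow (INR j + (x + 1)) (- a) * Rcpow (INR k + (1 - x + 1)) (- b))%C 0 1.

Lemma is_CInt_shift (f : R -> C) (v a b : R) (l : C) :
  is_CInt f (a + v) (b + v) l -> is_CInt (fun x => f (x + v)) a b l.
Proof.
  intros H.
  assert (G := @is_RInt_comp_lin C_R_NormedModule f 1 v a b l).
  rewrite !Rmult_1_l in G. specialize (G H).
  apply is_CInt_ext with (2 := G). intros x _. rewrite Rmult_1_l.
  generalize (f (x + v)). intros [p q]. change ((1 * p, 1 * q) = (p, q)). f_equal; ring.
Qed.

Lemma is_CInt_unshift (f : R -> C) (v a b : R) (l : C) :
  is_CInt (fun x => f (x + v)) a b l -> is_CInt f (a + v) (b + v) l.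
Proof.
  intros H. apply is_CInt_ext with (fun x => f (x + - v + v)).
  - intros; f_equal; ring.
  - apply (is_CInt_shift (fun x => f (x + v)) (- v)).
    replace (a + v + - v) with a by ring. replace (b + v + - v) with b by ring. exact H.
Qed.

Lemma is_CInt_cell (a b : C) (j k : nat) :
  is_CInt (fun x => Rcpow (INR j + (x + 1)) (- a) * Rcpow (INR k + (1 - x + 1)) (- b))%C 0 1 (cell a b j k).
Proof.
  apply is_CInt_CInt. rewrite Rmin_left, Rmax_right by lra. intros x Hx.
  assert (P := pos_INR j). assert (Q := pos_INR k).
  apply Ccont_mult.
  - apply (Ccont_comp (fun u => Rcpow u (- a)) (fun x => INR j + (x + 1))).
    + apply Rcont_plus; [apply continuous_const|apply Rcont_plus; [apply continuous_id|apply continuous_const]].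
    + apply Ccont_Rcpow; lra.
  - apply (Ccont_comp (fun u => Rcpow u (- b)) (fun x => INR k + (1 - x + 1))).
    + apply Rcont_plus; [apply continuous_const|].
      apply Rcont_plus; [apply Rcont_minus|]; auto using continuous_id, continuous_const.
    + apply Ccont_Rcpow; lra.
Qed.

(** The cells with [j + k = n] share [m = n + 3], and their intervals tile [[1, m - 1]]. *)
Lemma beta_mid_cells (a b : C) (n : nat) :
  beta_mid (INR (S n) + 2) a b = @sum_n C_AbelianMonoid (fun j => cell a b j (n - j)) n.
Proof.
  apply CInt_eq.
  assert (G : forall N, (N <= n)%nat -> is_CInt (fun u => Rcpow u (- a) * Rcpow (INR (S n) + 2 - u) (- b))%C
     1 (INR N + 2) (@sum_n C_AbelianMonoid (fun j => cell a b j (n - j)) N)).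
  { assert (St : forall j, (j <= n)%nat -> is_CInt (fun u => Rcpow u (- a) * Rcpow (INR (S n) + 2 - u) (- b))%C
      (INR j + 1) (INR j + 2) (cell a b j (n - j))).
    { intros j Hj. replace (INR j + 1) with (0 + (INR j + 1)) by ring.
      replace (INR j + 2) with (1 + (INR j + 1)) by ring.
      apply is_CInt_unshift. apply is_CInt_ext with (2 := is_CInt_cell a b j (n - j)).
      intros x _. f_equal; f_equal; [ring|]. rewrite minus_INR, S_INR by auto. ring. }
    induction N; intros HN.
    - rewrite sum_O. specialize (St O HN). change (INR 0) with 0 in *. rewrite !Rplus_0_l in *. exact St.
    - rewrite sum_Sn. apply (@is_RInt_Chasles C_R_NormedModule _ 1 (INR N + 2)); [apply IHN; lia|].
      specialize (St (S N) HN). replace (INR N + 2) with (INR (S N) + 1) by (rewrite S_INR; ring). exact St. }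
  replace (INR (S n) + 2 - 1) with (INR n + 2) by (rewrite S_INR; ring). apply G; auto.
Qed.

(** The product of the two series is integrated termwise, first in [j] with the second factor [G]
    kept whole, then in [k]; the resulting double series is summed along antidiagonals. *)
Lemma J_beta_mid_series (a b : C) : 1 < Re a -> 1 < Re b ->
  Cser (fun n => beta_mid (INR n + 2) a b) (J a b).
Proof.
  intros Ha Hb.
  assert (a1 : a <> 1) by (intros E; rewrite E in Ha; simpl in Ha; lra).
  assert (b1 : b <> 1) by (intros E; rewrite E in Hb; simpl in Hb; lra).
  set (A := fun j => Rpower (INR (S j)) (- Re a)). set (B := fun k => Rpower (INR (S k)) (- Re b)).
  assert (EA : ex_series A) by (apply ex_series_Riemann; auto).
  assert (EB : ex_series B) by (apply ex_series_Riemann; auto).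
  set (f := fun (j : nat) x => Rcpow (INR j + (x + 1)) (- a)).
  set (g := fun (k : nat) x => Rcpow (INR k + (1 - x + 1)) (- b)).
  set (G := fun x => (Phi_right b x / (b - 1))%C).
  assert (Hf : forall j x, 0 <= x <= 1 -> Cmod (f j x) <= A j).
  { intros; apply hurwitz_term_bound; lra. }
  assert (Hg : forall k x, 0 <= x <= 1 -> Cmod (g k x) <= B k).
  { intros; apply hurwitz_term_bound; lra. }
  assert (cf : forall j x, 0 <= x <= 1 -> Ccont (f j) x).
  { intros j x Hx. apply (Ccont_comp (fun u => Rcpow u (- a)) (fun x => INR j + (x + 1))).
    + apply Rcont_plus; [apply continuous_const|apply Rcont_plus; [apply continuous_id|apply continuous_const]].
    + apply Ccont_Rcpow. generalize (pos_INR j); lra. }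
  assert (cg : forall k x, 0 <= x <= 1 -> Ccont (g k) x).
  { intros k x Hx. apply (Ccont_comp (fun u => Rcpow u (- b)) (fun x => INR k + (1 - x + 1))).
    + apply Rcont_plus; [apply continuous_const|].
      apply Rcont_plus; [apply Rcont_minus|]; auto using continuous_id, continuous_const.
    + apply Ccont_Rcpow. generalize (pos_INR k); lra. }
  assert (Sg : forall x, 0 <= x <= 1 -> Cser (fun k => g k x) (G x)).
  { intros x Hx. unfold G. rewrite <- zeta1_right by auto. unfold zeta1.
    rewrite hurwitz_zeta_series by (auto; lra). apply hurwitz_sum_correct; lra. }
  assert (Sf : forall x, 0 <= x <= 1 -> Cser (fun j => f j x) (zeta1 a x)).
  { intros x Hx. unfold zeta1. rewrite hurwitz_zeta_series by (auto; lra). apply hurwitz_sum_correct; lra. }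
  assert (GB : forall x, 0 <= x <= 1 -> Cmod (G x) <= Series B).
  { intros x Hx. apply (Cser_Cmod_le_Series _ B _ (Sg x Hx)); auto. }
  assert (PA : forall j, 0 <= A j) by (intros; left; apply Rpower_pos).
  assert (PB : forall j, 0 <= B j) by (intros; left; apply Rpower_pos).
  set (row := fun j => CInt (fun x => f j x * G x)%C 0 1).
  assert (S1 : Cser row (J a b)).
  { destruct (is_CInt_series_on (fun j x => f j x * G x)%C (J_integrand a b) (fun j => A j * Series B) 0 1) as [_ I].
    - lra.
    - intros j x Hx. apply Ccont_mult; auto. apply Ccont_mult; [apply Phi_right_cont|apply Ccont_const].
    - intros j x Hx. rewrite Cmod_mult. apply Rmult_le_compat; auto using Cmod_ge_0.
    - destruct EA as [s Hs]. exists (s * Series B). apply is_series_scal_r; auto.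
    - intros x Hx. unfold J_integrand. rewrite zeta1_right by auto. fold (G x).
      rewrite Cmult_comm. apply Cser_ext with (fun j => G x * f j x)%C; [intros; ring|].
      apply Cser_scal; auto.
    - exact I. }
  assert (S2 : forall j, Cser (cell a b j) (row j)).
  { intros j.
    destruct (is_CInt_series_on (fun k x => f j x * g k x)%C (fun x => f j x * G x)%C (fun k => A j * B k) 0 1) as [_ I].
    - lra.
    - intros k x Hx. apply Ccont_mult; auto.
    - intros k x Hx. rewrite Cmod_mult. apply Rmult_le_compat; auto using Cmod_ge_0.
    - apply ex_series_Rscal; auto.
    - intros x Hx. apply Cser_scal; auto.
    - exact I. }
  assert (S3 := Cser_convolution (cell a b) A B row (J a b)).
  (* The term for [m = 2] is an integral over a point; including it aligns the index with the sum
     over [m >= 2] in [zeta_minus_1_series]. *)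
  replace (J a b) with (J a b + beta_mid (INR 0 + 2) a b)%C.
  - apply (Cser_decr_1 (fun n => beta_mid (INR n + 2) a b)).
    apply Cser_ext with (fun n => @sum_n C_AbelianMonoid (fun j => cell a b j (n - j)%nat) n).
    + intros n. symmetry; apply beta_mid_cells.
    + apply S3; auto. intros j k.
      replace (A j * B k) with ((1 - 0) * (A j * B k)) by ring.
      apply (is_CInt_Cmod_le_const (fun x => f j x * g k x)%C 0 1); [lra| |apply is_CInt_cell].
      intros x Hx. rewrite Cmod_mult. apply Rmult_le_compat; auto using Cmod_ge_0.
  - replace (beta_mid (INR 0 + 2) a b) with (RtoC 0); [ring|]. symmetry. apply CInt_eq.
    simpl INR. replace (0 + 2 - 1) with 1 by ring. apply (@is_RInt_point C_R_NormedModule).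
Qed.

Lemma zeta_minus_1_series (s : C) : 1 < Re s ->
  Cser (fun n => Rcpow (INR n + 2) (- s)) (riemann_zeta s - 1)%C.
Proof.
  intros Hs. unfold riemann_zeta. rewrite hurwitz_zeta_series by (auto; lra).
  assert (H := hurwitz_sum_correct s 1 Hs (Rle_refl 1)). apply Cser_incr_1 in H.
  change (INR 0) with 0 in H. rewrite Rplus_0_l, Rcpow_1_l in H.
  apply Cser_ext with (2 := H). intros n. f_equal. rewrite S_INR. ring.
Qed.

(** Exchange of the sum over [m] with the binomial sum: [m] enters only through [m^(-b-k)], which
    sums to [zeta(b+k) - 1]. The factor [2^(-k)] gained from [m >= 2] makes the double series
    absolutely convergent. *)
Lemma incomplete_sum (a b : C) : not_pos_int a -> 1 < Re b ->
  exists s, Cser (fun n => incomplete (INR n + 2) a b) s /\ Cser (J_series_term b a) s.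
Proof.
  intros Ha Hb. destruct (not_pos_int_dist a Ha) as [d [Hd HD]].
  set (B := Cmod b + 1). assert (HB : 0 < B) by (unfold B; generalize (Cmod_ge_0 b); lra).
  assert (Eb := ex_series_binom_bound B HB).
  set (M := fun n => / d * Series (binom_bound B) * Rpower (INR (S n)) (- Re b)).
  assert (EM : ex_series M) by (apply ex_series_Rscal, ex_series_Riemann; auto).
  assert (P2 : forall n, 2 <= INR n + 2) by (intros n; generalize (pos_INR n); lra).
  assert (Id : 0 < / d) by (apply Rinv_0_lt_compat; lra).
  assert (HT : forall n k, Cmod (incomplete_term (INR n + 2) a b k) <=
     / d * Rpower (INR (S n)) (- Re b) * binom_bound B k).
  { intros n k. rewrite incomplete_term_eq. unfold Cdiv.
    rewrite Cmod_mult, Cmod_inv by (apply not_pos_int_neq_0; auto).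
    apply Rle_trans with (Rpower (INR n + 2) (- Re b) * binom_bound B k * / d).
    - apply Rmult_le_compat; auto using Cmod_ge_0.
      + left. apply Rinv_0_lt_compat. specialize (HD k); lra.
      + apply binom_coef_le; auto.
      + apply Rinv_le_contravar; [lra|auto].
    - rewrite (Rmult_comm _ (/ d)), Rmult_assoc. apply Rmult_le_compat_l; [lra|].
      apply Rmult_le_compat_r; [left; apply binom_bound_pos; auto|].
      apply Rpower_anti; [lra|]. rewrite S_INR. generalize (pos_INR n); lra. }
  assert (HM : forall n N, sum_n (fun k => Cmod (incomplete_term (INR n + 2) a b k)) N <= M n).
  { intros n N. apply Rle_trans with (sum_n (fun k => / d * Rpower (INR (S n)) (- Re b) * binom_bound B k) N).
    - apply sum_n_m_le. auto.
    - rewrite (sum_n_mult_l (K := R_Ring)). unfold M.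
      replace (/ d * Series (binom_bound B) * Rpower (INR (S n)) (- Re b)) with
        (/ d * Rpower (INR (S n)) (- Re b) * Series (binom_bound B)) by ring.
      apply Rmult_le_compat_l.
      + apply Rmult_le_pos; [lra|left; apply Rpower_pos].
      + apply Series_partial_le; auto. intros; left; apply binom_bound_pos; auto. }
  assert (Hrow : forall n, Cser (incomplete_term (INR n + 2) a b) (incomplete (INR n + 2) a b)).
  { intros n. apply Cser_ext with (2 := incomplete_correct _ _ _ (P2 n) Ha).
    intros k; symmetry; apply incomplete_term_eq. }
  assert (S1 : Cser (fun n => incomplete (INR n + 2) a b) (Csum (fun n => incomplete (INR n + 2) a b))).
  { apply Cser_Csum with M; auto. intros n. apply (Cser_Cmod_le _ _ _ _ (Hrow n) (fun k => Rle_refl _) (HM n)). }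
  exists (Csum (fun n => incomplete (INR n + 2) a b)). split; auto.
  apply (Cser_Fubini (fun n k => incomplete_term (INR n + 2) a b k) M (fun n => incomplete (INR n + 2) a b)); auto.
  intros k. unfold J_series_term.
  assert (Z : Cser (fun n => Rcpow (INR n + 2) (- (b + RtoC (INR k)))) (riemann_zeta (b + RtoC (INR k)) - 1)%C).
  { apply zeta_minus_1_series. replace (Re (b + RtoC (INR k))%C) with (Re b + INR k) by (destruct b; auto).
    generalize (pos_INR k); lra. }
  assert (N := not_pos_int_neq_0 a k Ha).
  replace (Cpochhammer b k / INR (fact k) * ((riemann_zeta (b + INR k) - 1) / (INR k + 1 - a)))%C with
    (Cpochhammer b k / INR (fact k) / (INR k + 1 - a) * (riemann_zeta (b + INR k) - 1))%C by (unfold Cdiv; ring).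
  apply Cser_ext with (2 := Cser_scal _ _ _ Z). intros n. unfold incomplete_term, Cdiv. ring.
Qed.

(** [beta_decomposition] is solved for the middle integral and summed over [m = n + 2]. *)
Lemma J_expansion_convergent (a b : C) : 1 < Re a -> 1 < Re b -> not_pos_int a -> not_pos_int b ->
  J_expansion a b.
Proof.
  intros Ha Hb Na Nb.
  destruct (incomplete_sum a b Na Hb) as [s2 [I2 T2]].
  destruct (incomplete_sum b a Nb Ha) as [s1 [I1 T1]].
  exists s1, s2. split; [exact T1|split; [exact T2|]].
  assert (S0 := J_beta_mid_series a b Ha Hb).
  assert (Z : Cser (fun n => Rcpow (INR n + 2) (- (a + b - 1))) (riemann_zeta (a + b - 1) - 1)%C).
  { apply zeta_minus_1_series. replace (Re (a + b - 1)%C) with (Re a + Re b - 1) by (destruct a, b; auto). lra. }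
  apply (Cser_unique _ _ _ S0).
  apply Cser_ext with (2 := Cser_minus _ _ _ _ (Cser_minus _ _ _ _ (Cser_scal (Cbeta (1 - a) (1 - b)) _ _ Z) I1) I2).
  intros n. assert (D := beta_decomposition (INR n + 2) a b ltac:(generalize (pos_INR n); lra) Na Nb).
  unfold beta_decomp in D. replace (- (a + b - 1))%C with (1 - a - b)%C by ring.
  rewrite (Cmult_comm (Cbeta _ _)), <- D. ring.
Qed.

End Convergent.

(** * Continuation of the expansion to the strip *)

Section Continuation.
Local Open Scope R_scope.

Lemma fam_poch (r : R) (b0 u : C) (n : nat) : 0 < r ->
  fam r (Rpoch (Cmod b0 + Cmod u * r) n) (fun _ w => Cpochhammer (b0 + u * w) n).
Proof.
  intros Hr. induction n; simpl.
  - apply fam_const; intros; [apply Ccont_const|rewrite Cmod_1; lra].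
  - apply fam_mult; auto. apply fam_plus; [apply fam_affine; auto|].
    apply fam_const; intros; [apply Ccont_const|rewrite Cmod_R, Rabs_pos_eq by apply pos_INR; lra].
Qed.

(** Common shape of two series: [W n = 2^(-b-n)] gives [incomplete_term 2 a b], and
    [W n = zeta(b+n) - 1] gives [J_series_term b a]. *)
Definition poch_term (W : nat -> C) (a b : C) (n : nat) : C :=
  (Cpochhammer b n / RtoC (INR (fact n)) * (W n / (RtoC (INR n) + 1 - a)))%C.

(** The decay [2^(-n)] of the weights is what [binom_bound] contains, so the norms are summable; [d]
    keeps the denominators away from 0 on the disc. *)
Lemma fam_poch_series (r K d : R) (a0 b0 u : C) (W : nat -> C -> C) : 0 < r -> 0 < d ->
  (forall n, d <= Cmod (RtoC (INR n) + 1 - a0)%C) -> 2 * Cmod u * r <= d -> 0 < Cmod b0 ->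
  (forall n, fam r (K * (1 / 2) ^ n) (fun _ w => W n w)) ->
  (forall w, Cmod w <= r -> Cser (poch_term (fun n => W n w) (a0 + u * w) (b0 + u * w))
     (Csum (poch_term (fun n => W n w) (a0 + u * w) (b0 + u * w)))) /\
  exists M, fam r M (fun _ w => Csum (poch_term (fun n => W n w) (a0 + u * w) (b0 + u * w))).
Proof.
  intros Hr Hd HD Hu Hb HW.
  set (B := Cmod b0 + Cmod u * r).
  assert (HB : 0 < B) by (unfold B; assert (0 <= Cmod u * r) by (apply Rmult_le_pos; [apply Cmod_ge_0|lra]); lra).
  set (M := fun n => K * (2 / d) * binom_bound B n).
  assert (HF : forall n, fam r (M n) (fun _ w => poch_term (fun n => W n w) (a0 + u * w) (b0 + u * w) n)).
  { intros n. unfold poch_term, M, binom_bound.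
    replace (K * (2 / d) * (Rpoch B n / INR (fact n) * (1 / 2) ^ n)) with
      ((Rpoch B n * / INR (fact n)) * (K * (1/2) ^ n * (2 / d))) by (unfold Rdiv; ring).
    unfold Cdiv at 1. apply fam_mult; auto.
    - apply fam_mult; auto; [apply fam_poch; auto|].
      apply fam_const; intros; [apply Ccont_const|].
      rewrite Cmod_inv, Cmod_fact by apply RtoC_fact_neq_0. lra.
    - unfold Cdiv. apply fam_mult; auto.
      apply fam_ext with (fun (_ : R) w => / ((RtoC (INR n) + 1 - a0) + (- u) * w))%C.
      + intros _ w _. f_equal. ring.
      + apply fam_inv_affine; auto. rewrite Cmod_opp. auto. }
  assert (EM : ex_series M) by (apply ex_series_Rscal, ex_series_binom_bound; auto).
  assert (S : forall w, Cmod w <= r -> Cser (poch_term (fun n => W n w) (a0 + u * w) (b0 + u * w))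
     (Csum (poch_term (fun n => W n w) (a0 + u * w) (b0 + u * w)))).
  { intros w Hw. apply Cser_Csum with M; auto. intros n. apply (fam_bound r _ _ 0 w Hr (HF n) Hw). }
  split; auto. exists (Series M).
  apply fam_series with (fun n (_ : R) w => poch_term (fun n => W n w) (a0 + u * w) (b0 + u * w) n); auto.
Qed.

Lemma fam_two_pow (r : R) (b0 u : C) (n : nat) : 0 < r ->
  fam r (Rpower 2 (- Re b0) * exp (Cmod u * ln 2 * r) * (1 / 2) ^ n)
    (fun _ w => Rcpow 2 (- (b0 + u * w + RtoC (INR n)))).
Proof.
  intros Hr.
  apply fam_ext with (fun (_ : R) w => Rcpow 2 (- (b0 + RtoC (INR n)) + (- u) * w)).
  { intros _ w _. f_equal; ring. }
  replace (Rpower 2 (- Re b0) * exp (Cmod u * ln 2 * r) * (1 / 2) ^ n) with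
    (Rpower 2 (- Re b0) * (1 / 2) ^ n * exp (Cmod (- u)%C * ln 2 * r)) by (rewrite Cmod_opp; ring).
  apply (fam_Rcpow r _ (ln 2) (fun _ => 2)); auto.
  - intros; lra.
  - intros; apply continuous_const.
  - intros _. rewrite <- Cmod_Rcpow. apply Cmod_Rcpow_shift_le; lra.
  - intros _. rewrite Rabs_pos_eq; [lra|apply ln_nonneg; lra].
Qed.

Lemma fam_riemann_zeta (r : R) (s0 u : C) : 0 < r -> s0 <> 1 -> 2 * Cmod u * r <= Cmod (s0 - 1)%C ->
  exists M, fam r M (fun _ w => riemann_zeta (s0 + u * w) - 1)%C.
Proof.
  intros Hr Hs Hu.
  assert (Hd : 0 < Cmod (s0 - 1)%C) by (apply Cmod_gt_0, Cminus_neq_0; auto).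
  destruct (fam_Phi r 1 s0 u Hr (Rle_refl 1)) as [M HM].
  eexists. unfold Cminus. apply fam_plus.
  2:{ apply (fam_const r 1 (fun _ => - (1))%C); intros; [apply Ccont_const|rewrite Cmod_opp, Cmod_1; lra]. }
  (* The degenerate interval [[1, 1]] fixes [y = 1], which is the Riemann case. *)
  apply fam_ext with (fun x w => Phi (s0 + u * w) (clamp 1 1 x) * / ((s0 - 1) + u * w))%C.
  - intros x w Hw. assert (C1 := clamp_range 1 1 x (Rle_refl 1)). replace (clamp 1 1 x) with 1 by lra.
    unfold riemann_zeta. rewrite hurwitz_zeta_eq; [|intros E|lra].
    + unfold Cdiv. f_equal. f_equal. ring.
    + assert (F : (s0 - 1)%C = (- (u * w))%C).
      { replace s0 with (s0 + u * w - u * w)%C by ring. rewrite E. ring. }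
      rewrite F, Cmod_opp, Cmod_mult in Hu, Hd.
      assert (Cmod u * Cmod w <= Cmod u * r) by (apply Rmult_le_compat_l; auto using Cmod_ge_0). lra.
  - apply fam_mult; auto; [exact HM|]. apply fam_inv_affine with (d := Cmod (s0 - 1)%C); auto. lra.
Qed.

(** From index 2 on the argument has real part at least 2 on the disc, so the Dirichlet series is at
    hand, and [(k+2)^(-2-n) <= (k+2)^(-2) 2^(-n)] gives the decay. *)
Lemma fam_zeta_tail (r : R) (b0 u : C) : 0 < r -> Cmod u * r <= Re b0 ->
  exists K, forall n, fam r (K * (1 / 2) ^ n) (fun _ w => riemann_zeta (b0 + u * w + RtoC (INR (n + 2))) - 1)%C.
Proof.
  intros Hr Hu.
  assert (E2 : ex_series (fun k => Rpower (INR (S k)) (- (2)))) by (apply ex_series_Riemann; lra).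
  exists (Series (fun k => Rpower (INR (S k)) (- (2)))). intros n.
  rewrite <- Series_scal_r.
  apply fam_series with (fun k (_ : R) w => Rcpow (INR k + 2) (- (b0 + u * w + RtoC (INR (n + 2))))); auto.
  - intros k. assert (P := pos_INR k). assert (Q := pos_INR n).
    apply fam_ext with (fun (_ : R) w => Rcpow (INR k + 2) (- (b0 + RtoC (INR (n + 2))) + (- u) * w)).
    { intros _ w _. f_equal; ring. }
    eapply fam_le; [|apply (fam_Rcpow r (Rpower (INR k + 2) (- (Re b0 + INR (n + 2)))) (ln (INR k + 2)) (fun _ => INR k + 2)); auto].
    + rewrite Cmod_opp. replace (exp (Cmod u * ln (INR k + 2) * r)) with (Rpower (INR k + 2) (Cmod u * r))
        by (unfold Rpower; f_equal; ring).
      rewrite <- Rpower_plus.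
      apply Rle_trans with (Rpower (INR k + 2) (- (2 + INR n))).
      { apply Rle_Rpower; [lra|]. rewrite plus_INR. simpl (INR 2). lra. }
      eapply Rle_trans; [apply Rpower_shift_nat_le; lra|].
      apply Rmult_le_compat_r; [apply pow_le; lra|]. apply Rpower_anti; [lra|]. rewrite S_INR; lra.
    + intros; lra.
    + intros; apply continuous_const.
    + intros _. replace (Re (- (b0 + RtoC (INR (n + 2))))%C) with (- (Re b0 + INR (n + 2))) by (destruct b0; auto). lra.
    + intros _. rewrite Rabs_pos_eq; [lra|apply ln_nonneg; lra].
  - destruct E2 as [l Hl]. exists (l * (1 / 2) ^ n). apply is_series_scal_r; auto.
  - intros _ w Hw. apply zeta_minus_1_series.
    assert (H := Re_affine_bound b0 u w r Hw).
    replace (Re (b0 + u * w + RtoC (INR (n + 2)))%C) with (Re (b0 + u * w)%C + INR (n + 2)) by (destruct b0, u, w; auto).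
    rewrite plus_INR. simpl (INR 2). generalize (pos_INR n); lra.
Qed.

(** The indices 0 and 1 may fall outside the half-plane of convergence and are treated through
    [Phi]; this is where the poles [b0 = 1] and [b0 = 0] must be avoided. *)
Lemma fam_zeta_shift (r : R) (b0 u : C) : 0 < r -> Cmod u * r <= Re b0 -> b0 <> 1 -> b0 <> 0 ->
  2 * Cmod u * r <= Cmod (b0 - 1)%C -> 2 * Cmod u * r <= Cmod b0 ->
  exists K, forall n, fam r (K * (1 / 2) ^ n) (fun _ w => riemann_zeta (b0 + u * w + RtoC (INR n)) - 1)%C.
Proof.
  intros Hr Hu H1 H0 Hu1 Hu0.
  destruct (fam_zeta_tail r b0 u Hr Hu) as [K2 F2].
  destruct (fam_riemann_zeta r b0 u Hr H1 Hu1) as [K0 F0].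
  destruct (fam_riemann_zeta r (b0 + 1) u Hr) as [K1 F1].
  { intros E; apply H0. replace b0 with (b0 + 1 - 1)%C by ring. rewrite E; ring. }
  { replace (b0 + 1 - 1)%C with b0 by ring. auto. }
  assert (P0 := fam_M_pos _ _ _ Hr F0). assert (P1 := fam_M_pos _ _ _ Hr F1).
  assert (P2 := fam_M_pos _ _ _ Hr (F2 O)). simpl in P2.
  (* The factors 2 and 4 undo [(1/2)^n] at [n = 1] and in the shift of the index by two. *)
  exists (K0 + 2 * K1 + 4 * K2). intros [|[|n]].
  - apply fam_le with K0; [simpl; lra|]. apply fam_ext with (2 := F0).
    intros _ w _. simpl. f_equal. f_equal. ring.
  - apply fam_le with K1; [simpl; lra|]. apply fam_ext with (2 := F1).
    intros _ w _. simpl. f_equal. f_equal. ring.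
  - apply fam_le with (K2 * (1/2) ^ n).
    + simpl. assert (0 <= (1/2) ^ n) by (apply pow_le; lra). nra.
    + apply fam_ext with (2 := F2 n). intros _ w _. rewrite Nat.add_comm. auto.
Qed.

(* [Cbeta (1-a) (1-b)] rewritten through [beta_decomposition] at [m = 2], where
   the middle integral is over a point. *)
Definition beta_halves (a b : C) : C :=
  (Rcpow 2 (a + b - 1) * (incomplete 2 a b + incomplete 2 b a))%C.

Lemma beta_halves_eq (a b : C) : not_pos_int a -> not_pos_int b -> beta_halves a b = Cbeta (1 - a) (1 - b).
Proof.
  intros Ha Hb. assert (D := beta_decomposition 2 a b (Rle_refl 2) Ha Hb). unfold beta_decomp in D.
  replace (beta_mid 2 a b) with (RtoC 0) in D.
  2:{ symmetry. apply CInt_eq. replace (2 - 1) with 1 by ring. apply (@is_RInt_point C_R_NormedModule). }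
  unfold beta_halves. replace (incomplete 2 a b + incomplete 2 b a)%C with (0 + incomplete 2 a b + incomplete 2 b a)%C by ring.
  rewrite D. replace (1 - a - b)%C with (- (a + b - 1))%C by ring. rewrite Rcpow_opp.
  assert (N := Rcpow_neq_0 2 (a + b - 1)). field; auto.
Qed.

(** [Csum] makes this a total function, and [beta_halves] replaces the beta factor because
    [fam_poch_series] gives its analyticity. *)
Definition expansion_defect (a b : C) : C :=
  (J a b - (beta_halves a b * (riemann_zeta (a + b - 1) - 1)
    - Csum (J_series_term a b) - Csum (J_series_term b a)))%C.

(** The poles to avoid are the zeros of [n + 1 - a] and [n + 1 - b], and [a + b = 2] for
    [zeta(a+b-1)]; positive real parts exclude the poles of [zeta(a+1)] and [zeta(b+1)]. *)
Lemma fam_expansion_defect (a0 b0 u : C) : 0 < Re a0 -> 0 < Re b0 -> not_pos_int a0 -> not_pos_int b0 ->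
  (a0 + b0)%C <> 2 ->
  Cser (J_series_term a0 b0) (Csum (J_series_term a0 b0)) /\
  Cser (J_series_term b0 a0) (Csum (J_series_term b0 a0)) /\
  exists r M, 0 < r /\ fam r M (fun _ w => expansion_defect (a0 + u * w) (b0 + u * w)).
Proof.
  intros Ra Rb Na Nb Hab.
  destruct (not_pos_int_dist a0 Na) as [da [Hda HDa]].
  destruct (not_pos_int_dist b0 Nb) as [db [Hdb HDb]].
  assert (Ca := re_le_Cmod a0). rewrite Rabs_pos_eq in Ca by lra.
  assert (Cb := re_le_Cmod b0). rewrite Rabs_pos_eq in Cb by lra.
  assert (a0n : a0 <> 0) by (apply Cmod_gt_0; lra).
  assert (b0n : b0 <> 0) by (apply Cmod_gt_0; lra).
  assert (a1 : a0 <> 1) by (apply (Na O)). assert (b1 : b0 <> 1) by (apply (Nb O)).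
  assert (Da1 : da <= Cmod (a0 - 1)%C).
  { specialize (HDa O). replace (RtoC (INR 0) + 1 - a0)%C with (- (a0 - 1))%C in HDa by (simpl; ring).
    rewrite Cmod_opp in HDa; auto. }
  assert (Db1 : db <= Cmod (b0 - 1)%C).
  { specialize (HDb O). replace (RtoC (INR 0) + 1 - b0)%C with (- (b0 - 1))%C in HDb by (simpl; ring).
    rewrite Cmod_opp in HDb; auto. }
  set (dc := Cmod (a0 + b0 - 2)%C).
  assert (Hdc : 0 < dc) by (apply Cmod_gt_0, Cminus_neq_0; auto).
  (* At most the modulus of every quantity that must not vanish; the radius chosen below makes
     [|u w|] at most a quarter of it. *)
  set (k := Rmin (Rmin da db) (Rmin dc (Rmin (Re a0) (Re b0)))).
  assert (Hk : 0 < k) by (unfold k; repeat apply Rmin_pos; lra).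
  assert (k1 : k <= da) by (unfold k; eapply Rle_trans; [apply Rmin_l|apply Rmin_l]).
  assert (k2 : k <= db) by (unfold k; eapply Rle_trans; [apply Rmin_l|apply Rmin_r]).
  assert (k3 : k <= dc) by (unfold k; eapply Rle_trans; [apply Rmin_r|apply Rmin_l]).
  assert (k4 : k <= Re a0) by (unfold k; eapply Rle_trans; [apply Rmin_r|eapply Rle_trans; [apply Rmin_r|apply Rmin_l]]).
  assert (k5 : k <= Re b0) by (unfold k; eapply Rle_trans; [apply Rmin_r|eapply Rle_trans; [apply Rmin_r|apply Rmin_r]]).
  clearbody k. assert (Pu := Cmod_ge_0 u).
  set (r := k / (4 * Cmod u + 1)).
  assert (Hr : 0 < r) by (apply Rdiv_lt_0_compat; lra).
  assert (Hur : 4 * (Cmod u * r) <= k).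
  { unfold r. apply Rmult_le_reg_r with (4 * Cmod u + 1); [lra|].
    replace (4 * (Cmod u * (k / (4 * Cmod u + 1))) * (4 * Cmod u + 1)) with (4 * Cmod u * k) by (field; lra).
    nra. }
  assert (Hur0 : 0 <= Cmod u * r) by (apply Rmult_le_pos; lra).
  clearbody r.
  destruct (fam_zeta_shift r a0 u Hr) as [Ka Za]; auto; try lra.
  destruct (fam_zeta_shift r b0 u Hr) as [Kb Zb]; auto; try lra.
  destruct (fam_poch_series r Kb da a0 b0 u (fun n w => riemann_zeta (b0 + u * w + RtoC (INR n)) - 1)%C)
    as [Sba [Mba Fba]]; auto; try lra.
  destruct (fam_poch_series r Ka db b0 a0 u (fun n w => riemann_zeta (a0 + u * w + RtoC (INR n)) - 1)%C)
    as [Sab [Mab Fab]]; auto; try lra.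
  destruct (fam_poch_series r (Rpower 2 (- Re b0) * exp (Cmod u * ln 2 * r)) da a0 b0 u (fun n w => Rcpow 2 (- (b0 + u * w + RtoC (INR n)))) Hr
    ltac:(lra) HDa ltac:(lra) ltac:(lra) (fun n => fam_two_pow r b0 u n Hr)) as [_ [M1 F1]].
  destruct (fam_poch_series r (Rpower 2 (- Re a0) * exp (Cmod u * ln 2 * r)) db b0 a0 u (fun n w => Rcpow 2 (- (a0 + u * w + RtoC (INR n)))) Hr
    ltac:(lra) HDb ltac:(lra) ltac:(lra) (fun n => fam_two_pow r a0 u n Hr)) as [_ [M2 F2]].
  assert (Z0 : Cmod 0 <= r) by (rewrite Cmod_0; lra).
  split; [|split].
  - specialize (Sab 0 Z0). rewrite Cmult_0_r, !Cplus_0_r in Sab. exact Sab.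
  - specialize (Sba 0 Z0). rewrite Cmult_0_r, !Cplus_0_r in Sba. exact Sba.
  - destruct (fam_riemann_zeta r (a0 + b0 - 1) (2 * u) Hr) as [Mz Fz].
    { intros E; apply Hab. replace (a0 + b0)%C with (a0 + b0 - 1 + 1)%C by ring. rewrite E.
      rewrite <- RtoC_plus. f_equal; ring. }
    { replace (a0 + b0 - 1 - 1)%C with (a0 + b0 - 2)%C by ring. fold dc.
      rewrite Cmod_mult, Cmod_R, Rabs_pos_eq by lra. lra. }
    destruct (fam_JPhi r a0 b0 u u Hr) as [MJ FJ].
    assert (FP : fam r (Rpower 2 (Re (a0 + b0 - 1)%C) * exp (Cmod (2 * u)%C * ln 2 * r))
      (fun _ w => Rcpow 2 ((a0 + b0 - 1) + (2 * u) * w))).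
    { apply (fam_Rcpow r (Rpower 2 (Re (a0 + b0 - 1)%C)) (ln 2) (fun _ => 2)); auto; intros; try lra.
      - apply continuous_const.
      - rewrite Rabs_pos_eq; [lra|apply ln_nonneg; lra]. }
    exists r. eexists. split; auto.
    apply fam_ext with (fun _ w =>
      JPhi (a0 + u * w) (b0 + u * w) * / ((a0 - 1) + u * w) * / ((b0 - 1) + u * w) +
      - (1) * (Rcpow 2 ((a0 + b0 - 1) + (2 * u) * w) *
        (Csum (poch_term (fun n => Rcpow 2 (- (b0 + u * w + RtoC (INR n)))) (a0 + u * w) (b0 + u * w)) +
         Csum (poch_term (fun n => Rcpow 2 (- (a0 + u * w + RtoC (INR n)))) (b0 + u * w) (a0 + u * w))) *
        (riemann_zeta ((a0 + b0 - 1) + (2 * u) * w) - 1))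
      + Csum (poch_term (fun n => riemann_zeta (a0 + u * w + RtoC (INR n)) - 1) (b0 + u * w) (a0 + u * w))
      + Csum (poch_term (fun n => riemann_zeta (b0 + u * w + RtoC (INR n)) - 1) (a0 + u * w) (b0 + u * w)))%C.
    + intros _ w Hw.
      assert (Huw : Cmod u * Cmod w <= Cmod u * r) by (apply Rmult_le_compat_l; auto).
      assert (NE : forall z : C, k <= Cmod (z - 1)%C -> (z + u * w)%C <> 1).
      { intros z Hz E. assert (F : (z - 1)%C = (- (u * w))%C).
        { replace z with (z + u * w - u * w)%C by ring. rewrite E. ring. }
        rewrite F, Cmod_opp, Cmod_mult in Hz. lra. }
      assert (A1 := NE a0 ltac:(lra)). assert (B1 := NE b0 ltac:(lra)).
      unfold expansion_defect. rewrite J_eq by auto.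
      unfold beta_halves, incomplete.
      replace (a0 + b0 - 1 + 2 * u * w)%C with (a0 + u * w + (b0 + u * w) - 1)%C by ring.
      replace (a0 - 1 + u * w)%C with (a0 + u * w - 1)%C by ring.
      replace (b0 - 1 + u * w)%C with (b0 + u * w - 1)%C by ring.
      apply Cminus_neq_0 in A1. apply Cminus_neq_0 in B1.
      change (poch_term (fun n => Rcpow 2 (- (b0 + u * w + RtoC (INR n)))) (a0 + u * w) (b0 + u * w))%C
        with (incomplete_term 2 (a0 + u * w) (b0 + u * w))%C.
      change (poch_term (fun n => Rcpow 2 (- (a0 + u * w + RtoC (INR n)))) (b0 + u * w) (a0 + u * w))%C
        with (incomplete_term 2 (b0 + u * w) (a0 + u * w))%C.
      change (poch_term (fun n => riemann_zeta (a0 + u * w + RtoC (INR n)) - 1) (b0 + u * w) (a0 + u * w))%C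
        with (J_series_term (a0 + u * w) (b0 + u * w))%C.
      change (poch_term (fun n => riemann_zeta (b0 + u * w + RtoC (INR n)) - 1) (a0 + u * w) (b0 + u * w))%C
        with (J_series_term (b0 + u * w) (a0 + u * w))%C.
      field. auto.
    + apply fam_plus; [apply fam_plus; [apply fam_plus|exact Fab]|exact Fba].
      * apply fam_mult; auto; [apply fam_mult; auto; [exact FJ|]|].
        -- apply fam_inv_affine with (d := da); auto; lra.
        -- apply fam_inv_affine with (d := db); auto; lra.
      * eapply (fam_scal r) with (B := 1) (h := fun _ => (- (1))%C); auto.
        -- intros; apply Ccont_const.
        -- intros; rewrite Cmod_opp, Cmod_1; lra.
        -- apply fam_mult; auto; [|exact Fz]. apply fam_mult; auto; [exact FP|].
           apply fam_plus; [exact F1|exact F2].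
Qed.

(** On the segment the real part stays below 2, so 1 is the only positive integer in reach; it would
    be met at [t = 1 - Re z], where the imaginary part is positive by assumption. *)
Lemma not_pos_int_strip (z : C) (t tau : R) : 0 < Re z < 1 -> 0 <= t <= 1 ->
  0 < Im z + (1 - Re z) * tau -> not_pos_int (z + RtoC t * (1, tau))%C.
Proof.
  intros Hz Ht Htau n E. destruct z as [x y]. simpl in Hz, Htau.
  assert (E1 := f_equal Re E). assert (E2 := f_equal Im E).
  change (x + (t * 1 - 0 * tau) = INR (S n)) in E1.
  change (y + (t * tau + 0 * 1) = 0) in E2.
  destruct n.
  - simpl in E1. assert (t = 1 - x) by lra. subst t. lra.
  - assert (P := pos_INR n). rewrite !S_INR in E1. lra.
Qed.

Lemma J_expansion_strip (a b : C) : 0 < Re a < 1 -> 0 < Re b < 1 -> J_expansion a b.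
Proof.
  intros Ha Hb.
  (* The slope [tau] is chosen so that the segment from [(a, b)] to
     [(a + 1 + i tau, b + 1 + i tau)] avoids all poles of the expansion. *)
  set (tau := 1 + Rabs (Im a) / (1 - Re a) + Rabs (Im b) / (1 - Re b)).
  (* The quotient in [tau] with denominator [1 - Re a] contributes exactly [|Im a|] to the product,
     and the summand 1 makes the inequality strict. *)
  assert (Ta : 0 < Im a + (1 - Re a) * tau).
  { unfold tau.
    replace ((1 - Re a) * (1 + Rabs (Im a) / (1 - Re a) + Rabs (Im b) / (1 - Re b))) with
      ((1 - Re a) + Rabs (Im a) + (1 - Re a) * (Rabs (Im b) / (1 - Re b))) by (field; lra).
    assert (0 <= (1 - Re a) * (Rabs (Im b) / (1 - Re b))).
    { apply Rmult_le_pos; [lra|]. apply Rmult_le_pos; [apply Rabs_pos|left; apply Rinv_0_lt_compat; lra]. }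
    generalize (Rle_abs (- Im a)). rewrite Rabs_Ropp. lra. }
  assert (Tb : 0 < Im b + (1 - Re b) * tau).
  { unfold tau.
    replace ((1 - Re b) * (1 + Rabs (Im a) / (1 - Re a) + Rabs (Im b) / (1 - Re b))) with
      ((1 - Re b) + Rabs (Im b) + (1 - Re b) * (Rabs (Im a) / (1 - Re a))) by (field; lra).
    assert (0 <= (1 - Re b) * (Rabs (Im a) / (1 - Re a))).
    { apply Rmult_le_pos; [lra|]. apply Rmult_le_pos; [apply Rabs_pos|left; apply Rinv_0_lt_compat; lra]. }
    generalize (Rle_abs (- Im b)). rewrite Rabs_Ropp. lra. }
  clearbody tau.
  set (u := (1, tau) : C).
  set (f := fun s : C => expansion_defect (a + s * u) (b + s * u)).
  assert (Rp : forall (z : C) (t : R), Re (z + RtoC t * u)%C = Re z + t).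
  { intros [x y] t. unfold u; simpl. ring. }
  assert (Ip : forall (z : C) (t : R), Im (z + RtoC t * u)%C = Im z + t * tau).
  { intros [x y] t. unfold u; simpl. ring. }
  assert (L : forall t, 0 <= t <= 1 ->
     Cser (J_series_term (a + RtoC t * u) (b + RtoC t * u)) (Csum (J_series_term (a + RtoC t * u) (b + RtoC t * u))) /\
     Cser (J_series_term (b + RtoC t * u) (a + RtoC t * u)) (Csum (J_series_term (b + RtoC t * u) (a + RtoC t * u))) /\
     exists r M, 0 < r /\ fam r M (fun _ w => expansion_defect (a + RtoC t * u + u * w) (b + RtoC t * u + u * w))).
  { intros t Ht. apply fam_expansion_defect.
    - rewrite Rp; lra.
    - rewrite Rp; lra.
    - apply not_pos_int_strip; auto.
    - apply not_pos_int_strip; auto.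
    (* If [a + b = 2] on the segment, the real parts fix [2 t], and the imaginary part is then the
       sum of the two positive quantities of [Ta] and [Tb]. *)
    - intros E. assert (E1 := f_equal Re E). assert (E2 := f_equal Im E).
      change (Re (a + RtoC t * u)%C + Re (b + RtoC t * u)%C = 2) in E1.
      change (Im (a + RtoC t * u)%C + Im (b + RtoC t * u)%C = 0) in E2.
      rewrite !Rp in E1. rewrite !Ip in E2.
      assert (Et : 2 * t = 2 - Re a - Re b) by lra.
      assert (2 * t * tau = (2 - Re a - Re b) * tau) by (rewrite Et; auto). lra. }
  assert (Z : f 0 = 0).
  (* Beyond this parameter both real parts exceed 1, where the expansion is already proved. *)
  { apply identity_on_segment with (Rmax (1 - Re a) (1 - Re b)).
    - split; [eapply Rle_trans; [|apply Rmax_l]; lra|apply Rmax_lub_lt; lra].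
    - intros t Ht. destruct (L t Ht) as (_ & _ & r & M & Hr & F).
      apply (fam_analytic r M); auto. apply fam_ext with (2 := F).
      intros _ w _. unfold f. f_equal; ring.
    - intros t Ht. assert (1 - Re a < t) by (eapply Rle_lt_trans; [apply Rmax_l|apply Ht]).
      assert (1 - Re b < t) by (eapply Rle_lt_trans; [apply Rmax_r|apply Ht]).
      destruct (L t ltac:(lra)) as (S1 & S2 & _).
      assert (Na := not_pos_int_strip a t tau Ha ltac:(lra) Ta).
      assert (Nb := not_pos_int_strip b t tau Hb ltac:(lra) Tb). fold u in Na, Nb.
      destruct (J_expansion_convergent (a + RtoC t * u) (b + RtoC t * u)) as (s1 & s2 & T1 & T2 & E); auto.
      + rewrite Rp; lra.
      + rewrite Rp; lra.
      + unfold f, expansion_defect. rewrite beta_halves_eq by auto.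
        rewrite (Csum_eq _ _ T1), (Csum_eq _ _ T2), E. ring. }
  destruct (L 0 ltac:(lra)) as (S1 & S2 & _).
  assert (N : forall z : C, 0 < Re z < 1 -> not_pos_int z).
  { intros z Hz n E. rewrite E in Hz. change (0 < INR (S n) < 1) in Hz.
    generalize (INR_S_ge_1 n); lra. }
  unfold f in Z. rewrite !Cmult_0_l, !Cplus_0_r in *.
  exists (Csum (J_series_term a b)), (Csum (J_series_term b a)). split; [exact S1|split; [exact S2|]].
  unfold expansion_defect in Z. rewrite <- beta_halves_eq by auto.
  match type of Z with (?x - ?y)%C = _ => replace x with (x - y + y)%C by ring end. rewrite Z. ring.
Qed.

End Continuation.

Theorem theorem3 :
  (forall a b : C, a <> RtoC 1 -> b <> RtoC 1 ->
     @ex_RInt C_R_NormedModule (J_integrand a b) 0%R 1%R) /\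
  (forall a b : C,
     (0 < Re a < 1)%R -> (0 < Re b < 1)%R ->
     J_expansion a b) /\
  (forall a b : C,
     (1 < Re a)%R -> (1 < Re b)%R ->
     (forall k : nat, (2 <= k)%nat ->
        a <> RtoC (INR k) /\ b <> RtoC (INR k)) ->
     J_expansion a b) /\
  (forall a b : C,
     (0 < Re a)%R -> (0 < Re b)%R -> a <> RtoC 1 -> b <> RtoC 1 ->
     analytic2_at J a b) /\
  has_pole_of_order 2 (fun a : C => J a a) (RtoC 1).
Proof.
  split; [|split; [|split; [|split]]].
  - intros a b Ha Hb. exists (JPhi a b / ((a - 1) * (b - 1)))%C. apply is_CInt_J; auto.
  - exact J_expansion_strip.
  (* [not_pos_int] also excludes the integer 1, which the real parts above 1 rule out. *)
  - intros a b Ha Hb Hk. apply J_expansion_convergent; auto; intros [|n] E.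
    + rewrite E in Ha. simpl in Ha. lra.
    + apply (proj1 (Hk (S (S n)) ltac:(lia))); auto.
    + rewrite E in Hb. simpl in Hb. lra.
    + apply (proj2 (Hk (S (S n)) ltac:(lia))); auto.
  - intros a b _ _ Ha Hb. apply J_analytic2; auto.
  - exact J_double_pole.
Qed.
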